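(* There exist an irrational $\alpha\in\mathbb{R}\setminus\mathbb{Q}$ and a discrete-time cocycle in $\mathrm{SL}_2(\mathbb{R})$ over the circle rotation by $\alpha$, generated by a continuous map $A:S^1\to\mathrm{SL}_2(\mathbb{R})$, such that $A$ is non-uniformly hyperbolic and has a canonical extension $\Phi$ to a continuous-time cocycle in $\mathrm{SL}_2(\mathbb{R})$ over the suspension flow by $\alpha$ (which is uniquely ergodic), and $\Phi$ is non-uniformly hyperbolic. In particular, there is a continuous-time cocycle in $\mathrm{SL}_2(\mathbb{R})$ over a uniquely ergodic driving which is non-uniformly hyperbolic.
   Context: The circle $S^1$ is $[0,1]$ with endpoints identified (i.e. $\mathbb{R}/\mathbb{Z}$). The circle rotation by $\alpha$ is $\phi:S^1\to S^1$, $\phi(\theta)=\theta+\alpha \bmod 1$; for irrational $\alpha$ it is uniquely ergodic with respect to Lebesgue measure. Discrete-time cocycle over $\phi$: for continuous $A:S^1\to\mathrm{SL}_2(\mathbb{R})$, $\theta\mapsto A_\theta$, the $n$-step map ($n\in\mathbb{Z}$) is $A^n_\theta = A_{\phi^{n-1}\theta}\cdots A_{\phi\theta}A_\theta$ for $n>0$, $A^0_\theta=\mathrm{Id}$, and $A^n_\theta = A^{-1}_{\phi^{n}\theta}\cdots A^{-1}_{\phi^{-2}\theta}A^{-1}_{\phi^{-1}\theta}$ for $n<0$. Suspension flow by $\alpha$: on the mapping torus $\Theta_1=(S^1\times[0,1])/\sim$ with $(\theta,1)\sim(\theta+\alpha \bmod 1,0)$ and the quotient topology, it is the flow $\phi^t(\theta,r)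 = (\theta+\lfloor r+t\rfloor\alpha,\ r+t) \bmod 1$, $t\in\mathbb{R}$. For irrational $\alpha$ its unique invariant probability measure is Lebesgue measure. Continuous-time cocycle in $\mathrm{SL}_2(\mathbb{R})$ over the suspension flow: the map $\Phi:\Theta_1\times\mathbb{R}\to\mathrm{SL}_2(\mathbb{R})$, $((\theta,r),t)\mapsto\Phi^t_{(\theta,r)}$, generated by a continuous map $G:\Theta_1\to\mathfrak{sl}_2(\mathbb{R})$ (real trace-zero $2\times2$ matrices), i.e. the unique solution of $\Phi^0_{(\theta,r)}=\mathrm{Id}$, $\partial_t\Phi^t_{(\theta,r)} = G(\phi^t(\theta,r))\,\Phi^t_{(\theta,r)}$. Canonical extension: $\Phi$ is a canonical extension of $A$ if $\Phi^n_{(\theta,0)}=A^n_\theta$ for all $n\in\mathbb{Z}$, $\theta\in S^1$. Hyperbolicity (discrete and continuous time alike): let $\mathfrak{T}=\mathbb{Z}$, $\Omega=S^1$ or $\mathfrak{T}=\mathbb{R}$, $\Omega=\Theta_1$; write $\Phi^t_\omega$ for the cocycle (in discrete time $\Phi^t_\omega=A^t_\omega$), $\phi^t$ for the driving, and $\mu$ for its invariant (ergodic) probability measure. The Furstenberg--Kesten limit $\Lambda(\omega)=\lim_{t\to\infty}\frac1t\log\|\Phi^t_\omega\|$ exists and equals a constant $\Lambda^*$ for $\mu$-a.e. $\omega$. The cocycle is hyperbolic if $\Lambda^*>0$. It is uniformly hyperbolic if there are constants $C>0$, $\lambda>0$ and, for each $\omega\in\Omega$, a splitting $\mathbb{R}^2=U(\omega)\oplus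 S(\omega)$, continuous in $\omega$ with respect to the Grassmannian topology, such that: (i) $\Phi^t_\omega U(\omega)=U(\phi^t\omega)$ and $\Phi^t_\omega S(\omega)=S(\phi^t\omega)$ for all $t\in\mathfrak{T}$; (ii) $\|\Phi^t_\omega u\|\ge Ce^{\lambda t}\|u\|$ for all $u\in U(\omega)$, $t\in\mathfrak{T}_{\ge0}$; (iii) $\|\Phi^t_\omega s\|\le C^{-1}e^{-\lambda t}\|s\|$ for all $s\in S(\omega)$, $t\in\mathfrak{T}_{\ge0}$. It is non-uniformly hyperbolic if it is hyperbolic but not uniformly hyperbolic. *)

(* Defs.v *)
From HB Require Import structures.
From mathcomp Require Import all_boot all_order all_algebra.
From mathcomp Require Import all_classical all_reals all_analysis.
From mathcomp Require Import measurable_realfun.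
Set Implicit Arguments.
Unset Strict Implicit.
Unset Printing Implicit Defensive.
Import Order.TTheory GRing.Theory Num.Theory.
Import numFieldNormedType.Exports.
Local Open Scope classical_set_scope.
Local Open Scope ring_scope.
Local Open Scope quotient_scope.

(* The circle is R modulo Z, with the quotient topology. *)
Section circle.
Context {R : realType}.

Definition circle_eqb (x y : R) : bool := (x - y) \is a Num.int.

Lemma circle_rel_refl : reflexive circle_eqb.
Proof. by move=> x; rewrite /circle_eqb subrr rpred0. Qed.

Lemma circle_rel_sym : symmetric circle_eqb.
Proof. by move=> x y; rewrite /circle_eqb -opprB rpredN. Qed.

Lemma circle_rel_trans : transitive circle_eqb.
Proof.
by move=> y x z xy yz; rewrite /circle_eqb -(subrKA y) rpredD.
Qed.

Definition circle_rel :=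
  EquivRel circle_eqb circle_rel_refl circle_rel_sym circle_rel_trans.

End circle.

Definition circle (R : realType) := {eq_quot (@circle_rel R)}.

HB.instance Definition _ (R : realType) :=
  Topological.copy (circle R) (quotient_topology (circle R)).
HB.instance Definition _ (R : realType) := Quotient.on (circle R).
HB.instance Definition _ (R : realType) :=
  isPointed.Build (circle R) (\pi_(circle R) 0).

(* The choice of representative is irrelevant: translations of R preserve
   congruence modulo Z. *)
Definition rotate {R : realType} (a : R) (theta : circle R) : circle R :=
  \pi_(circle R) (repr theta + a).

Lemma rotate_inj {R : realType} (a : R) : injective (@rotate R a).
Proof.
move=> x y /eqmodP/= xy; rewrite -[x]reprK -[y]reprK; apply/eqmodP => /=.
by move: xy; rewrite /circle_eqb opprD addrACA subrr addr0.
Qed.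

Notation unit_itv R := (set_type `[0%R : R, 1%R]%classic).

Lemma clamp_subproof {R : realType} (r : R) :
  Num.max 0 (Num.min r 1) \in `[0%R : R, 1%R]%classic.
Proof.
by rewrite inE/= in_itv/= le_max lexx ge_max ler01 ge_min lexx orbT.
Qed.

Definition clamp {R : realType} (r : R) : unit_itv R :=
  exist _ (Num.max 0 (Num.min r 1)) (clamp_subproof r).

Section torus.
Context {R : realType} (alpha : R).
Local Notation cyl := (circle R * unit_itv R)%type.

Definition torus_glue (x y : cyl) : bool :=
  [&& \val x.2 == 1, \val y.2 == 0 & y.1 == rotate alpha x.1].

Definition torus_eqb (x y : cyl) : bool := [|| x == y, torus_glue x y | torus_glue y x].

Lemma torus_rel_refl : reflexive torus_eqb.
Proof. by move=> x; rewrite /torus_eqb eqxx. Qed.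

Lemma torus_rel_sym : symmetric torus_eqb.
Proof. by move=> x y; rewrite /torus_eqb eq_sym orbCA orbC -orbA orbCA. Qed.

Lemma torus_rel_trans : transitive torus_eqb.
Proof.
have no x y z : torus_glue x y -> torus_glue y z -> False.
  move=> /and3P[_ /eqP y0 _] /and3P[/eqP y1 _ _].
  by move: y1; rewrite y0 => /esym/eqP; rewrite oner_eq0.
move=> y x z /or3P[/eqP->//|xy|yx] /or3P[/eqP<-|yz|zy].
- by rewrite /torus_eqb xy orbT.
- by case: (no _ _ _ xy yz).
- apply/orP; left; apply/eqP.
  case/and3P: xy => /eqP x1 _ /eqP yx; case/and3P: zy => /eqP z1 _ /eqP yz.
  case: x x1 yx => x r /= x1 yx; case: z z1 yz => z s /= z1 yz.
  by congr pair; [apply: (@rotate_inj _ alpha); rewrite -yx|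
    apply: val_inj; rewrite /= x1].
- by rewrite /torus_eqb yx !orbT.
- apply/orP; left; apply/eqP.
  case/and3P: yx => _ /eqP x0 /eqP xy; case/and3P: yz => _ /eqP z0 /eqP zy.
  case: x x0 xy => x r /= x0 xy; case: z z0 zy => z s /= z0 zy.
  by congr pair; [rewrite xy|apply: val_inj; rewrite /= x0].
- by case: (no _ _ _ zy yx).
Qed.

Definition torus_rel :=
  EquivRel torus_eqb torus_rel_refl torus_rel_sym torus_rel_trans.

End torus.

(* S^1 x [0,1] with (theta, 1) identified with (theta + alpha, 0) *)
Definition torus {R : realType} (alpha : R) := {eq_quot (torus_rel alpha)}.

HB.instance Definition _ (R : realType) (alpha : R) :=
  Topological.copy (torus alpha) (quotient_topology (torus alpha)).
HB.instance Definition _ (R : realType) (alpha : R) :=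
  Quotient.on (torus alpha).
HB.instance Definition _ (R : realType) (alpha : R) :=
  isPointed.Build (torus alpha) (\pi_(torus alpha) (point, clamp 0)).

(* The point of the suspension that lies at height r above theta, for any real
   r: "(theta + floor r * alpha, r) mod 1". *)
Definition torus_pt {R : realType} (alpha : R) (theta : circle R) (r : R) :
    torus alpha :=
  \pi_(torus alpha)
    (rotate ((Num.floor r)%:~R * alpha) theta, clamp (r - (Num.floor r)%:~R)).

Definition suspension_flow {R : realType} (alpha : R) (t : R)
    (w : torus alpha) : torus alpha :=
  let: (theta, r) := repr w in torus_pt alpha theta (\val r + t).

(* n-th iterate of the rotation by alpha *)
Definition rotation {R : realType} (alpha : R) (n : int) (theta : circle R) :
    circle R := rotate (n%:~R * alpha) theta.

Notation borel T := (g_sigma_algebraType (@open T)).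

Lemma borel_measurable_fun d (T : measurableType d) (X : ptopologicalType)
    (f : T -> borel X) :
  (forall U : set X, open U -> measurable (f @^-1` U)) ->
  measurable_fun [set: T] f.
Proof.
move=> fU; apply: (@measurability _ _ _ (borel X) _ _ (@open X)) => //.
by move=> _ [U oU <-]; rewrite setTI; exact: fU.
Qed.

Section lebesgue.
Context {R : realType}.

Lemma open_measurable2 (U : set (R * R)) : open U ->
  measurable (U : set (measurableTypeR R * measurableTypeR R)).
Proof.
move=> oU.
pose box (q : (rat * rat) * (rat * rat)) : set (R * R) :=
  `]ratr q.1.1, ratr q.1.2[%classic `*` `]ratr q.2.1, ratr q.2.2[%classic.
have -> : U = \bigcup_(q in [set q | box q `<=` U]) box q.
  apply/seteqP; split => [[x y] Uxy|z [q /= qU]]; last exact: qU.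
  have : nbhs (x, y) U by exact: open_nbhs_nbhs.
  move=> [[/= A B] [/nbhs_ballP[e /= e0 eA] /nbhs_ballP[d /= d0 dB]] ABU].
  have ratI (a b : R) : a < b -> exists q, a < ratr q < b.
    by move=> /rat_in_itvoo[q]; rewrite in_itv/=; exists q.
  have [a1 /andP[ea1 a1x]] : exists q, x - e < ratr q < x.
    by apply: ratI; rewrite ltrBlDr ltrDl.
  have [a2 /andP[xa2 a2e]] : exists q, x < ratr q < x + e.
    by apply: ratI; rewrite ltrDl.
  have [b1 /andP[db1 b1y]] : exists q, y - d < ratr q < y.
    by apply: ratI; rewrite ltrBlDr ltrDl.
  have [b2 /andP[yb2 b2d]] : exists q, y < ratr q < y + d.
    by apply: ratI; rewrite ltrDl.
  exists ((a1, a2), (b1, b2)) => /=; last first.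
    by split; rewrite /= in_itv/= ?a1x ?b1y.
  move=> [u v] [/=]; rewrite !in_itv/= => /andP[a1u ua2] /andP[b1v vb2].
  apply: ABU; split => /=.
    apply: eA; rewrite /ball/= ltr_distlC; apply/andP; split.
      exact: lt_trans a1u.
    exact: lt_trans a2e.
  apply: dB; rewrite /ball/= ltr_distlC; apply/andP; split.
    exact: lt_trans b1v.
  exact: lt_trans b2d.
rewrite bigcup_mkcond; apply: countable_bigcupT_measurable => // q.
by case: ifP => // _; apply: measurableX; exact: measurable_itv.
Qed.

Definition lebesgue_unit : set (measurableTypeR R) -> \bar R :=
  mrestr (@lebesgue_measure R) (measurable_itv `[0%R : R, 1%R]).

HB.instance Definition _ := Measure.on lebesgue_unit.

Lemma lebesgue_unit_setT : lebesgue_unit setT = 1%E.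
Proof.
rewrite /lebesgue_unit/mrestr/= setTI lebesgue_measure_itv/=.
by rewrite lte_fin ltr01 oppr0 adde0.
Qed.

HB.instance Definition _ := Measure_isProbability.Build _ _ _ lebesgue_unit
  lebesgue_unit_setT.

Definition circle_proj (x : measurableTypeR R) : borel (circle R) :=
  \pi_(circle R) x.

Lemma measurable_circle_proj : measurable_fun setT circle_proj.
Proof.
by apply: borel_measurable_fun => U oU; apply: open_measurable; exact: oU.
Qed.

HB.instance Definition _ :=
  isMeasurableFun.Build _ _ _ _ circle_proj measurable_circle_proj.

Definition lebesgue_circle : probability (borel (circle R)) R :=
  distribution lebesgue_unit circle_proj.

Variable alpha : R.

(* [clamp] is only there to make the map total: the measure below is carried by
   the unit square. *)
Definition torus_proj (p : measurableTypeR R * measurableTypeR R) :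
    borel (torus alpha) :=
  \pi_(torus alpha) (\pi_(circle R) p.1, clamp p.2).

Lemma continuous_clamp : continuous (@clamp R).
Proof.
apply: continuous_comp_initial.
have : continuous ((cst 0 : R -> R^o) \max ((id : R -> R^o) \min cst 1)).
  move=> x; apply: continuous_max; first exact: cvg_cst.
  by apply: continuous_min; [exact: cvg_id|exact: cvg_cst].
exact.
Qed.

Lemma measurable_torus_proj : measurable_fun setT torus_proj.
Proof.
apply: borel_measurable_fun => U oU; apply: open_measurable2.
suff /continuousP : continuous (torus_proj : R * R -> torus alpha) by exact.
move=> p.
have h1 : {for p, continuous (fun p : R * R => \pi_(circle R) p.1)}.
  by apply: continuous_comp; [exact: cvg_fst|exact: pi_continuous].
have h2 : {for p, continuous (fun p : R * R => clamp p.2)}.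
  by apply: continuous_comp; [exact: cvg_snd|exact: continuous_clamp].
have h12 : {for p, continuous (fun p : R * R =>
    (\pi_(circle R) p.1, clamp p.2) : circle R * unit_itv R)}.
  exact: cvg_pair h1 h2.
exact: (continuous_comp h12 (@pi_continuous _ (torus alpha) _)).
Qed.

HB.instance Definition _ :=
  isMeasurableFun.Build _ _ _ _ torus_proj measurable_torus_proj.

Definition lebesgue_torus : probability (borel (torus alpha)) R :=
  distribution (lebesgue_unit \x lebesgue_unit)%E torus_proj.

End lebesgue.

Section ergodicity.
Context {R : realType} {T : Type} {Omega : ptopologicalType}.
Variable phi : T -> Omega -> Omega.

Definition invariant_probability (mu : probability (borel Omega) R) :=
  forall t (B : set (borel Omega)), measurable B -> mu (phi t @^-1` B) = mu B.

Definition uniquely_ergodic (mu : probability (borel Omega) R) :=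
  invariant_probability mu /\
  forall nu : probability (borel Omega) R, invariant_probability nu ->
    forall B : set (borel Omega), measurable B -> nu B = mu B.

End ergodicity.

Section norms.
Context {R : realType}.

Definition enorm (v : 'cV[R]_2) : R := Num.sqrt (\sum_i v i 0 ^+ 2).

Definition opnorm (M : 'M[R]_2) : R :=
  sup [set enorm (M *m v) | v in [set v | enorm v <= 1]].

End norms.

(* The Grassmannian of R^2, all dimensions together, topologized by embedding
   it in the matrices through V |-> orthogonal projection onto V. *)
Section grassmannian.
Context {R : realType}.

Definition basis_mx (V : {vspace 'cV[R]_2}) : 'M[R]_(2, \dim V) :=
  \matrix_(i, j) (tnth (vbasis V) j) i 0.

Definition orthoproj (V : {vspace 'cV[R]_2}) : 'M[R]_2 :=
  let B := basis_mx V in B *m invmx (B^T *m B) *m B^T.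

End grassmannian.

Definition grassmannian (R : realType) := {vspace 'cV[R]_2}.
HB.instance Definition _ (R : realType) :=
  Topological.copy (grassmannian R) (initial_topology (@orthoproj R)).

(* The time set T is Z or R; c : T -> R is its inclusion in R and F the filter
   of neighbourhoods of +oo in T. *)
Section hyperbolicity.
Context {R : realType} {T : Type} (c : T -> R) (F : set_system T).
Context {Omega : ptopologicalType}.
Variables (phi : T -> Omega -> Omega) (mu : probability (borel Omega) R).
Variable Phi : T -> Omega -> 'M[R]_2.

(* L is the almost everywhere constant value of the Furstenberg-Kesten limit. *)
Definition lyapunov_exponent (L : R) :=
  {ae mu, forall w : borel Omega,
    (fun t => ln (opnorm (Phi t w)) / c t) @ F --> L}.

Definition hyperbolic := exists L, lyapunov_exponent L /\ 0 < L.

Definition uniformly_hyperbolic :=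
  exists (C lambda : R) (U S : Omega -> grassmannian R),
    [/\ 0 < C, 0 < lambda, continuous U & continuous S] /\
    [/\ forall w, (U w + S w = fullv)%VS /\ directv (U w + S w)%VS,
        forall t w, (linfun (mulmx (Phi t w)) @: U w)%VS = U (phi t w) /\
          (linfun (mulmx (Phi t w)) @: S w)%VS = S (phi t w),
        forall t w u, 0 <= c t -> u \in U w ->
          C * expR (lambda * c t) * enorm u <= enorm (Phi t w *m u) &
        forall t w s, 0 <= c t -> s \in S w ->
          enorm (Phi t w *m s) <= C^-1 * expR (- lambda * c t) * enorm s].

Definition nonuniformly_hyperbolic := hyperbolic /\ ~ uniformly_hyperbolic.

End hyperbolicity.

Section discrete_time.
Context {R : realType} (alpha : R).
Variable A : circle R -> 'M[R]_2.

Fixpoint cocycle_pos (n : nat) (theta : circle R) : 'M[R]_2 :=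
  if n is m.+1 then A (rotation alpha m%:Z theta) *m cocycle_pos m theta
  else 1%:M.

(* [cocycle_neg n] is the (-n)-step map. *)
Fixpoint cocycle_neg (n : nat) (theta : circle R) : 'M[R]_2 :=
  if n is m.+1 then
    invmx (A (rotation alpha (- (m.+1)%:Z) theta)) *m cocycle_neg m theta
  else 1%:M.

Definition discrete_cocycle (n : int) (theta : circle R) : 'M[R]_2 :=
  match n with
  | Posz m => cocycle_pos m theta
  | Negz m => cocycle_neg m.+1 theta
  end.

Definition SL2_generator := continuous A /\ forall theta, \det (A theta) = 1.

Definition discrete_nonuniformly_hyperbolic :=
  nonuniformly_hyperbolic (fun n : int => n%:~R) (Posz @ \oo) (rotation alpha)
    lebesgue_circle discrete_cocycle.

End discrete_time.

Section continuous_time.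
Context {R : realType} {Omega : ptopologicalType}.
Variable phi : R -> Omega -> Omega.

Definition continuous_flow :=
  [/\ forall w, phi 0 w = w,
      forall s t w, phi (s + t) w = phi s (phi t w) &
      continuous (fun p : R * Omega => phi p.1 p.2)].

Definition generates (G : Omega -> 'M[R]_2) (Phi : R -> Omega -> 'M[R]_2) :=
  forall w, Phi 0 w = 1%:M /\
    forall t : R, is_derive t 1 (Phi ^~ w) (G (phi t w) *m Phi t w).

(* A map into SL_2(R) that solves the linear equation generated by a continuous
   map G into sl_2(R); the equation has a single solution for each G. *)
Definition continuous_cocycle (Phi : R -> Omega -> 'M[R]_2) :=
  (forall t w, \det (Phi t w) = 1) /\
  exists G : Omega -> 'M[R]_2,
    [/\ continuous G, forall w, \tr (G w) = 0 & generates G Phi].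

Definition flow_nonuniformly_hyperbolic (mu : probability (borel Omega) R)
    (Phi : R -> Omega -> 'M[R]_2) :=
  nonuniformly_hyperbolic (fun t : R => t) (+oo : set_system R) phi mu Phi.

End continuous_time.

Definition canonical_extension {R : realType} (alpha : R)
    (A : circle R -> 'M[R]_2) (Phi : R -> torus alpha -> 'M[R]_2) :=
  forall (n : int) (theta : circle R),
    Phi n%:~R (\pi_(torus alpha) (theta, clamp 0)) =
    discrete_cocycle alpha A n theta.

(* Main.v *)
Require Import Defs.
From HB Require Import structures.
From mathcomp Require Import all_boot all_order all_algebra.
From mathcomp Require Import all_classical all_reals all_analysis.
From mathcomp Require Import measurable_realfun complex ring lra zify.
Set Implicit Arguments.
Unset Strict Implicit.
Unset Printing Implicit Defensive.
Import Order.TTheory GRing.Theory Num.Theory.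
Import numFieldNormedType.Exports.
Local Open Scope classical_set_scope.
Local Open Scope ring_scope.

(** The example is the cocycle generated by A(x) = [[1, a], [0, 1]] [[1, 0], [1, 1]]
    with a = E + 4 cos (2 pi x), over the rotation by sqrt 2, for a well-chosen E.

    Choice of E. For a rational rotation number p/q with q odd, the trace of the
    q-step map is at most 0 for E = -8 and at least 2 for E = 4, hence equals 2 for
    some E in between, and then there is a periodic orbit; seen from its point of
    largest norm it is a two-sided orbit that stays in the unit disc and starts on
    the unit circle. The tuples (alpha, E, x, v) with such an orbit form a compact
    set, so its projection to alpha is closed and contains every alpha in [0, 2].
    A nonzero orbit bounded in both time directions excludes uniform hyperbolicity,
    in discrete and in continuous time.

    Positive exponent. The upper left entry of the n-step map is a unimodular
    multiple of a polynomial in exp (2 pi i x) with constant term of modulus 2 ^ n, so by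
    Herman's averaging argument L = inf_n sup_x ln |A^n_x| / n is at least ln 2.
    Subadditivity gives limsup <= L everywhere. If the liminf were below L on a set
    of positive measure, then almost everywhere, since its flow-saturation is an
    invariant set of a uniquely ergodic flow. Orbit segments of length q, for q the
    denominator of a good rational approximation of alpha, are within 1/q of a
    regular grid, so every one of them would spend most of its time at points where
    the norm grows slowly, and cutting it into such blocks would force
    sup_x ln |A^q_x| < q L.

    Canonical extension. Switching on the two unipotent factors of A by a C^1 step
    function gives a path from the identity to A(x) that concatenates along orbits
    to a solution of a linear equation with continuous coefficients on the
    suspension. *)

(** * Real 2x2 matrices *)

(** Herman's bound [ln 2] does not depend on E: with z = exp (2 pi i x) the potential contains 4 cos
    (2 pi x) = 2 (z + 1/z), and each step multiplies the constant coefficient by this 2. So E may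
    come out of a compactness argument that gives no control over its value. The detour through
    rational rotation numbers is forced, since an irrational rotation has no periodic orbit to start
    from. Odd denominators enter because for E = -8 each step is minus a nonnegative matrix in a
    suitable basis, so (-1) ^ q times the trace of q steps is nonnegative.

    The number sqrt 2 has explicit approximations p/q with error at most 1/q^2, from Pell's
    equation; q rotation steps then drift by at most 1/q from the rational ones.

    Growth is measured in the Frobenius norm. It is submultiplicative, unchanged by inversion in
    SL_2 and within a factor 2 of the operator norm, so bounded factors on either side of a product
    change its logarithm by a bounded amount only. *)

Section mx2.
Context {R : realType}.
Implicit Types (M N : 'M[R]_2) (u v : 'cV[R]_2).

Lemma ord2P (i : 'I_2) : i = 0 \/ i = 1.
Proof. by case: i => [[|[|//]]] Hi; [left|right]; apply/val_inj. Qed.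

Lemma sum2 (F : 'I_2 -> R) : \sum_i F i = F 0 + F 1.
Proof. by rewrite big_ord_recl big_ord1; congr (_ + F _); apply/val_inj. Qed.

Lemma mulmx2 m (M : 'M[R]_2) (N : 'M[R]_(2, m)) i j :
  (M *m N) i j = M i 0 * N 0 j + M i 1 * N 1 j.
Proof. by rewrite mxE sum2. Qed.

Definition mx2 (a b c d : R) : 'M[R]_2 :=
  \matrix_(i, j) if i == 0 then (if j == 0 then a else b)
                 else (if j == 0 then c else d).

Lemma mx2E00 a b c d : mx2 a b c d 0 0 = a. Proof. by rewrite mxE. Qed.
Lemma mx2E01 a b c d : mx2 a b c d 0 1 = b. Proof. by rewrite mxE. Qed.
Lemma mx2E10 a b c d : mx2 a b c d 1 0 = c. Proof. by rewrite mxE. Qed.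
Lemma mx2E11 a b c d : mx2 a b c d 1 1 = d. Proof. by rewrite mxE. Qed.
Definition mx2E := (mx2E00, mx2E01, mx2E10, mx2E11).

Lemma mx2P M N : M 0 0 = N 0 0 -> M 0 1 = N 0 1 -> M 1 0 = N 1 0 ->
  M 1 1 = N 1 1 -> M = N.
Proof.
by move=> *; apply/matrixP => i j; case: (ord2P i) => ->; case: (ord2P j) => ->.
Qed.

Lemma cV2P u v : u 0 0 = v 0 0 -> u 1 0 = v 1 0 -> u = v.
Proof. by move=> *; apply/colP => i; case: (ord2P i) => ->. Qed.

Lemma det2 M : \det M = M 0 0 * M 1 1 - M 0 1 * M 1 0.
Proof.
rewrite (expand_det_row _ 0) sum2 /cofactor !det_mx11 !mxE /=.
rewrite expr0 expr1 mul1r mulN1r mulrN.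
by congr (M _ _ * M _ _ - M _ _ * M _ _); apply/val_inj.
Qed.

Lemma tr2 M : \tr M = M 0 0 + M 1 1. Proof. by rewrite /mxtrace sum2. Qed.

Lemma id2 i j : (1%:M : 'M[R]_2) i j = (i == j)%:R.
Proof. by rewrite mxE. Qed.

Definition adj2 M := mx2 (M 1 1) (- M 0 1) (- M 1 0) (M 0 0).

Lemma adj2_mulmx M : \det M = 1 -> adj2 M *m M = 1%:M.
Proof.
rewrite det2 => h; apply: mx2P; rewrite mulmx2 !mx2E id2/= ?mulr1n ?mulr0n.
1,4: by rewrite -h; ring.
all: by ring.
Qed.

Lemma det1_unitmx M : \det M = 1 -> M \in unitmx.
Proof. by rewrite unitmxE => ->; rewrite unitr1. Qed.

Lemma invmx2 M : \det M = 1 -> invmx M = adj2 M.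
Proof.
move=> M1; rewrite -[RHS]mulmx1 -(mulmxV (det1_unitmx M1)) mulmxA.
by rewrite adj2_mulmx// mul1mx.
Qed.

Lemma det_invmx1 M : \det M = 1 -> \det (invmx M) = 1.
Proof. by rewrite det_inv => ->; rewrite invr1. Qed.

Lemma det_mul1 M N : \det M = 1 -> \det N = 1 -> \det (M *m N) = 1.
Proof. by rewrite det_mulmx => -> ->; rewrite mulr1. Qed.

Lemma invmx_mul1 M N : \det M = 1 -> \det N = 1 ->
  invmx (M *m N) = invmx N *m invmx M.
Proof.
move=> hM hN; rewrite -[RHS](mulKmx (det1_unitmx (det_mul1 hM hN))) -mulmxA.
by rewrite mulKVmx ?det1_unitmx// mulmxV ?det1_unitmx// mulmx1.
Qed.

Definition frob2 M := M 0 0 ^+ 2 + M 0 1 ^+ 2 + M 1 0 ^+ 2 + M 1 1 ^+ 2.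
(** The Frobenius norm: unlike [opnorm] it is explicit in the entries, so its estimates reduce to
    polynomial identities. *)
Definition frob M := Num.sqrt (frob2 M).

Lemma frob2_ge0 M : 0 <= frob2 M.
Proof. by rewrite /frob2 !addr_ge0// sqr_ge0. Qed.

Lemma frob_ge0 M : 0 <= frob M. Proof. exact: sqrtr_ge0. Qed.

Lemma frobK M : frob M ^+ 2 = frob2 M.
Proof. by rewrite sqr_sqrtr// frob2_ge0. Qed.

Lemma le_frob M (x : R) : 0 <= x -> (frob M <= x) = (frob2 M <= x ^+ 2).
Proof.
by move=> x0; rewrite -frobK ler_sqr ?nnegrE// frob_ge0.
Qed.

Lemma entry_le_frob M i j : `|M i j| <= frob M.
Proof.
rewrite -(@ler_sqr _ `|_|) ?nnegrE ?frob_ge0// frobK real_normK ?num_real//.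
rewrite /frob2; case: (ord2P i) => ->; case: (ord2P j) => ->;
 have := sqr_ge0 (M 0 0); have := sqr_ge0 (M 0 1); have := sqr_ge0 (M 1 0);
 have := sqr_ge0 (M 1 1); lra.
Qed.

Lemma frobM M N : frob (M *m N) <= frob M * frob N.
Proof.
rewrite le_frob ?mulr_ge0 ?frob_ge0// exprMn !frobK /frob2 !mulmx2.
set a := M 0 0; set b := M 0 1; set c := M 1 0; set d := M 1 1.
set e := N 0 0; set f := N 0 1; set g := N 1 0; set h := N 1 1.
(* Lagrange's identity for each row of [M] against each column of [N]. *)
rewrite -subr_ge0 (_ : _ - _ = (a * g - b * e) ^+ 2 + (a * h - b * f) ^+ 2 +
  (c * g - d * e) ^+ 2 + (c * h - d * f) ^+ 2); last by ring.
by rewrite !addr_ge0// sqr_ge0.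
Qed.

(** For determinant 1, [frob2 M] - 2 is the sum of the squares of [M 0 0 - M 1 1] and
    [M 0 1 + M 1 0]. *)
Lemma frob_ge1 M : \det M = 1 -> 1 <= frob M.
Proof.
rewrite det2 -(@ler_sqr _ 1) ?nnegrE ?frob_ge0// frobK expr1n /frob2 => h.
have := sqr_ge0 (M 0 0 - M 1 1); have := sqr_ge0 (M 0 1 + M 1 0).
by nra.
Qed.

Lemma frob_gt0 M : \det M = 1 -> 0 < frob M.
Proof. by move=> h; apply: lt_le_trans ltr01 (frob_ge1 h). Qed.

Lemma frob_invmx M : \det M = 1 -> frob (invmx M) = frob M.
Proof.
by move=> h; rewrite invmx2// /frob; congr Num.sqrt; rewrite /frob2 !mx2E; ring.
Qed.

Lemma enorm2 v : enorm v ^+ 2 = v 0 0 ^+ 2 + v 1 0 ^+ 2.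
Proof. by rewrite /enorm sum2 sqr_sqrtr// addr_ge0// sqr_ge0. Qed.

Lemma enorm_ge0 v : 0 <= enorm v. Proof. exact: sqrtr_ge0. Qed.

Lemma le_enorm v (x : R) : 0 <= x -> (enorm v <= x) = (v 0 0 ^+ 2 + v 1 0 ^+ 2 <= x ^+ 2).
Proof. by move=> x0; rewrite -enorm2 ler_sqr ?nnegrE// enorm_ge0. Qed.

Lemma enorm_eq0 v : enorm v = 0 -> v = 0.
Proof.
move=> /(congr1 (fun x => x ^+ 2)); rewrite enorm2 expr0n/= => /eqP.
rewrite paddr_eq0 ?sqr_ge0// !sqrf_eq0 => /andP[/eqP h1 /eqP h2].
by apply: cV2P; rewrite mxE.
Qed.

Lemma enorm_mul_frob M v : enorm (M *m v) <= frob M * enorm v.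
Proof.
rewrite le_enorm ?mulr_ge0 ?frob_ge0 ?enorm_ge0// exprMn enorm2 frobK /frob2.
rewrite !mulmx2.
set a := M 0 0; set b := M 0 1; set c := M 1 0; set d := M 1 1.
set e := v 0 0; set g := v 1 0.
rewrite -subr_ge0.
rewrite (_ : _ - _ = (a * g - b * e) ^+ 2 + (c * g - d * e) ^+ 2); last by ring.
by rewrite addr_ge0// sqr_ge0.
Qed.

Lemma enormD u v : enorm (u + v) <= enorm u + enorm v.
Proof.
rewrite le_enorm ?addr_ge0 ?enorm_ge0// sqrrD !enorm2 !mxE.
have uv0 := mulr_ge0 (enorm_ge0 u) (enorm_ge0 v).
have : u 0 0 * v 0 0 + u 1 0 * v 1 0 <= enorm u * enorm v.
  have [h|/ltW h] := leP (u 0 0 * v 0 0 + u 1 0 * v 1 0) 0.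
    exact: le_trans h uv0.
  rewrite -ler_sqr ?nnegrE// exprMn !enorm2.
  rewrite -subr_ge0.
  rewrite (_ : _ - _ = (u 0 0 * v 1 0 - u 1 0 * v 0 0) ^+ 2) ?sqr_ge0//.
  by ring.
by move=> h; nra.
Qed.

Lemma enormN v : enorm (- v) = enorm v.
Proof.
by apply/eqP; rewrite -(@eqrXn2 _ 2)// ?enorm_ge0// !enorm2 !mxE !sqrrN.
Qed.

Lemma opnorm_sup M : has_sup [set enorm (M *m v) | v in [set v | enorm v <= 1]].
Proof.
split.
  exists (enorm (M *m 0)); exists 0 => //=.
  by rewrite /enorm big1 ?sqrtr0// => i _; rewrite mxE expr0n.
exists (frob M) => _ [v /= v1 <-].
by rewrite (le_trans (enorm_mul_frob _ _))// ler_piMr// frob_ge0.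
Qed.

Lemma opnorm_le_frob M : opnorm M <= frob M.
Proof.
apply: ge_sup; first by case: (opnorm_sup M).
move=> _ [v /= v1 <-].
by rewrite (le_trans (enorm_mul_frob _ _))// ler_piMr// frob_ge0.
Qed.

Lemma col_le_opnorm M j : M 0 j ^+ 2 + M 1 j ^+ 2 <= opnorm M ^+ 2.
Proof.
have h : enorm (M *m (delta_mx j 0)) <= opnorm M.
  apply: sup_ubound; first by case: (opnorm_sup M).
  exists (delta_mx j 0) => //=; rewrite le_enorm// !mxE expr1n.
  by case: (ord2P j) => ->; rewrite /= ?mulr1n ?mulr0n; lra.
have e i : M i j = (M *m (delta_mx j 0 : 'cV_2)) i 0 by rewrite -colE mxE.
rewrite !e -enorm2 ler_sqr ?nnegrE ?enorm_ge0//.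
exact: le_trans (enorm_ge0 _) h.
Qed.

Lemma opnorm_ge0 M : 0 <= opnorm M.
Proof.
apply: le_trans (enorm_ge0 (M *m 0)) _; apply: sup_ubound; first by case: (opnorm_sup M).
by exists 0 => //=; rewrite le_enorm// !mxE; lra.
Qed.

Lemma frob_le_opnorm M : frob M <= 2 * opnorm M.
Proof.
rewrite le_frob ?mulr_ge0 ?opnorm_ge0// exprMn /frob2.
by have := col_le_opnorm M 0; have := col_le_opnorm M 1; nra.
Qed.

End mx2.

(** * Sine and cosine of period 1 *)

Section circular.
Context {R : realType}.
Implicit Types (x y : R) (m : int).

Definition cos1 x : R := cos (2 * pi * x).
Definition sin1 x : R := sin (2 * pi * x).

Lemma periodicz (U V : zmodType) (f : U -> V) (T : U) :
  periodic f T -> forall m a, f (a + T *~ m) = f a.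
Proof.
move=> pf [n|n] a; first by rewrite -pmulrn periodicn.
by rewrite NegzE mulrNz -pmulrn -[LHS](periodicn pf n.+1) subrK.
Qed.

Let twopi m : 2 * pi * m%:~R = (pi *+ 2) *~ m :> R.
Proof. by rewrite -[RHS]mulrzl -mulr_natl; ring. Qed.

Lemma cos1Dint x m : cos1 (x + m%:~R) = cos1 x.
Proof. by rewrite /cos1 mulrDr twopi (periodicz (@cosD2pi R)). Qed.

Lemma sin1Dint x m : sin1 (x + m%:~R) = sin1 x.
Proof. by rewrite /sin1 mulrDr twopi (periodicz (@sinD2pi R)). Qed.

Lemma cos1D x y : cos1 (x + y) = cos1 x * cos1 y - sin1 x * sin1 y.
Proof. by rewrite /cos1 mulrDr cosD. Qed.

Lemma sin1D x y : sin1 (x + y) = sin1 x * cos1 y + cos1 x * sin1 y.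
Proof. by rewrite /sin1 mulrDr sinD. Qed.

Lemma cos1_ge x : -1 <= cos1 x. Proof. exact: cos_geN1. Qed.
Lemma cos1_le x : cos1 x <= 1. Proof. exact: cos_le1. Qed.

Lemma cos1_0 : cos1 0 = 1. Proof. by rewrite /cos1 mulr0 cos0. Qed.
Lemma sin1_0 : sin1 0 = 0. Proof. by rewrite /sin1 mulr0 sin0. Qed.

Lemma cos1N x : cos1 (- x) = cos1 x.
Proof. by rewrite /cos1 mulrN cosN. Qed.

Lemma sin1N x : sin1 (- x) = - sin1 x.
Proof. by rewrite /sin1 mulrN sinN. Qed.

Lemma cos1_sin1 x : cos1 x ^+ 2 + sin1 x ^+ 2 = 1.
Proof. exact: cos2Dsin2. Qed.

Lemma cos1_cont : continuous cos1.
Proof.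
move=> x; apply: (@continuous_comp _ _ _ (fun x => 2 * pi * x)).
  by apply: cvgM; [exact: cvg_cst|exact: cvg_id].
exact: continuous_cos.
Qed.

Lemma sin1_cont : continuous sin1.
Proof.
move=> x; apply: (@continuous_comp _ _ _ (fun x => 2 * pi * x)).
  by apply: cvgM; [exact: cvg_cst|exact: cvg_id].
exact: continuous_sin.
Qed.

Lemma cos1_eq1 x : cos1 x = 1 -> x \is a Num.int.
Proof.
pose d := x - (Num.floor x)%:~R; have xd : x = d + (Num.floor x)%:~R by rewrite subrK.
have d0 : 0 <= d by rewrite subr_ge0 floor_le.
have d1 : d < 1 by rewrite ltrBlDr addrC -intrD1 floorD1_gt.
rewrite xd cos1Dint => c1; rewrite rpredD ?intr_int//.
suff -> : d = 0 by rewrite rpred0.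
have pi0 := @pi_gt0 R.
(* [cos] is injective on [0, pi] only, which is half a period; the other half is reached by the
   reflection d -> 1 - d. *)
have key (e : R) : 0 <= e <= 1 / 2 -> cos1 e = 1 -> e = 0.
  move=> /andP[e0 e2]; rewrite -cos1_0 => h.
  have e1 : 2 * pi * e \in `[0, pi] by rewrite in_itv/=; apply/andP; split; nra.
  have e3 : 2 * pi * 0 \in `[0, (pi : R)] by rewrite in_itv/=; apply/andP; split; nra.
  by have := cos_inj e1 e3 h; nra.
have [d2|d2] := leP d (1 / 2); first by apply: key => //; rewrite d0.
have : 1 - d = 0.
  apply: key; first by apply/andP; split; lra.
  by rewrite addrC (cos1Dint (- d) 1) cos1N.
lra.
Qed.

Lemma cos1_sin1_inj x y : cos1 x = cos1 y -> sin1 x = sin1 y ->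
  x - y \is a Num.int.
Proof.
move=> c s; apply: cos1_eq1; rewrite cos1D cos1N sin1N c s.
by rewrite -(cos1_sin1 y); ring.
Qed.

End circular.

(** * Bounded orbits exclude uniform hyperbolicity *)

Section bounded_orbit.
Context {R : realType} {T : Type} (c : T -> R) {Omega : ptopologicalType}.
Variables (phi : T -> Omega -> Omega) (Phi : T -> Omega -> 'M[R]_2).

(** Split [v] along U and S at [w]. Forward boundedness kills the U-component, which would grow
    exponentially while the image of the S-component stays bounded. So [v] lies in S, and as the
    image of bounded vectors of S from n steps back it is arbitrarily small. The backward orbit is
    encoded by points [w' n] and vectors [x n] that are carried to [w] and [v], because the growth
    conditions concern nonnegative times. *)
Lemma bounded_orbit_not_uniformly_hyperbolic (w : Omega) (v : 'cV[R]_2) (K : R)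
    (t : nat -> T) (w' : nat -> Omega) (x : nat -> 'cV[R]_2) :
  v != 0 -> (forall n, Phi (t n) (w' n) \in unitmx) ->
  (forall n, c (t n) = n%:R) ->
  (forall n, enorm (Phi (t n) w *m v) <= K) ->
  (forall n, phi (t n) (w' n) = w) ->
  (forall n, Phi (t n) (w' n) *m x n = v) ->
  (forall n, enorm (x n) <= K) ->
  ~ uniformly_hyperbolic c phi Phi.
Proof.
move=> v0 uPhi ct fw pw Px xK [C [l [U [S [[C0 l0 _ _] [dUS inv exU exS]]]]]].
have K0 : 0 <= K by apply: le_trans (enorm_ge0 _) (xK 0%N).
have c0 n : 0 <= c (t n) by rewrite ct.
have expn n : 1 + l * n%:R <= expR (l * n%:R) by apply: expR_ge1Dx.
have unbounded (B : R) : exists n : nat, B < expR (l * n%:R).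
  have [n nB] : exists n : nat, B / l < n%:R.
    exists (Num.bound `|B / l|); apply: le_lt_trans (ler_norm _) _.
    exact: archi_boundP (normr_ge0 _).
  exists n; apply: lt_le_trans (expn n).
  by rewrite ltr_pdivrMr// mulrC in nB; lra.
have [vU vS] : exists2 u, u \in U w & v - u \in S w.
  have : v \in (U w + S w)%VS by rewrite (dUS w).1 memvf.
  move=> /memv_addP[u uU [s sS vus]]; exists u => //.
  by rewrite vus addrAC subrr add0r.
(* [vU] is the U-component of [v] and [vS] its membership in [U w]; [sS] says that the rest lies in
   [S w]. *)
move=> sS; have u0 : vU = 0.
  apply: enorm_eq0; apply/eqP; rewrite eq_le enorm_ge0 andbT leNgt.
  apply/negP => u_gt0.
  pose B := (K + C^-1 * enorm (v - vU)) / (C * enorm vU).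
  have [n nB] := unbounded B.
  have := exU (t n) w vU (c0 n) vS.
  have := exS (t n) w _ (c0 n) sS.
  rewrite ct => h1 h2.
  have h3 : enorm (Phi (t n) w *m vU) <= K + C^-1 * enorm (v - vU).
    rewrite -[X in Phi _ _ *m X](subKr v) mulmxBr.
    apply: le_trans (enormD _ _) _; rewrite enormN; apply: lerD (fw n) _.
    apply: le_trans h1 _; rewrite ler_wpM2r ?enorm_ge0//.
    rewrite ler_piMr ?invr_ge0 ?(ltW C0)// mulNr expRN invf_le1 ?expR_gt0//.
    by apply: le_trans (expn n); rewrite lerDl mulr_ge0// ltW.
  have h4 : C * expR (l * n%:R) * enorm vU <= K + C^-1 * enorm (v - vU).
    exact: le_trans h2 h3.
  move: nB; rewrite /B ltr_pdivrMr ?mulr_gt0// ltNge => /negP; apply.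
  by apply: le_trans h4; rewrite le_eqVlt mulrCA mulrA eqxx.
move: sS; rewrite u0 subr0 => vSw.
suff v00 : enorm v = 0 by rewrite (enorm_eq0 v00) eqxx in v0.
apply/eqP; rewrite eq_le enorm_ge0 andbT leNgt; apply/negP => v_gt0.
have [n nB] := unbounded (C^-1 * K / enorm v).
(* Invariance provides some preimage of [v] in [S (w' n)]; invertibility identifies it with
   [x n]. *)
have xS : x n \in S (w' n).
  have := (inv (t n) (w' n)).2; rewrite pw => e.
  move: vSw; rewrite -e => /memv_imgP[s sS]; rewrite lfunE/= -(Px n) => /esym es.
  have -> // : x n = s.
  by rewrite -[x n](mulKmx (uPhi n)) -es mulKmx.
have := exS (t n) (w' n) _ (c0 n) xS; rewrite Px ct mulNr expRN => h.
have : enorm v * expR (l * n%:R) <= C^-1 * K.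
  rewrite -ler_pdivlMr ?expR_gt0//; apply: le_trans h _.
  by rewrite mulrAC ler_wpM2r ?invr_ge0 ?expR_ge0// ler_wpM2l// invr_ge0 ltW.
by rewrite leNgt [enorm v * _]mulrC -ltr_pdivrMr// nB.
Qed.

End bounded_orbit.

(** * Schroedinger cocycles and their bounded orbits *)

Section gen_orbit.
Context {R : realType}.
Implicit Types (al E x : R) (p : R * R).

Definition pot E x : R := E + 4 * cos1 x.

(* The product of [[1, a], [0, 1]] and [[1, 0], [1, 1]]; scaling both off-diagonal
   entries to 0 connects it to the identity inside SL_2. *)
Definition stp (a : R) : 'M[R]_2 := mx2 (1 + a) a 1 1.

Lemma det_stp a : \det (stp a) = 1.
Proof. by rewrite det2 !mx2E; ring. Qed.

(** Pairs rather than column vectors: the tuples (alpha, E, x, v) of the compactness argument then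
    live in a product of copies of R. *)
Definition fstep (a : R) (p : R * R) : R * R := ((1 + a) * p.1 + a * p.2, p.1 + p.2).
Definition bstep (a : R) (p : R * R) : R * R := (p.1 - a * p.2, (1 + a) * p.2 - p.1).

Lemma fstepK a : cancel (fstep a) (bstep a).
Proof. by case=> x y; rewrite /fstep /bstep /=; congr pair; ring. Qed.

Lemma bstepK a : cancel (bstep a) (fstep a).
Proof. by case=> x y; rewrite /fstep /bstep /=; congr pair; ring. Qed.

Definition col2 (p : R * R) : 'cV[R]_2 := \col_i (if i == 0 then p.1 else p.2).

Lemma col20 p : col2 p 0 0 = p.1. Proof. by rewrite mxE. Qed.
Lemma col21 p : col2 p 1 0 = p.2. Proof. by rewrite mxE. Qed.

Lemma stp_fstep a p : stp a *m col2 p = col2 (fstep a p).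
Proof.
apply: cV2P; rewrite mulmx2 !mx2E !col20 !col21//=.
by rewrite !mul1r.
Qed.

Definition nrm2 p := p.1 ^+ 2 + p.2 ^+ 2.

Lemma enorm_col2 p : enorm (col2 p) ^+ 2 = nrm2 p.
Proof. by rewrite enorm2 col20 col21. Qed.

Fixpoint forb al E x n p : R * R :=
  if n is m.+1 then fstep (pot E (x + m%:R * al)) (forb al E x m p) else p.

(** Passing from time -m to time -(m + 1) inverts the step taken at x - (m + 1) al, hence the shift
    by one compared with [forb]. *)
Fixpoint borb al E x n p : R * R :=
  if n is m.+1 then bstep (pot E (x - m.+1%:R * al)) (borb al E x m p) else p.

Lemma pot_add1 E x (m : int) : pot E (x + m%:~R) = pot E x.
Proof. by rewrite /pot cos1Dint. Qed.

Fixpoint gmx al E x n : 'M[R]_2 :=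
  if n is m.+1 then stp (pot E (x + m%:R * al)) *m gmx al E x m else 1%:M.

Lemma gmx_forb al E x n p : gmx al E x n *m col2 p = col2 (forb al E x n p).
Proof.
by elim: n => [|n IH] /=; rewrite ?mul1mx// -mulmxA IH stp_fstep.
Qed.

Lemma det_gmx al E x n : \det (gmx al E x n) = 1.
Proof. by elim: n => [|n IH] /=; rewrite ?det1// det_mul1// det_stp. Qed.

(** Nonnegative matrices with diagonal entries at least 1 are closed under products. *)
Lemma gmx_tr_ge2 al E x n : (forall y, 0 <= pot E y) -> 2 <= \tr (gmx al E x n).
Proof.
move=> a0.
suff : [/\ 1 <= gmx al E x n 0 0, 0 <= gmx al E x n 0 1,
  0 <= gmx al E x n 1 0 & 1 <= gmx al E x n 1 1].
  by case=> h1 _ _ h2; rewrite tr2; lra.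
elim: n => [|n [h1 h2 h3 h4]] /=.
  by rewrite !id2/=; split; rewrite ?mulr1n ?mulr0n//; lra.
have ha := a0 (x + n%:R * al); set a := pot _ _ in ha *; clearbody a.
by rewrite !mulmx2 !mx2E; split; nra.
Qed.

(** The four quantities are the entries of P^-1 M P for the shear P = [[1, 0], [-1/2, 1]], which
    preserves the trace. The conjugate of [stp a] is [[1 + a/2, a], [1 + a/4, 1 + a/2]], and all its
    entries are at most 0 exactly when a <= -4. *)
Lemma gmx_tr_sign al E x n : (forall y, pot E y <= -4) ->
  0 <= (-1) ^+ n * \tr (gmx al E x n).
Proof.
move=> a4; set G := gmx al E x.
suff : [/\ 0 <= (-1) ^+ n * (G n 0 0 - G n 0 1 / 2),
    0 <= (-1) ^+ n * G n 0 1,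
    0 <= (-1) ^+ n * (G n 1 0 - G n 1 1 / 2 + G n 0 0 / 2 - G n 0 1 / 4)
  & 0 <= (-1) ^+ n * (G n 1 1 + G n 0 1 / 2)].
  by case=> h1 _ _ h2; rewrite tr2; lra.
elim: n => [|n] /=.
  by rewrite expr0 !id2/=; split; rewrite ?mulr1n ?mulr0n//; lra.
have -> : G n.+1 = stp (pot E (x + n%:R * al)) *m G n by [].
rewrite exprS; move: ((-1) ^+ n) => s.
have ha := a4 (x + n%:R * al); set a := pot _ _ in ha *; clearbody a.
rewrite !mulmx2 !mx2E !mul1r.
move: (G n 0 0) (G n 0 1) (G n 1 0) (G n 1 1) => m00 m01 m10 m11 [h1 h2 h3 h4].
have c1 : 0 <= - a / 2 - 1 by lra.
have c2 : 0 <= - a by lra.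
have c3 : 0 <= - a / 4 - 1 by lra.
have eqge (u w : R) : u = w -> 0 <= u -> 0 <= w by move=> ->.
split.
- by apply: eqge (addr_ge0 (mulr_ge0 c1 h1) (mulr_ge0 c2 h3)); field.
- by apply: eqge (addr_ge0 (mulr_ge0 c1 h2) (mulr_ge0 c2 h4)); field.
- by apply: eqge (addr_ge0 (mulr_ge0 c3 h1) (mulr_ge0 c1 h3)); field.
- by apply: eqge (addr_ge0 (mulr_ge0 c3 h2) (mulr_ge0 c1 h4)); field.
Qed.

Lemma gmx_continuousE al x n i j : continuous (fun E => gmx al E x n i j).
Proof.
elim: n i j => [|n IH] i j; first by move=> E; exact: cvg_cst.
move=> E /=; rewrite (_ : (fun E => _) =
  (fun E => (stp (pot E (x + n%:R * al)) i 0 * gmx al E x n 0 j) +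
            (stp (pot E (x + n%:R * al)) i 1 * gmx al E x n 1 j))); last first.
  by apply/funext => e; rewrite mulmx2.
have stpc k : {for E, continuous (fun E => stp (pot E (x + n%:R * al)) i k)}.
  have pc : {for E, continuous (fun E => pot E (x + n%:R * al))}.
    by apply: cvgD; [exact: cvg_id|exact: cvg_cst].
  case: (ord2P i) => ->; case: (ord2P k) => ->.
  - under [X in {for _, continuous X}]funext => e do rewrite mx2E.
    by apply: cvgD => //; exact: cvg_cst.
  - by under [X in {for _, continuous X}]funext => e do rewrite mx2E.
  - under [X in {for _, continuous X}]funext => e do rewrite mx2E.
    exact: cvg_cst.
  - under [X in {for _, continuous X}]funext => e do rewrite mx2E.
    exact: cvg_cst.
by apply: cvgD; apply: cvgM; (exact: stpc || exact: IH).
Qed.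

(** The potential ranges over [-12, -4] for E = -8 and over [0, 8] for E = 4, as the two trace
    estimates require. *)
Lemma parabolic_energy al x n : odd n ->
  exists2 E, -8 <= E <= 4 & \tr (gmx al E x n) = 2.
Proof.
move=> on; have c1 (y : R) := cos1_le y; have c2 (y : R) := cos1_ge y.
have h1 : \tr (gmx al (-8) x n) <= 0.
  have := @gmx_tr_sign al (-8) x n; rewrite -signr_odd on expr1 mulN1r oppr_ge0.
  by apply=> y; rewrite /pot; have := c1 y; lra.
have h2 : 2 <= \tr (gmx al 4 x n).
  by apply: gmx_tr_ge2 => y; rewrite /pot; have := c2 y; lra.
have h84 : (-8 : R) <= 4 by lra.
have [||E] := @IVT R (fun E => \tr (gmx al E x n)) _ _ 2 h84.
- apply: continuous_subspaceT => E.
  rewrite (_ : (fun E => _) = (fun E => gmx al E x n 0 0 + gmx al E x n 1 1)).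
    by apply: cvgD; exact: gmx_continuousE.
  by apply/funext => e; rewrite tr2.
- by rewrite ge_min le_max; apply/andP; split; apply/orP; [left; lra|right].
- by rewrite in_itv/= => hE e2; exists E.
Qed.

(** Determinant 1 and trace 2 make 1 a double eigenvalue. An eigenvector is (M01, 1 - M00), or (0,
    1) if M01 = 0. *)
Lemma parabolic_fixpoint al E x n : \tr (gmx al E x n) = 2 ->
  exists2 p, nrm2 p != 0 & forb al E x n p = p.
Proof.
have := det_gmx al E x n; have := gmx_forb al E x n.
move: (gmx al E x n) => M MF; rewrite det2 tr2 => d1 t2.
have fixp p : M *m col2 p = col2 p -> forb al E x n p = p.
  rewrite MF => e; rewrite [LHS]surjective_pairing [RHS]surjective_pairing.
  by rewrite -!col20 -!col21 e.
have key p : p.1 * (M 0 0 - 1) + M 0 1 * p.2 = 0 ->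
  M 1 0 * p.1 + (M 1 1 - 1) * p.2 = 0 -> forb al E x n p = p.
  move=> e1 e2; apply: fixp; apply: cV2P; rewrite mulmx2 !col20 !col21.
    by rewrite -[RHS]addr0 -e1; ring.
  by rewrite -[RHS]addr0 -e2; ring.
have nz (a b : R) : a != 0 \/ b != 0 -> nrm2 (a, b) != 0.
  by rewrite /nrm2/= paddr_eq0 ?sqr_ge0// !sqrf_eq0 => -[] /negPf->; rewrite ?andbF.
have [b0|b0] := eqVneq (M 0 1) 0; last first.
  exists (M 0 1, 1 - M 0 0); first by apply: nz; left.
  apply: key => /=; first by ring.
  have -> : M 1 1 = 2 - M 0 0 by lra.
  rewrite (_ : M 1 0 * M 0 1 = M 0 0 * M 1 1 - 1); last by rewrite -d1; ring.
  have -> : M 1 1 = 2 - M 0 0 by lra.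
  by ring.
have m00 : M 0 0 = 1.
  have /eqP : (M 0 0 - 1) ^+ 2 = 0.
    have e : M 1 1 = 2 - M 0 0 by lra.
    have h : M 0 0 * (2 - M 0 0) = 1 by rewrite -e -[RHS]d1 b0; ring.
    by transitivity (1 - M 0 0 * (2 - M 0 0)); [ring|rewrite h subrr].
  by rewrite sqrf_eq0 subr_eq0 => /eqP.
exists (0, 1); first by apply: nz; right; rewrite oner_neq0.
apply: key; first by rewrite /= b0; ring.
by rewrite /=; lra.
Qed.

Lemma forbD al E x m n p :
  forb al E x (m + n) p = forb al E (x + m%:R * al) n (forb al E x m p).
Proof.
elim: n => [|n IH]; rewrite ?addn0// addnS /= IH; congr (fstep (pot _ _) _).
by rewrite natrD mulrDl addrA.
Qed.

Lemma forb_int al E x (m : int) n p :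
  forb al E (x + m%:~R) n p = forb al E x n p.
Proof.
elim: n => //= n ->; congr (fstep _ _).
by rewrite addrAC pot_add1.
Qed.

Definition scal2 (r : R) p : R * R := (r * p.1, r * p.2).

Lemma forb_scal al E x n r p :
  forb al E x n (scal2 r p) = scal2 r (forb al E x n p).
Proof.
elim: n => //= n ->; rewrite /fstep /scal2/=; congr pair; ring.
Qed.

Lemma borb_scal al E x n r p :
  borb al E x n (scal2 r p) = scal2 r (borb al E x n p).
Proof.
elim: n => //= n ->; rewrite /bstep /scal2/=; congr pair; ring.
Qed.

Lemma nrm2_scal r p : nrm2 (scal2 r p) = r ^+ 2 * nrm2 p.
Proof. by rewrite /nrm2 /scal2/=; ring. Qed.

Lemma nrm2_ge0 p : 0 <= nrm2 p.
Proof. by rewrite addr_ge0// sqr_ge0. Qed.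

Definition bounded_orbit al E x p :=
  forall n, nrm2 (forb al E x n p) <= 1 /\ nrm2 (borb al E x n p) <= 1.

(* Recentre a periodic orbit at the point where its norm is largest. *)
Lemma rational_bounded_orbit (p : int) (k : nat) :
  let al := p%:~R / (k.*2.+1)%:R in
  exists E x v, [/\ -8 <= E <= 4, 0 <= x <= 1, nrm2 v = 1 &
    bounded_orbit al E x v].
Proof.
set q := k.*2.+1 => al.
have q0 : (q%:R : R) != 0 by rewrite pnatr_eq0.
have qal : q%:R * al = p%:~R by rewrite /al mulrC divfK.
have [|E HE] := @parabolic_energy al 0 q; first by rewrite /q/= odd_double.
move=> /parabolic_fixpoint[u u0 uq].
pose y n := forb al E 0 n u.
have yD m n : y (m + n)%N = forb al E (m%:R * al) n (y m).
  by rewrite /y forbD add0r.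
have yq n : y (n + q)%N = y n.
  rewrite addnC yD; rewrite qal -[X in forb _ _ X]add0r forb_int.
  by rewrite /y uq.
have yqm n m : y (n + m * q)%N = y n.
  by elim: m => [|m IH]; rewrite ?addn0// mulSn addnCA addnC yq IH.
pose i0 : 'I_q := ord0.
pose j := [arg max_(i > i0) nrm2 (y i)]%O.
have jmax n : nrm2 (y n) <= nrm2 (y j).
  have -> : y n = y (n %% q)%N by rewrite {1}(divn_eq n q) addnC yqm.
  rewrite /j; case: arg_maxP => // i _ /(_ (Ordinal (ltn_pmod n (isT : (0 < q)%N)))).
  by apply.
have yj0 : 0 < nrm2 (y j).
  by apply: lt_le_trans (jmax 0%N); rewrite /y/= lt_neqAle nrm2_ge0 eq_sym u0.
set N := nrm2 (y j) in yj0 jmax.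
pose r := Num.sqrt N^-1.
have r2 : r ^+ 2 = N^-1 by rewrite sqr_sqrtr// invr_ge0 ltW.
have rle n : nrm2 (scal2 r (y n)) <= 1.
  by rewrite nrm2_scal r2 mulrC ler_pdivrMr// mul1r.
pose f := Num.floor (j%:R * al).
pose x := j%:R * al - f%:~R.
have xE : x = j%:R * al + (- f)%:~R by rewrite mulrNz.
exists E, x, (scal2 r (y j)); split => //.
- rewrite /x subr_ge0 floor_le/= lerBlDr addrC -intrD1.
  exact/ltW/floorD1_gt.
- by rewrite nrm2_scal r2 mulVf// gt_eqF.
move=> n; split.
  by rewrite forb_scal xE forb_int -yD.
(* On an orbit of period q, n steps back are n (q - 1) steps forward. *)
suff -> : borb al E x n (scal2 r (y j)) = scal2 r (y (j + n * q.-1)%N) by [].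
rewrite borb_scal; congr (scal2 _ _).
elim: n => [|n IH]; first by rewrite mul0n addn0.
rewrite /= {}IH -[y (j + n * _)%N]yq.
set m := (j + n.+1 * _)%N.
have -> : (j + n * q.-1 + q = m.+1)%N by rewrite /m /q /= mulSn; lia.
have -> : y m.+1 = fstep (pot E (m%:R * al)) (y m) by rewrite -addn1 yD /= mul0r addr0.
rewrite -[RHS](fstepK (pot E (m%:R * al))); congr (bstep _ _).
have -> : x - n.+1%:R * al = m%:R * al + (- f - n.+1%:Z * p)%:~R.
  rewrite xE /m natrD natrM intrD mulrDl -!addrA; congr (_ + _).
  rewrite [RHS]addrCA; congr (_ + _).
  rewrite mulrNz intrM -qal -pmulrn.
  by rewrite /q -[k.*2.+1%:R]natr1 /=; ring.
by rewrite pot_add1.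
Qed.

End gen_orbit.

(** * Bounded orbits for real rotation numbers, by compactness *)

Section limit_orbit.
Context {R : realType}.
Let Z := (R * (R * (R * (R * R))))%type.

Lemma proj_cont : [/\ continuous (fun z : Z => z.1),
  continuous (fun z : Z => z.2.1), continuous (fun z : Z => z.2.2.1),
  continuous (fun z : Z => z.2.2.2.1) & continuous (fun z : Z => z.2.2.2.2)].
Proof.
have c1 (U V : topologicalType) : continuous (fun z : U * V => z.1).
  by move=> z; exact: cvg_fst.
have c2 (U V : topologicalType) : continuous (fun z : U * V => z.2).
  by move=> z; exact: cvg_snd.
split => z.
- exact: c1.
- by apply: (@continuous_comp _ _ _ snd fst); [exact: c2|exact: c1].
- apply: (@continuous_comp _ _ _ snd (fun z => z.2.1)); first exact: c2.
  by apply: (@continuous_comp _ _ _ snd fst); [exact: c2|exact: c1].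
- apply: (@continuous_comp _ _ _ snd (fun z => z.2.2.1)); first exact: c2.
  apply: (@continuous_comp _ _ _ snd (fun z => z.2.1)); first exact: c2.
  by apply: (@continuous_comp _ _ _ snd fst); [exact: c2|exact: c1].
- apply: (@continuous_comp _ _ _ snd (fun z => z.2.2.2)); first exact: c2.
  apply: (@continuous_comp _ _ _ snd (fun z => z.2.2)); first exact: c2.
  by apply: (@continuous_comp _ _ _ snd snd); exact: c2.
Qed.

Lemma pot_cont (T : topologicalType) (E x : T -> R) :
  continuous E -> continuous x -> continuous (fun t => pot (E t) (x t)).
Proof.
move=> cE cx t; rewrite /pot; apply: cvgD; first exact: cE.
apply: cvgM; first exact: cvg_cst.
by apply: continuous_comp; [exact: cx|exact: cos1_cont].
Qed.

Lemma orbit_cont n : 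
  [/\ continuous (fun z : Z => (forb z.1 z.2.1 z.2.2.1 n z.2.2.2).1),
      continuous (fun z : Z => (forb z.1 z.2.1 z.2.2.1 n z.2.2.2).2),
      continuous (fun z : Z => (borb z.1 z.2.1 z.2.2.1 n z.2.2.2).1) &
      continuous (fun z : Z => (borb z.1 z.2.1 z.2.2.1 n z.2.2.2).2)].
Proof.
have [ca cE cx c1 c2] := proj_cont.
elim: n => [|n [f1 f2 b1 b2]] //.
have pc : continuous (fun z : Z => pot z.2.1 (z.2.2.1 + n%:R * z.1)).
  apply: pot_cont; first exact: cE.
  move=> z; apply: cvgD; first exact: cx.
  by apply: cvgM; [exact: cvg_cst|exact: ca].
have qc : continuous (fun z : Z => pot z.2.1 (z.2.2.1 - n.+1%:R * z.1)).
  apply: pot_cont; first exact: cE.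
  move=> z; apply: cvgB; first exact: cx.
  by apply: cvgM; [exact: cvg_cst|exact: ca].
split => z /=.
- apply: cvgD; apply: cvgM; [|exact: f1|exact: pc|exact: f2].
  by apply: cvgD; [exact: cvg_cst|exact: pc].
- by apply: cvgD; [exact: f1|exact: f2].
- by apply: cvgB; [exact: b1|apply: cvgM; [exact: qc|exact: b2]].
- apply: cvgB; last exact: b1.
  apply: cvgM; last exact: b2.
  by apply: cvgD; [exact: cvg_cst|exact: qc].
Qed.

Lemma exists_bounded_orbit (al : R) : 0 <= al <= 2 ->
  exists E x v, [/\ 0 <= x <= 1, nrm2 v = 1 & bounded_orbit al E x v].
Proof.
move=> /andP[al0 al2].
pose S : set Z := [set z | nrm2 z.2.2.2 = 1 /\
  bounded_orbit z.1 z.2.1 z.2.2.1 z.2.2.2].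
pose box : set Z := `[0, 3]%classic `*` (`[-8, 4]%classic `*`
  (`[0, 1]%classic `*` (`[-1, 1]%classic `*` `[-1, 1]%classic))).
have [ca cE cx c1 c2] := proj_cont.
have sq (f g : Z -> R) : continuous f -> continuous g ->
    continuous (fun z => f z ^+ 2 + g z ^+ 2).
  move=> cf cg z; apply: cvgD; apply: (@cvgM _ _ _ _ _ _ _ _); (exact: cf || exact: cg).
have clS : closed S.
  have -> : S = [set z : Z | nrm2 z.2.2.2 = 1] `&` \bigcap_n
      ([set z : Z | nrm2 (forb z.1 z.2.1 z.2.2.1 n z.2.2.2) <= 1] `&`
       [set z : Z | nrm2 (borb z.1 z.2.1 z.2.2.1 n z.2.2.2) <= 1]).
    apply/seteqP; split => z [h1 h2]; split => //.
      by move=> n _; split; case: (h2 n).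
    by move=> n; have [] := h2 n I; split.
  apply: closedI.
    have /continuous_closedP := sq _ _ c1 c2.
    by move=> /(_ [set x | x = 1]); apply; exact: closed_eq.
  apply: closed_bigI => n _; have [f1 f2 b1 b2] := orbit_cont n.
  apply: closedI.
    have /continuous_closedP := sq _ _ f1 f2.
    by move=> /(_ [set x | x <= 1]); apply; exact: closed_le.
  have /continuous_closedP := sq _ _ b1 b2.
  by move=> /(_ [set x | x <= 1]); apply; exact: closed_le.
have cpt : compact (box `&` S).
  apply: (@subclosed_compact _ _ box) => //.
    apply: closedI => //; apply: compact_closed.
      exact: norm_hausdorff.
    by do !(apply: compact_setX; first exact: segment_compact); exact: segment_compact.
  by do !(apply: compact_setX; first exact: segment_compact); exact: segment_compact.
have clP : closed [set z.1 | z in box `&` S].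
  apply: compact_closed; first exact: norm_hausdorff.
  by apply: continuous_compact => //; exact: continuous_subspaceT.
suff /clP [[a [E [x v]]]] : closure [set z.1 | z in box `&` S] al.
  by move=> [[_ [_ [/= xI _]]] [/= v1 bo]] /= <-; exists E, x, v; split.
move=> B /nbhs_ballP[e /= e0 eB].
(* Fractions with odd denominator q are dense: p/q with p the floor of al q lies within 1/q below
   [al]. *)
have [k ke] : exists k : nat, e^-1 < k.*2.+1%:R.
  exists (Num.bound `|e^-1|); apply: le_lt_trans (ler_norm _) _.
  apply: lt_le_trans (archi_boundP (normr_ge0 _)) _.
  by rewrite ler_nat -addnn -addnS leq_addr.
set q : R := k.*2.+1%:R in ke.
have q1 : 1 <= q by rewrite /q ler1n.
have q0 : 0 < q by lra.
pose p := Num.floor (al * q).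
have pq : p%:~R / q <= al by rewrite ler_pdivrMr// floor_le.
have pq1 : al < p%:~R / q + q^-1.
  by rewrite -{2}(mul1r q^-1) -mulrDl ltr_pdivlMr// -intrD1 floorD1_gt.
have p0 : 0 <= p%:~R / q.
  by rewrite divr_ge0 ?(ltW q0)// ler0z floor_ge0 mulr_ge0// ltW.
have [E [x [v [hE hx hv bo]]]] := @rational_bounded_orbit R p k.
exists (p%:~R / q); split; last first.
  apply: eB; rewrite /ball/= ger0_norm ?subr_ge0//.
  have : q^-1 < e by rewrite invf_plt ?posrE.
  by move=> qe; rewrite ltrBlDl; apply: lt_trans pq1 _; rewrite ltrD2l.
exists ((p%:~R / q, (E, (x, v))) : Z) => //; split; last by split.
have /andP[v1 v2] : (v.1 ^+ 2 <= 1) && (v.2 ^+ 2 <= 1).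
  move: hv; rewrite /nrm2; have := sqr_ge0 v.1; have := sqr_ge0 v.2.
  by move=> ? ? ?; apply/andP; split; lra.
have sqle (a : R) : a ^+ 2 <= 1 -> a \in `[-1, 1].
  by move=> h; rewrite in_itv/= -ler_norml -(@expr_le1 _ 2)// real_normK// num_real.
do !split => /=; rewrite ?in_itv//=; [|exact: sqle v1|exact: sqle v2].
by rewrite p0/=; apply: le_trans pq _; lra.
Qed.

End limit_orbit.

(** * Exponential growth *)

Section herman.
Local Open Scope complex_scope.
Context {R : realType}.
Local Notation C := (R[i]).

Definition ex1 (x : R) : C := cos1 x +i* sin1 x.

Lemma ex1D x y : ex1 (x + y) = ex1 x * ex1 y.
Proof.
by apply/eqP; rewrite eq_complex /= cos1D sin1D eqxx/=; apply/eqP; ring.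
Qed.

Lemma ex1_0 : ex1 0 = 1.
Proof. by rewrite /ex1 cos1_0 sin1_0. Qed.

Lemma ex1X x n : ex1 x ^+ n = ex1 (n%:R * x).
Proof.
elim: n => [|n IH]; first by rewrite mul0r ex1_0.
by rewrite exprS IH -ex1D -[n.+1%:R]nat1r mulrDl mul1r.
Qed.

Lemma ex1_nat (n : nat) : ex1 n%:R = 1.
Proof. by rewrite /ex1 pmulrn -[n%:~R]add0r cos1Dint sin1Dint cos1_0 sin1_0. Qed.

Lemma norm_ex1 x : `|ex1 x| = 1.
Proof. by rewrite normc_def/= cos1_sin1 sqrtr1. Qed.

Lemma ex1_neq1 x : x \isn't a Num.int -> ex1 x != 1.
Proof.
by apply: contraNneq => -[c _]; exact: cos1_eq1.
Qed.

(** A geometric series in z = [ex1 (k%:R / M%:R)], an M-th root of unity other than 1. *)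
Lemma sum_unity (M k : nat) : (0 < k < M)%N ->
  \sum_(j < M) ex1 (j%:R / M%:R) ^+ k = 0.
Proof.
move=> /andP[k0 kM].
have M0 : (M%:R : R) != 0 by rewrite pnatr_eq0; lia.
have M0' : 0 < (M%:R : R) by rewrite ltr0n; lia.
pose z := ex1 (k%:R / M%:R).
have z1 : z - 1 != 0.
  rewrite subr_eq0; apply: ex1_neq1; apply/negP => /intrP[m hm].
  have m0 : 0 < (m%:~R : R) by rewrite -hm divr_gt0// ltr0n.
  have m1 : (m%:~R : R) < 1 by rewrite -hm ltr_pdivrMr// mul1r ltr_nat.
  by move: m0 m1; rewrite ltr0z -[1]/(1%:~R) ltr_int; lia.
apply: (mulfI z1); rewrite mulr0.
transitivity (z ^+ M - 1); last first.
  by rewrite /z ex1X mulrC divfK// ex1_nat subrr.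
rewrite subrX1; congr (_ * _); apply: eq_bigr => j _.
by rewrite /z !ex1X; congr ex1; rewrite mulrCA.
Qed.

(* Averaging over roots of unity kills every coefficient but the constant one. *)
Lemma horner_max_modulus (p : {poly C}) : exists x, `|p.[0]| <= `|p.[ex1 x]|.
Proof.
(* More sample points than the degree, so that 0 is the only exponent of [p] divisible by M. *)
pose M := (size p).+1.
have M0 : 0 < (M%:R : C) by rewrite ltr0n.
have avg : \sum_(j < M) p.[ex1 (j%:R / M%:R)] = p.[0] * M%:R.
  under eq_bigr do rewrite (@horner_coef_wide _ (size p))//.
  rewrite exchange_big /=; under eq_bigr do rewrite -mulr_sumr.
  case E : (size p) => [|s].
    by move/eqP: E; rewrite size_poly_eq0 big_ord0 => /eqP->; rewrite horner0 mul0r.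
  rewrite big_ord_recl /= [X in _ + X]big1 ?addr0; last first.
    move=> i _; rewrite sum_unity ?mulr0//.
    by rewrite /M E /bump leq0n; have := ltn_ord i; lia.
  rewrite horner_coef0; congr (_ * _).
  under eq_bigr do rewrite expr0.
  by rewrite sumr_const card_ord.
apply: contrapT => /forallNP h.
have hlt j : `|p.[ex1 j]| < `|p.[0]|.
  have := h j; rewrite !normc_def !lecR ltcR => /negP.
  by rewrite -ltNge.
suff : `|p.[0] * M%:R| < `|p.[0]| * M%:R.
  by rewrite normrM [`|M%:R|]ger0_norm ?ler0n// ltxx.
rewrite -avg; apply: le_lt_trans (ler_norm_sum _ _ _) _.
rewrite -[X in _ * X%:R](card_ord M) mulr_natr -sumr_const.
apply: ltr_sum => [|i _]; last exact: hlt.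
by apply/hasP; exists ord0; rewrite // mem_index_enum.
Qed.

(** The first column of the n-step map as polynomials in z = [ex1 x]. Each step is multiplied by the
    unimodular number u = [ex1 (x + m%:R * al)] to clear the negative power of z: [w] evaluates to
    u, and [b] to u times the potential, since u (u + 1/u) = u ^ 2 + 1. *)
Fixpoint upol (al E : R) (n : nat) : {poly C} * {poly C} :=
  if n is m.+1 then
    let w := (ex1 (m%:R * al)) *: 'X in
    let b := E%:C *: w + 2%:R *: (w ^+ 2 + 1) in
    ((w + b) * (upol al E m).1 + b * (upol al E m).2,
     w * ((upol al E m).1 + (upol al E m).2))
  else (1, 0).

(** At 0 the recursion has w = 0 and b = 2, whatever [al] and [E] are. *)
Lemma upol0 (al E : R) n : (upol al E n).1.[0] = 2 ^+ n /\ (upol al E n).2.[0] = 0.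
Proof.
elim: n => [|n [IH1 IH2]] /=; first by rewrite !hornerE.
rewrite !hornerE IH1 IH2 !(mulr0, mul0r, expr0n, addr0, add0r)/= exprS mulr1.
by rewrite mulr0 add0r.
Qed.

Lemma pot_ex1 E x : ex1 x * (pot E x)%:C =
  E%:C * ex1 x + 2%:R * (ex1 x ^+ 2 + 1).
Proof.
rewrite /pot /ex1 expr2; have := cos1_sin1 x.
move: (cos1 x) (sin1 x) => c s h.
have -> : (2 : C) = 2%:C by rewrite rmorph_nat.
apply/eqP; rewrite eq_complex /=; apply/andP; split; apply/eqP => /=; last by ring.
by rewrite -h; ring.
Qed.

Lemma upolE (al E x : R) n : exists z : C, `|z| = 1 /\
  (upol al E n).1.[ex1 x] = z * (gmx al E x n 0 0)%:C /\
  (upol al E n).2.[ex1 x] = z * (gmx al E x n 1 0)%:C.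
Proof.
elim: n => [|n [z [z1 [IH1 IH2]]]] /=.
  by exists 1; rewrite normr1 !hornerE !id2/= ?mulr1n ?mulr0n ?mulr1 ?mulr0.
exists (ex1 (x + n%:R * al) * z); split; first by rewrite normrM norm_ex1 z1 mulr1.
have e : ex1 (n%:R * al) * ex1 x = ex1 (x + n%:R * al) by rewrite -ex1D addrC.
set w := _ *: 'X; set b := _ *: w + _.
have hw : w.[ex1 x] = ex1 (x + n%:R * al) by rewrite hornerZ hornerX e.
have hb : b.[ex1 x] = ex1 (x + n%:R * al) * (pot E (x + n%:R * al))%:C.
   rewrite pot_ex1 /b hornerD !hornerZ hornerD horner_exp hw -[1 : {poly C}]polyC1 hornerC.
   by rewrite hornerX e.
move: w b hw hb => w b hw hb; rewrite !(hornerD, hornerM) hw hb IH1 IH2 !mulmx2 /stp !mx2E.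
move: (pot _ _) (ex1 (x + _)) (gmx _ _ _ _ _ _) (gmx _ _ _ _ _ _) => a y s t.
have re (u v : R) : (u + v)%:C = u%:C + v%:C by rewrite rmorphD.
have rm (u v : R) : (u * v)%:C = u%:C * v%:C by rewrite rmorphM.
have r1 : (1 : R)%:C = 1 by rewrite rmorph1.
by rewrite !(re, rm, r1); split; ring.
Qed.

Lemma herman_bound (al E : R) n : exists x, 2 ^+ n <= `|gmx al E x n 0 0|.
Proof.
have [x hx] := horner_max_modulus (upol al E n).1.
exists x; move: hx; have [z [z1 [-> _]]] := upolE al E x n.
rewrite (upol0 al E n).1 normrM z1 mul1r.
have -> : `|(gmx al E x n 0 0)%:C| = `|gmx al E x n 0 0|%:C :> C.
  by rewrite normc_def/= expr0n/= addr0 sqrtr_sqr.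
have -> : `|2 ^+ n| = (2 ^+ n : R)%:C :> C.
  by rewrite normrX normr_nat rmorphXn/= rmorph_nat.
by rewrite lecR.
Qed.

End herman.

(** * Lifts to the circle and to the suspension *)

Lemma comp_cont (U V W : topologicalType) (f : U -> V) (g : V -> W) :
  continuous f -> continuous g -> continuous (fun x => g (f x)).
Proof. by move=> cf cg x; apply: continuous_comp; [exact: cf|exact: cg]. Qed.

Lemma fst_cont (U V : topologicalType) : continuous (fun p : U * V => p.1).
Proof. by move=> p; exact: cvg_fst. Qed.

Lemma snd_cont (U V : topologicalType) : continuous (fun p : U * V => p.2).
Proof. by move=> p; exact: cvg_snd. Qed.

Lemma pair_cont (U V W : topologicalType) (f : U -> V) (g : U -> W) :
  continuous f -> continuous g -> continuous (fun x => (f x, g x)).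
Proof. by move=> cf cg x; apply: cvg_pair; [exact: cf|exact: cg]. Qed.

Lemma cst_cont (U V : topologicalType) (c : V) : continuous (fun _ : U => c).
Proof. by move=> x; exact: cvg_cst. Qed.

Lemma contD (R : realType) (U : topologicalType) (f g : U -> R) :
  continuous f -> continuous g -> continuous (fun x => f x + g x).
Proof. by move=> cf cg x; apply: cvgD; [exact: cf|exact: cg]. Qed.

Lemma contN (R : realType) (U : topologicalType) (f : U -> R) :
  continuous f -> continuous (fun x => - f x).
Proof. by move=> cf x; apply: cvgN; exact: cf. Qed.

Lemma contM (R : realType) (U : topologicalType) (f g : U -> R) :
  continuous f -> continuous g -> continuous (fun x => f x * g x).
Proof. by move=> cf cg x; apply: cvgM; [exact: cf|exact: cg]. Qed.

(** * Periodic functions on the line as functions on the circle *)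

Section circle_lifts.
Local Open Scope quotient_scope.
Context {R : realType}.
Implicit Types (x y a : R) (th : circle R).

Definition cpi x : circle R := \pi_(circle R) x.

Lemma cpi_eq x y : cpi x = cpi y <-> x - y \is a Num.int.
Proof. by split => [/eqmodP|h]; [|apply/eqmodP]. Qed.

Lemma cpiP th : exists2 x, 0 <= x < 1 & th = cpi x.
Proof.
exists (repr th - (Num.floor (repr th))%:~R).
  by rewrite subr_ge0 floor_le ltrBlDl -intrD1 floorD1_gt.
rewrite -[LHS]reprK; apply/cpi_eq.
by rewrite opprB addrCA subrr addr0 intr_int.
Qed.

Lemma cpiDint x (m : int) : cpi (x + m%:~R) = cpi x.
Proof. by apply/cpi_eq; rewrite addrAC subrr add0r intr_int. Qed.

Lemma repr_cpi x : repr (cpi x) - x \is a Num.int.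
Proof. by apply/cpi_eq; rewrite /cpi reprK. Qed.

Lemma rotate_cpi a x : rotate a (cpi x) = cpi (x + a).
Proof.
by apply/cpi_eq; rewrite opprD addrACA subrr addr0 repr_cpi.
Qed.

Lemma rotation_cpi a (n : int) x : rotation a n (cpi x) = cpi (x + n%:~R * a).
Proof. exact: rotate_cpi. Qed.

Definition per1 (T : Type) (f : R -> T) := forall x (m : int), f (x + m%:~R) = f x.

Lemma per1_repr (T : Type) (f : R -> T) x : per1 f -> f (repr (cpi x)) = f x.
Proof.
move=> pf; have /intrP[m hm] := repr_cpi x.
by rewrite -[RHS](pf x m) -hm addrCA subrr addr0.
Qed.

Lemma circle_continuous (T : topologicalType) (f : circle R -> T) :
  continuous (f \o cpi) -> continuous f.
Proof. by move=> h; apply/(@quotient_continuous _ (circle R)). Qed.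

Lemma cpi_continuous : continuous cpi.
Proof. exact: (@pi_continuous _ (circle R)). Qed.

Lemma per1_continuous (T : topologicalType) (f : R -> T) :
  per1 f -> continuous f -> continuous (fun th => f (repr th)).
Proof.
move=> pf cf; apply: circle_continuous.
by rewrite (_ : _ \o _ = f)//; apply/funext => x /=; rewrite per1_repr.
Qed.

Lemma rotate_continuous a : continuous (@rotate R a).
Proof.
apply: circle_continuous.
rewrite (_ : _ \o _ = cpi \o (fun x => x + a)); last first.
  by apply/funext => x /=; rewrite rotate_cpi.
move=> x; apply: continuous_comp; last exact: cpi_continuous.
by apply: cvgD; [exact: cvg_id|exact: cvg_cst].
Qed.

End circle_lifts.

(** * The plane as universal cover of the suspension *)

Section torus_lifts.
Local Open Scope quotient_scope.
Context {R : realType} (al : R).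
Implicit Types (x y t : R) (w : torus al).

(** The covering map of the suspension by the plane: [tpDx] and [tpDy] are its deck transformations,
    and the flow lifts to translation of [y]. *)
Definition tp x y : torus al := torus_pt al (cpi x) y.

Definition tpi (th : circle R) (r : unit_itv R) : torus al :=
  \pi_(torus al) (th, r).

Lemma tpDx x (m : int) y : tp (x + m%:~R) y = tp x y.
Proof. by rewrite /tp cpiDint. Qed.

Lemma clamp_in y : 0 <= y <= 1 -> \val (clamp y) = y.
Proof.
by move=> /andP[y0 y1] /=; rewrite (min_idPl y1) (max_idPr y0).
Qed.

Lemma val_clamp (r : unit_itv R) : clamp (\val r) = r.
Proof.
apply/val_inj/clamp_in; have := valP r.
by rewrite inE/= in_itv.
Qed.

Lemma unit_itvP (r : unit_itv R) : 0 <= \val r <= 1.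
Proof. by have := valP r; rewrite inE/= in_itv. Qed.

Lemma tpi_glue x : tpi (cpi x) (clamp 1) = tpi (cpi (x + al)) (clamp 0).
Proof.
apply/eqmodP; rewrite /= /torus_eqb; apply/orP; right; apply/orP; left.
rewrite /torus_glue !clamp_in ?lexx ?ler01//= !eqxx/=.
by rewrite rotate_cpi eqxx.
Qed.

Lemma tp_tpi x y : 0 <= y <= 1 -> tp x y = tpi (cpi x) (clamp y).
Proof.
move=> /andP[y0 y1]; rewrite /tp /torus_pt.
have [->|yn1] := eqVneq y 1.
  by rewrite floor1 mul1r subrr rotate_cpi tpi_glue.
have -> : Num.floor y = 0 by apply: floor_def; rewrite y0 lt_neqAle yn1.
by rewrite mul0r subr0 rotate_cpi addr0.
Qed.

Lemma tpDy x y (m : int) : tp x (y + m%:~R) = tp (x + m%:~R * al) y.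
Proof.
rewrite /tp /torus_pt floorDrz ?intr_int// intrKfloor !rotate_cpi.
rewrite intrD mulrDl opprD addrACA subrr addr0 [x + (_ + _)]addrA.
by rewrite addrAC.
Qed.

Lemma tpP w : exists x y, [/\ 0 <= x < 1, 0 <= y < 1 & w = tp x y].
Proof.
rewrite -[w]reprK; case: (repr w) => th r.
have [x x01 ->] := cpiP th.
have [r0 r1] := andP (unit_itvP r).
have [re|rn1] := eqVneq (\val r) 1.
  have [z z01 e] := cpiP (cpi (x + al)).
  exists z, 0; rewrite lexx ltr01; split => //.
  by rewrite tp_tpi ?lexx ?ler01// -e -tpi_glue -[r]val_clamp re.
exists x, (\val r); split => //; first by rewrite r0 lt_neqAle rn1.
by rewrite tp_tpi ?val_clamp// r0.
Qed.

Lemma repr_tp x y : exists x' y', [/\ 0 <= y' <= 1, 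
  repr (tp x y) = (cpi x', clamp y') & tp x' y' = tp x y].
Proof.
have := reprK (tp x y); case: (repr (tp x y)) => th r e.
have [x' _ hth] := cpiP th; exists x', (\val r).
by rewrite (unit_itvP r) val_clamp hth; split => //; rewrite tp_tpi ?unit_itvP// val_clamp -hth.
Qed.

Lemma torus_continuous (T : topologicalType) (f : torus al -> T) :
  continuous (fun p : circle R * unit_itv R => f (tpi p.1 p.2)) -> continuous f.
Proof.
move=> h; apply/(@quotient_continuous _ (torus al)).
rewrite (_ : _ \o _ = (fun p : circle R * unit_itv R => f (tpi p.1 p.2)))//.
by apply/funext => -[].
Qed.

Lemma tpi_continuous : continuous (fun p : circle R * unit_itv R => tpi p.1 p.2).
Proof.
rewrite (_ : (fun _ => _) = \pi_(torus al)); last by apply/funext => -[].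
exact: (@pi_continuous _ (torus al)).
Qed.

Lemma val_unit_continuous : continuous (\val : unit_itv R -> R).
Proof. exact: initial_continuous. Qed.

(* The suspension is the 2-torus through (x + al * y, y), which is linear on the
   flow lines. *)
Definition psi w : (R * R) * (R * R) :=
  let: (th, r) := repr w in
  let x := repr th + al * \val r in
  ((cos1 x, sin1 x), (cos1 (\val r), sin1 (\val r))).

Definition psi_lift x y : (R * R) * (R * R) :=
  ((cos1 (x + al * y), sin1 (x + al * y)), (cos1 y, sin1 y)).

Lemma psi_lift_glue x : psi_lift x 1 = psi_lift (x + al) 0.
Proof.
rewrite /psi_lift mulr1 mulr0 addr0.
have -> : (1 : R) = 0 + 1%:~R by rewrite add0r.
by rewrite cos1Dint sin1Dint.
Qed.

Lemma psi_lift_per y : per1 (psi_lift^~ y).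
Proof.
by move=> x m; rewrite /psi_lift addrAC cos1Dint sin1Dint.
Qed.

(** A point on the glued fibre has two representatives in the cylinder and [repr] may pick either;
    periodicity and compatibility with the gluing make the choice harmless. Lifted formulas become
    functions on the suspension through this lemma. *)
Lemma repr_lift (T : Type) (f : R -> R -> T) x y :
  (forall y, per1 (f^~ y)) -> (forall x, f x 1 = f (x + al) 0) -> 0 <= y <= 1 ->
  f (repr (repr (tp x y)).1) (\val (repr (tp x y)).2) = f x y.
Proof.
move=> pf gf y01.
have : repr (tp x y) = (cpi x, clamp y) %[mod torus al].
  by rewrite reprK tp_tpi.
case: (repr (tp x y)) => th r /eqmodP/= /or3P[/eqP[-> ->]||].
- by rewrite (per1_repr _ (pf _)) clamp_in.
- move=> /and3P[/eqP r1 /eqP y0 /eqP /=].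
  have {}y0 : y = 0 by rewrite -y0 clamp_in.
  have {}r1 : \val r = 1 := r1.
  rewrite r1 y0.
  have [z _ ->] := cpiP th; rewrite rotate_cpi (per1_repr _ (pf _)) gf.
  by move=> /cpi_eq/intrP[m hm]; rewrite -[x](subrK (z + al)) hm [_%:~R + _]addrC pf.
- move=> /and3P[/eqP y1 /eqP r0 /eqP /=].
  have {}y1 : y = 1 by rewrite -y1 clamp_in.
  have {}r0 : \val r = 0 := r0.
  rewrite r0 y1 rotate_cpi => ->.
  by rewrite (per1_repr _ (pf _)) gf.
Qed.

Lemma psi_tp x y : psi (tp x y) = psi_lift x y.
Proof.
have -> : tp x y = tp (x + (Num.floor y)%:~R * al) (y - (Num.floor y)%:~R).
  by rewrite -tpDy subrK.
have -> : psi_lift x y = psi_lift (x + (Num.floor y)%:~R * al) (y - (Num.floor y)%:~R).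
  rewrite /psi_lift -mulrNz cos1Dint sin1Dint; congr ((cos1 _, sin1 _), _).
    by rewrite mulrNz; ring.
  by rewrite mulrNz; ring.
set z := x + _; set r := y - _.
have r01 : 0 <= r <= 1.
  by rewrite subr_ge0 floor_le/= lerBlDl -intrD1; exact/ltW/floorD1_gt.
have := @repr_lift _ psi_lift z r psi_lift_per psi_lift_glue r01.
by rewrite /psi; case: (repr (tp z r)).
Qed.

Lemma psi_inj : injective psi.
Proof.
move=> w w'; have [x [y [_ _ ->]]] := tpP w; have [x' [y' [_ _ ->]]] := tpP w'.
rewrite !psi_tp => -[cx sx cy sy].
have /intrP[m hm] := cos1_sin1_inj cy sy.
have /intrP[n hn] := cos1_sin1_inj cx sx.
have -> : y = y' + m%:~R by rewrite -hm addrCA subrr addr0.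
rewrite tpDy; have -> : x + m%:~R * al = x' + n%:~R by rewrite -hn -hm; ring.
by rewrite tpDx.
Qed.

Lemma tp_eqP x y x' y' : tp x y = tp x' y' ->
  y - y' \is a Num.int /\ x + al * y - (x' + al * y') \is a Num.int.
Proof.
move=> /(congr1 psi); rewrite !psi_tp => -[cx sx cy sy].
by split; apply: cos1_sin1_inj.
Qed.

Lemma psi_continuous : continuous psi.
Proof.
apply: torus_continuous.
pose F (p : circle R * unit_itv R) : (R * R) * (R * R) :=
  ((cos1 (repr p.1) * cos1 (al * \val p.2) - sin1 (repr p.1) * sin1 (al * \val p.2),
    sin1 (repr p.1) * cos1 (al * \val p.2) + cos1 (repr p.1) * sin1 (al * \val p.2)),
   (cos1 (\val p.2), sin1 (\val p.2))).
rewrite (_ : (fun _ => _) = F); last first.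
  apply/funext => -[th r] /=; have [x _ ->] := cpiP th.
  have -> : tpi (cpi x) r = tp x (\val r) by rewrite tp_tpi ?unit_itvP// val_clamp.
  rewrite psi_tp /psi_lift /F/= -!(cos1D, sin1D).
  by rewrite !(per1_repr (f := fun x => cos1 (x + _)))
    ?(per1_repr (f := fun x => sin1 (x + _)))// => z m; rewrite addrAC ?cos1Dint ?sin1Dint.
have cs1 : continuous (fun p : circle R * unit_itv R => cos1 (repr p.1)).
  apply: (comp_cont (@fst_cont _ _) (per1_continuous _ (@cos1_cont R))).
  by move=> x m; exact: cos1Dint.
have sn1 : continuous (fun p : circle R * unit_itv R => sin1 (repr p.1)).
  apply: (comp_cont (@fst_cont _ _) (per1_continuous _ (@sin1_cont R))).
  by move=> x m; exact: sin1Dint.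
have v2 : continuous (fun p : circle R * unit_itv R => \val p.2).
  exact: (comp_cont (@snd_cont _ _) val_unit_continuous).
have av2 : continuous (fun p : circle R * unit_itv R => al * \val p.2).
  by move=> p; apply: cvgM; [exact: cvg_cst|exact: v2].
have [cc sc] := (@cos1_cont R, @sin1_cont R).
apply: pair_cont; apply: pair_cont.
- move=> p; apply: cvgB; apply: cvgM;
    [exact: cs1|exact: (comp_cont av2 cc)|exact: sn1|exact: (comp_cont av2 sc)].
- move=> p; apply: cvgD; apply: cvgM;
    [exact: sn1|exact: (comp_cont av2 cc)|exact: cs1|exact: (comp_cont av2 sc)].
- exact: (comp_cont v2 cc).
- exact: (comp_cont v2 sc).
Qed.

Lemma torus_hausdorff : hausdorff_space (torus al).
Proof.
move=> w w' cl; apply: psi_inj; apply: (@norm_hausdorff _ ((R * R) * (R * R))%type).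
move=> A B nA nB.
have [z [Az Bz]] := cl _ _ (psi_continuous nA) (psi_continuous nB).
by exists (psi z).
Qed.

Lemma torus_projE (p : R * R) : torus_proj al p = tpi (cpi p.1) (clamp p.2).
Proof. by []. Qed.

Lemma torus_proj_continuous : continuous (torus_proj al : R * R -> torus al).
Proof.
exact: (comp_cont (pair_cont (comp_cont (@fst_cont _ _) (@cpi_continuous R))
  (comp_cont (@snd_cont _ _) (@continuous_clamp R))) tpi_continuous).
Qed.

Lemma torus_compact : compact [set: torus al].
Proof.
have -> : [set: torus al] = torus_proj al @` (`[0, 1]%classic `*` `[0, 1]%classic).
  apply/seteqP; split => // w _; have [x [y [/andP[x0 x1] /andP[y0 y1] ->]]] := tpP w.
  exists (x, y); first by split; rewrite /= in_itv/= ?x0 ?y0 ltW.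
  by rewrite torus_projE tp_tpi// y0 ltW.
apply: continuous_compact; first exact/continuous_subspaceT/torus_proj_continuous.
by apply: compact_setX; exact: segment_compact.
Qed.

Lemma flow_tp t x y : suspension_flow t (tp x y) = tp x (y + t).
Proof.
rewrite /suspension_flow; have [x' [y' [y01 -> e]]] := repr_tp x y.
rewrite clamp_in// -/(tp x' _).
have /tp_eqP[/intrP[m hm] /intrP[n hn]] := e.
have -> : y' = y + m%:~R by rewrite -hm addrCA subrr addr0.
rewrite addrAC tpDy; have -> : x' + m%:~R * al = x + n%:~R by rewrite -hn -hm; ring.
by rewrite tpDx.
Qed.

(** For joint continuity the flow is read through [psi], where it is a pair of plane rotations
    depending continuously on time. Compactness of the suspension makes [psi] a closed injection, so
    the preimage of a closed set under the flow is the preimage of a closed set under a continuous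
    map. *)
Lemma suspension_continuous_flow : continuous_flow (@suspension_flow R al).
Proof.
split.
- by move=> w; have [x [y [_ _ ->]]] := tpP w; rewrite flow_tp addr0.
- move=> s t w; have [x [y [_ _ ->]]] := tpP w; rewrite !flow_tp.
  by rewrite addrA [y + t + s]addrAC.
pose g (p : R * torus al) := suspension_flow p.1 p.2.
pose rot (a : R) (p : R * R) : R * R :=
  (p.1 * cos1 a - p.2 * sin1 a, p.2 * cos1 a + p.1 * sin1 a).
have rotc (T : topologicalType) (a : T -> R) (p : T -> R * R) :
    continuous a -> continuous p -> continuous (fun z => rot (a z) (p z)).
  move=> ca cp.
  have c1 := comp_cont ca (@cos1_cont R); have c2 := comp_cont ca (@sin1_cont R).
  have c3 := comp_cont cp (@fst_cont R R); have c4 := comp_cont cp (@snd_cont R R).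
  apply: pair_cont => z.
    by apply: cvgB; apply: cvgM; [exact: c3|exact: c1|exact: c4|exact: c2].
  by apply: cvgD; apply: cvgM; [exact: c4|exact: c1|exact: c3|exact: c2].
have pg p : psi (g p) = (rot (al * p.1) (psi p.2).1, rot p.1 (psi p.2).2).
  case: p => t w; have [x [y [_ _ ->]]] := tpP w; rewrite /g/= flow_tp !psi_tp.
  rewrite /psi_lift /rot/= mulrDr addrA [cos1 (_ + _ + _)]cos1D [sin1 (_ + _ + _)]sin1D.
  by rewrite [cos1 (y + t)]cos1D [sin1 (y + t)]sin1D.
have cpg : continuous (psi \o g).
  rewrite (_ : _ \o _ = fun p => (rot (al * p.1) (psi p.2).1, rot p.1 (psi p.2).2));
    last by apply/funext => p; exact: pg.
  have cp2 := comp_cont (@snd_cont R (torus al)) psi_continuous.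
  apply: pair_cont; apply: rotc.
  - by move=> q; apply: cvgM; [exact: cvg_cst|exact: cvg_fst].
  - exact: (comp_cont cp2 (@fst_cont _ _)).
  - exact: fst_cont.
  - exact: (comp_cont cp2 (@snd_cont _ _)).
apply/continuous_closedP => A cA.
rewrite (_ : _ @^-1` _ = (psi \o g) @^-1` (psi @` A)); last first.
  by apply/seteqP; split => p /= => [Ap|[w Aw /psi_inj e]]; [exists (g p)|move: Aw; rewrite e].
move/continuous_closedP : cpg; apply; apply: compact_closed.
  exact: norm_hausdorff.
apply: continuous_compact; first exact/continuous_subspaceT/psi_continuous.
exact: (subclosed_compact cA torus_compact).
Qed.

End torus_lifts.

(** * Rotations by well approximable numbers *)

Section grid.
Context {R : realType}.
Implicit Types (x a b z : R) (p q : nat).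

Definition fpart x : R := x - (Num.floor x)%:~R.

Lemma fpart_itv x : 0 <= fpart x < 1.
Proof. by rewrite subr_ge0 floor_le/= ltrBlDl -intrD1 floorD1_gt. Qed.

Lemma fpartE x a (m : int) : 0 <= a < 1 -> x = a + m%:~R -> fpart x = a.
Proof.
move=> /andP[a0 a1] xE; rewrite /fpart.
rewrite (@floor_def _ x m) ?xE ?addrK// intrD1 addrC lerDl a0 ltrD2l a1//.
Qed.

Lemma fpartDint x (m : int) : fpart (x + m%:~R) = fpart x.
Proof.
apply: (@fpartE _ _ (Num.floor x + m)); first exact: fpart_itv.
by rewrite /fpart intrD addrA subrK.
Qed.

(** Modulo 1 and up to an error 1/q, the points occupy a translate of the regular grid of mesh 1/q,
    one point at each node. *)
Definition is_grid q (P : 'I_q -> R) := exists z, 0 <= z < q%:R^-1 /\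
  exists tau : 'I_q -> 'I_q, injective tau /\
  forall k, exists m : int, `|P k - (z + (tau k)%:R / q%:R) - m%:~R| <= q%:R^-1.

(** As p is invertible modulo q, the multiples of p/q visit every node once; replacing p/q by [al]
    moves the k-th point by at most k / q^2 <= 1/q. The offset z is what remains of x after removing
    the nearest node below. *)
Lemma rotation_grid x (al : R) p q : (0 < q)%N -> coprime p q ->
  `|al - p%:R / q%:R| <= q%:R^-1 ^+ 2 -> is_grid (fun k : 'I_q => x + k%:R * al).
Proof.
move=> q0 pq alpq; have qR : 0 < (q%:R : R) by rewrite ltr0n.
pose l := Num.floor (x * q%:R).
exists (x - l%:~R / q%:R); split.
  rewrite subr_ge0 ler_pdivrMr// floor_le/= ltrBlDl -[X in _ + X]mul1r -mulrDl.
  by rewrite ltr_pdivlMr// -intrD1 floorD1_gt.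
have q0z : (q%:Z : int) != 0 by lia.
pose r (k : 'I_q) : int := ((l + k%:Z * p%:Z) %% q%:Z)%Z.
have r0 k : 0 <= r k by rewrite modz_ge0.
have rq k : r k < q%:Z by rewrite ltz_pmod// ltz_nat.
have rlt k : (`|r k|%N < q)%N by have := r0 k; have := rq k; lia.
exists (fun k => Ordinal (rlt k)); split.
  move=> k k' /(congr1 val) /= e.
  have {}e : r k = r k' by have := r0 k; have := r0 k'; lia.
  have : (q%:Z %| (k%:Z * p%:Z) - (k'%:Z * p%:Z))%Z.
    have : (l + k%:Z * p%:Z == l + k'%:Z * p%:Z %[mod q%:Z])%Z by apply/eqP.
    by rewrite eqz_mod_dvd; congr (_ %| _)%Z; lia.
  rewrite -mulrBl Gauss_dvdzl; last by rewrite coprimez_sym /coprimez.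
  move=> /dvdzP[c hc]; apply/val_inj => /=.
  have := ltn_ord k; have := ltn_ord k'; move: hc; case: c => [[|c]|c]; nia.
move=> k; exists ((l + k%:Z * p%:Z) %/ q%:Z)%Z => /=.
have rE : (`|r k|%N)%:R = (l + k%:Z * p%:Z)%:~R - ((l + k%:Z * p%:Z) %/ q%:Z)%Z%:~R * q%:R :> R.
  have -> : (`|r k|%N)%:R = (r k)%:~R :> R.
    by rewrite -[in RHS](gez0_abs (r0 k)).
  rewrite /r; move: (l + _) => m.
  have e : m%:~R = ((m %/ q)%Z)%:~R * (q%:Z)%:~R + ((m %% q)%Z)%:~R :> R.
    by rewrite -intrM -intrD -divz_eq.
  by rewrite [X in _ = X - _]e addrAC subrr add0r.
rewrite rE mulrBl mulfK ?gt_eqF// rmorphD rmorphM /=.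
set d := (_ %/ _)%Z; rewrite (_ : _ - _ = k%:R * (al - p%:R / q%:R)); last first.
  by rewrite !pmulrn; field; rewrite gt_eqF.
rewrite normrM ger0_norm//.
apply: (@le_trans _ _ (q%:R * q%:R^-1 ^+ 2)).
  by apply: ler_pM => //; rewrite ler_nat ltnW.
by rewrite expr2 mulrA divff ?mul1r// gt_eqF.
Qed.

Lemma count_nat_itv q (A B : R) : 0 <= A -> B <= q%:R ->
  B - A - 1 <= #|[set i : 'I_q | (A <= i%:R < B)%R]%SET|%:R.
Proof.
move=> A0 Bq.
have [|AB] := leP (B - A - 1) 0.
  by move=> h; apply: le_trans h _; rewrite ler0n.
pose n0 := `|Num.ceil A|%N; pose n1 := `|Num.ceil B|%N.
have n0E : n0%:R = (Num.ceil A)%:~R :> R.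
  by rewrite /n0 -[in RHS](@gez0_abs (Num.ceil A)) // ceil_ge0//; lra.
have n1E : n1%:R = (Num.ceil B)%:~R :> R.
  by rewrite /n1 -[in RHS](@gez0_abs (Num.ceil B)) // ceil_ge0//; lra.
have hA : n0%:R < A + 1 by rewrite n0E; have := gt_pred_ceil A; rewrite rmorphB /=; lra.
have hA' : A <= n0%:R by rewrite n0E ceil_ge.
have hB : B <= n1%:R by rewrite n1E ceil_ge.
have hB' : n1%:R < B + 1 by rewrite n1E; have := gt_pred_ceil B; rewrite rmorphB /=; lra.
have n1q : (n1 <= q)%N.
  have : n1%:R < (q.+1)%:R :> R by rewrite -natr1; lra.
  by rewrite ltr_nat.
have n01 : (n0 <= n1)%N.
  have : n0%:R < n1%:R :> R by lra.
  by rewrite ltr_nat => /ltnW.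
have jq (j : 'I_(n1 - n0)) : (n0 + j < q)%N by have := ltn_ord j; lia.
pose f (j : 'I_(n1 - n0)) : 'I_q := Ordinal (jq j).
have fi : injective f by move=> i j /(congr1 val) /= /addnI /val_inj.
have sub : f @: [set: 'I_(n1 - n0)]%SET \subset [set i : 'I_q | (A <= i%:R < B)%R]%SET.
  apply/fintype.subsetP => _ /imsetP[j _ ->]; rewrite inE /= natrD.
  have j0 : 0 <= (j%:R : R) by [].
  have : (n0 + j)%:R <= (n1.-1)%:R :> R by rewrite ler_nat; have := ltn_ord j; lia.
  have : (n1.-1)%:R = n1%:R - 1 :> R.
    have : (0 < n1)%N by have := ltn_ord j; lia.
    by case: (n1) => // n _; rewrite -natr1 addrK.
  by rewrite natrD; lra.
have := subset_leq_card sub; rewrite card_imset// cardsT card_ord => h.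
have : (n1 - n0)%:R <= #|[set i : 'I_q | (A <= i%:R < B)%R]%SET|%:R :> R by rewrite ler_nat.
by rewrite natrB//; lra.
Qed.

(** An injective self-map of a finite set is bijective, so the preimage of [B] has as many elements
    as [B]. *)
Lemma grid_count q (B : {set 'I_q}) (D : {set 'I_q})
    (tau : 'I_q -> 'I_q) : injective tau ->
  (forall k, tau k \in B -> k \in D) -> (#|B| <= #|D|)%N.
Proof.
move=> ti BD.
rewrite -(on_card_preimset (f := tau)); last exact/onW_bij/injF_bij.
by apply: subset_leq_card; apply/fintype.subsetP => k; rewrite inE; exact: BD.
Qed.

Lemma grid_count_itv q (P : 'I_q -> R) a b : is_grid P -> 0 <= a -> b <= 1 ->
  q%:R * (b - a) - 4 <= #|[set k | (a <= fpart (P k) < b)%R]%SET|%:R.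
Proof.
move=> [z [/andP[z0 zq] [tau [ti tP]]]] a0 b1.
case: q P tau ti tP zq => [|q'] P tau ti tP zq.
  by rewrite mul0r; apply: le_trans (ler0n _ _); lra.
set q := q'.+1 in P tau ti tP zq *.
have q0 : 0 < (q%:R : R) by rewrite ltr0n.
have qz : q%:R * z < 1 by rewrite mulrC -ltr_pdivlMr// mul1r.
have qz0 : 0 <= q%:R * z by rewrite mulr_ge0// ltW.
have qb : q%:R * b <= q%:R by rewrite ler_piMr// ltW.
have qa : 0 <= q%:R * a by rewrite mulr_ge0// ltW.
(* The indices in [A, B) are those of the nodes in [a + 1/q, b - 1/q), whose points stay inside [a,
   b) despite their error 1/q. *)
pose A := q%:R * a + 1 - q%:R * z; pose B := q%:R * b - 1 - q%:R * z.
have : B - A - 1 <= #|[set i : 'I_q | (A <= i%:R < B)%R]%SET|%:R.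
  by apply: count_nat_itv; rewrite /A /B; lra.
suff : (#|[set i : 'I_q | (A <= (i%:R : R) < B)%R]%SET| <=
  #|[set k | (a <= fpart (P k) < b)%R]%SET|)%N.
  rewrite -(@ler_nat R) /A /B => h1 h2.
  by apply: le_trans (le_trans h2 h1); rewrite mulrBr; lra.
apply: (grid_count ti) => k; rewrite !inE => /andP[h1 h2].
have [m hm] := tP k.
have qi : q%:R * q%:R^-1 = 1 :> R by rewrite divff// gt_eqF.
have qi0 : 0 < q%:R^-1 :> R by rewrite invr_gt0.
have k1 : a + q%:R^-1 <= z + (tau k)%:R / q%:R.
  rewrite -(ler_pM2l q0) !mulrDr qi mulrCA qi mulr1.
  by move: h1; rewrite /A; lra.
have k2 : z + (tau k)%:R / q%:R < b - q%:R^-1.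
  rewrite -(ltr_pM2l q0) !mulrDr mulrN qi mulrCA qi mulr1.
  by move: h2; rewrite /B; lra.
move: hm; rewrite ler_norml => /andP[h3 h4].
suff [h5 h6] : a <= P k - m%:~R /\ P k - m%:~R < b.
  rewrite (@fpartE _ (P k - m%:~R) m) ?subrK ?h5 ?h6//.
  by apply/andP; split; lra.
by split; lra.
Qed.

End grid.

(** * Pell's equation and the approximation of sqrt 2 *)

Section pell.
Context {R : realType}.

(** The coefficients (p, q) of (1 + sqrt 2) ^ (n + 1) = p + q sqrt 2; the norm p^2 - 2 q^2
    alternates between -1 and 1. *)
Fixpoint pell (n : nat) : nat * nat :=
  if n is m.+1 then ((pell m).1 + 2 * (pell m).2, (pell m).1 + (pell m).2)%N
  else (1, 1)%N.

Lemma pell_eq n : ((pell n).1 ^ 2 = 2 * (pell n).2 ^ 2 + 1)%N \/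
  ((pell n).1 ^ 2 + 1 = 2 * (pell n).2 ^ 2)%N.
Proof.
elim: n => [|n [IH|IH]] /=; first by right.
  by right; move: IH; case: (pell n) => p q /=; nia.
by left; move: IH; case: (pell n) => p q /=; nia.
Qed.

Lemma pell_gt n : (n < (pell n).2)%N.
Proof.
have p1 m : (0 < (pell m).1)%N by elim: m => //= m IH; rewrite addn_gt0 IH.
by elim: n => //= n IH; have := p1 n; lia.
Qed.

Lemma pell_coprime n : coprime (pell n).1 (pell n).2.
Proof.
have [d1 d2] := (dvdn_gcdl (pell n).1 (pell n).2, dvdn_gcdr (pell n).1 (pell n).2).
rewrite /coprime -dvdn1; move: d1 d2; set g := gcdn _ _ => d1 d2.
have e1 : (g %| (pell n).1 ^ 2)%N by rewrite dvdn_exp.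
have e2 : (g %| 2 * (pell n).2 ^ 2)%N by rewrite dvdn_mull// dvdn_exp.
have [h|h] := pell_eq n.
  by rewrite h dvdn_addr in e1.
by rewrite -h dvdn_addr in e2.
Qed.

Definition sqrt2 : R := Num.sqrt 2.

Lemma sqrt2_sqr : sqrt2 ^+ 2 = 2. Proof. by rewrite sqr_sqrtr. Qed.

Lemma sqrt2_ge1 : 1 <= sqrt2.
Proof. by rewrite -(@ler_sqr _ 1) ?nnegrE ?sqrtr_ge0// sqrt2_sqr expr1n; lra. Qed.

Lemma sqrt2_le2 : sqrt2 <= 2.
Proof. by rewrite -(@ler_sqr _ _ 2) ?nnegrE ?sqrtr_ge0// sqrt2_sqr; lra. Qed.

(** By [pell_eq] the product of the error with sqrt 2 + p/q is 1/q^2 in absolute value, and the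
    second factor is at least 1. *)
Lemma pell_approx n :
  `|sqrt2 - (pell n).1%:R / (pell n).2%:R| <= (pell n).2%:R^-1 ^+ 2 :> R.
Proof.
have := pell_eq n; have := pell_gt n; case: (pell n) => p q /= nq pqe.
have q0 : 0 < (q%:R : R) by rewrite ltr0n; lia.
have s1 := sqrt2_ge1; have s2 := sqrt2_sqr.
have : `|(sqrt2 - p%:R / q%:R) * (sqrt2 + p%:R / q%:R)| = q%:R^-1 ^+ 2 :> R.
  rewrite (_ : _ * _ = (2 * q%:R ^+ 2 - p%:R ^+ 2) / q%:R ^+ 2); last first.
    by rewrite -s2; field; rewrite gt_eqF.
  rewrite normrM [`|_^-1|]ger0_norm ?invr_ge0 ?exprn_ge0 ?ltW// exprVn.
  rewrite [`|_ - _|](_ : _ = 1) ?mul1r//.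
  case: pqe => /(congr1 (fun m => m%:R : R)); rewrite natrD natrX [(2 * _)%:R]natrM natrX => e.
    by rewrite [_ - _](_ : _ = -1) ?normrN1//; lra.
  by rewrite [_ - _](_ : _ = 1) ?normr1//; lra.
move=> <-; rewrite normrM ler_peMr// ger0_norm; last first.
  by apply: addr_ge0; [lra|exact: divr_ge0].
have : 0 <= p%:R / q%:R :> R by rewrite divr_ge0.
lra.
Qed.

Lemma sqrt2_irrational : irrational sqrt2.
Proof.
move=> /rationalP[a [b e]]; have := sqrt2_sqr; have := sqrt2_ge1; rewrite {}e.
have [->|b0] := eqVneq b 0%N; first by rewrite invr0 mulr0; lra.
have bR : (b%:R : R) != 0 by rewrite pnatr_eq0.
move=> _; rewrite expr_div_n => /(canRL (divfK (expf_neq0 2 bR))) h.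
have {}h : (`|a| ^ 2 = 2 * b ^ 2)%N.
  apply/eqP; rewrite -(@eqr_nat R) natrX [(2 * _)%:R]natrM natrX -h.
  have -> : `|a|%:R = `|a%:~R| :> R by rewrite natr_absz intr_norm.
  by rewrite real_normK ?num_real.
(* The exponent of 2 is even on the left and odd on the right. *)
have := congr1 (logn 2) h; rewrite lognM ?expn_gt0 ?lt0n ?b0// !lognX.
by rewrite (_ : logn 2 2 = 1%N)//; lia.
Qed.

End pell.

(** * Unique ergodicity of the suspension flow *)

Section lebesgue_periodic.
Context {R : realType}.
Implicit Types (A Q : set (measurableTypeR R)) (s : R).
Local Notation lu := (@lebesgue_unit R).
Local Notation leb := (@lebesgue_measure R).

Definition transl s (x : measurableTypeR R) : measurableTypeR R := x + s.

Lemma measurable_shift s : measurable_fun setT (transl s).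
Proof. by apply: measurable_funD; [exact: measurable_id|exact: measurable_cst]. Qed.

HB.instance Definition _ s := isMeasurableFun.Build _ _ _ _ (transl s) (measurable_shift s).

Lemma measurable_preimage d1 d2 (T1 : measurableType d1) (T2 : measurableType d2)
  (f : T1 -> T2) (A : set T2) : measurable_fun setT f -> measurable A ->
  measurable (f @^-1` A).
Proof. by move=> mf mA; rewrite -[_ @^-1` _]setTI; exact: mf. Qed.

Lemma lebesgue_shift s A : measurable A -> leb (transl s @^-1` A) = leb A.
Proof.
move=> mA; have h := @lebesgue_measure_unique R (pushforward leb (transl s)).
apply/esym/(h (measurable_shift s)) => // X [[a b] _ <-]; rewrite /pushforward.
have e : transl s @^-1` `]a, b]%classic = `]a - s, b - s]%classic.
  by apply/seteqP; split => x /=; rewrite !in_itv/= /transl ltrBlDr lerBrDr.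
rewrite -[RHS]/(leb (transl s @^-1` `]a, b]%classic)) e.
rewrite !lebesgue_measure_itv/= !lte_fin ltrD2r; case: ifP => // _.
by rewrite -!EFinB; congr (_%:E); lra.
Qed.

Lemma lebesgue_unitE A : measurable A -> lu A = leb (A `&` `[0, 1[%classic).
Proof.
move=> mA; rewrite /lebesgue_unit /mrestr.
have -> : A `&` `[0, 1]%classic = (A `&` `[0, 1[%classic) `|` (A `&` [set 1]).
  rewrite -setIUr; congr (_ `&` _); apply/seteqP; split => x /=; rewrite !in_itv/=.
    by rewrite [x <= 1]le_eqVlt andb_orr => /orP[/andP[_ /eqP]|]; [right|left].
  by case=> [/andP[-> /ltW//]|->]; rewrite ler01 lexx.
rewrite measureU//.
- rewrite [X in (_ + X)%E](_ : _ = 0%E) ?adde0//.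
  apply/eqP; rewrite eq_le measure_ge0 andbT.
  rewrite -(lebesgue_measure_set1 (1 : R)); apply: le_measure; rewrite ?inE//.
  by apply: measurableI => //; exact: measurable_set1.
- by apply: measurableI => //; exact: measurable_itv.
- by apply: measurableI => //; exact: measurable_set1.
- by apply/seteqP; split => x //= [[_ /=]]; rewrite in_itv/= => /andP[_ x1] [_ e];
    rewrite e ltxx in x1.
Qed.

(** By periodicity the shift is some r in [0, 1). It carries the window [0, 1) to [r, 1 + r), whose
    part beyond 1 is a copy of the missing part [0, r). *)
Lemma lebesgue_unit_periodic Q s : measurable Q -> per1 Q ->
  lu (transl s @^-1` Q) = lu Q.
Proof.
move=> mQ pQ.
have -> : transl s @^-1` Q = transl (fpart s) @^-1` Q.
  apply/funext => x; rewrite /= /preimage /mkset /transl /fpart addrA -mulrNz.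
  by rewrite pQ.
have /andP[r0 r1] := fpart_itv s; set r := fpart s in r0 r1 *.
have mI a b : measurable (Q `&` `[a, b[%classic) by apply: measurableI => //; exact: measurable_itv.
rewrite !lebesgue_unitE//; last exact: (measurable_preimage (measurable_shift r)).
transitivity (leb (Q `&` `[r, 1 + r[%classic)).
  have e : transl r @^-1` (Q `&` `[r, 1 + r[%classic) = transl r @^-1` Q `&` `[0, 1[%classic.
    by apply/seteqP; split => x /=; rewrite !in_itv/= /transl lerDr ltrD2r.
  exact: (etrans (congr1 (fun X : set (measurableTypeR R) => leb X) (esym e))
    (lebesgue_shift r (mI _ _))).
rewrite [in RHS](_ : `[0, 1[%classic = `[0, r[%classic `|` `[r, 1[%classic :> set R);
  last by rewrite -itv_bndbnd_setU// bnd_simp// ltW.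
rewrite (_ : `[r, 1 + r[%classic = `[r, 1[%classic `|` `[1, 1 + r[%classic :> set R);
  last by rewrite -itv_bndbnd_setU// bnd_simp ?lerDl// ltW.
rewrite !setIUr !measureU//.
- rewrite addeC; congr (_ + _)%E.
  have e : transl 1 @^-1` (Q `&` `[1, 1 + r[%classic) = Q `&` `[0, r[%classic.
    by apply/seteqP; split => x /=;
      rewrite !in_itv/= /transl lerDr [1 + r]addrC ltrD2r -[1]/(1%:~R) pQ.
  exact: (etrans (esym (lebesgue_shift 1 (mI _ _)))
    (congr1 (fun X : set (measurableTypeR R) => leb X) e)).
- apply/seteqP; split => x //= [[_ +] [_]]; rewrite /= !in_itv/= => /andP[_ h1] /andP[h2 _].
  by have := lt_le_trans h1 h2; rewrite ltxx.
- apply/seteqP; split => x //= [[_ +] [_]]; rewrite /= !in_itv/= => /andP[_ h1] /andP[h2 _].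
  by have := lt_le_trans h1 h2; rewrite ltxx.
Qed.

Definition fpart_shift s (x : measurableTypeR R) : measurableTypeR R := fpart (x + s).

Lemma measurable_fpart A :
  measurable A -> measurable ((@fpart R) @^-1` A : set (measurableTypeR R)).
Proof.
move=> mA.
have -> : (@fpart R) @^-1` A = \bigcup_(m : int)
   (`[m%:~R, (m + 1)%:~R[%classic `&` transl (- m%:~R) @^-1` A).
  apply/seteqP; split => x /=.
    move=> Ax; exists (Num.floor x) => //; split => //.
    by rewrite /= in_itv/= floor_itv.
  move=> [m _ [/=]]; rewrite in_itv/= => mx; rewrite /transl /= /preimage /mkset.
  by rewrite /fpart (floor_def mx).
apply: countable_bigcupT_measurable => // m.
apply: measurableI; first exact: measurable_itv.
exact: (measurable_preimage (measurable_shift _)).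
Qed.

Lemma measurable_fpart_shift s : measurable_fun setT (fpart_shift s).
Proof.
move=> _ A mA; rewrite setTI.
exact: (measurable_preimage (measurable_shift s) (measurable_fpart mA)).
Qed.

Lemma lebesgue_unit_fpart_shift s A : measurable A ->
  lu (fpart_shift s @^-1` A) = lu A.
Proof.
move=> mA; have mQ := measurable_fpart mA.
have pQ : per1 ((@fpart R) @^-1` A).
  by move=> x m; rewrite /preimage/mkset fpartDint.
rewrite [LHS](lebesgue_unit_periodic s mQ pQ) !lebesgue_unitE//.
have -> // : (@fpart R) @^-1` A `&` `[0, 1[%classic = A `&` `[0, 1[%classic.
apply/seteqP; split => x [/= Ax x01]; split => //; move: x01 Ax;
  by rewrite /= in_itv/= => x01; rewrite /preimage /mkset (@fpartE _ x x 0) ?addr0.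
Qed.

Lemma integral_fpart_shift s (f : measurableTypeR R -> \bar R) :
  measurable_fun setT f -> (forall x, 0 <= f x)%E ->
  (\int[lu]_x f (fpart_shift s x) = \int[lu]_x f x)%E.
Proof.
move=> mf f0.
have := @ge0_integral_pushforward _ _ _ _ R _ (measurable_fpart_shift s) lu setT f.
move=> /(_ measurableT mf (fun x _ => f0 x)) => h.
rewrite preimage_setT in h; rewrite -[LHS]h.
apply: (eq_measure_integral lu); first exact: measurable_fpart_shift.
by move=> ? A mA _; exact: lebesgue_unit_fpart_shift.
Qed.

Lemma lebesgue_unit_ae (P : R -> Prop) : (forall x, 0 <= x < 1 -> P x) ->
  {ae lu, forall x, P x}.
Proof.
move=> h; exists (~` `[0, 1[%classic); split.
- by apply: measurableC; exact: measurable_itv.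
- rewrite lebesgue_unitE ?setICl ?measure0//.
  by apply: measurableC; exact: measurable_itv.
- by move=> x /= nP /=; rewrite in_itv/= => x01; exact/nP/h.
Qed.

End lebesgue_periodic.

(** * Invariance of Lebesgue measure under the suspension flow *)

Section torus_measure.
Context {R : realType} (al : R).
Local Notation lu := (@lebesgue_unit R).
Local Notation mu := (@lebesgue_torus R al).
Implicit Types (B : set (borel (torus al))).

Let mRR := (measurableTypeR R * measurableTypeR R)%type.

Lemma measurable_torus_preimage B : measurable B ->
  measurable (torus_proj al @^-1` B : set mRR).
Proof. exact: measurable_preimage (@measurable_torus_proj R al). Qed.

Lemma lebesgue_torusE B : measurable B ->
  mu B = (\int[lu]_y lu (ysection (torus_proj al @^-1` B : set mRR) y))%E.
Proof.
move=> mB; rewrite /lebesgue_torus /distribution /pushforward.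
have mP := measurable_torus_preimage mB.
(* The product measure is rewritten in its other iterated form, which integrates horizontal slices;
   uniqueness of the product measure identifies the two. *)
transitivity ((lu \x^ lu)%E (torus_proj al @^-1` B : set mRR)); last by [].
apply: product_measure_unique => // A1 A2 mA1 mA2.
exact: product_measure2E.
Qed.

Lemma tp_fpart x y :
  tp al x y = torus_proj al (x + (Num.floor y)%:~R * al, fpart y).
Proof.
have /andP[h0 h1] := fpart_itv y.
rewrite torus_projE -tp_tpi; last by rewrite h0 ltW.
by rewrite -tpDy /fpart subrK.
Qed.

Lemma measurable_flow t : measurable_fun setT
  (@suspension_flow R al t : borel (torus al) -> borel (torus al)).
Proof.
apply: borel_measurable_fun => U oU; apply: sub_sigma_algebra.
have [_ _ c] := @suspension_continuous_flow R al.
have ct : continuous (fun w => @suspension_flow R al t w).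
  exact: (comp_cont (pair_cont (fun w => cvg_cst t) (fun w => cvg_id)) c).
by move/continuousP : ct; exact.
Qed.

(** The slice at height y is sent to the slice at height y + t modulo 1 by a translation of the
    base. Slices are 1-periodic sets, so their measure is unchanged, and the heights are permuted by
    a rotation of [0, 1). *)
Lemma lebesgue_torus_invariant : invariant_probability (@suspension_flow R al) mu.
Proof.
move=> t B mB.
have mB' : measurable (@suspension_flow R al t @^-1` B : set (borel (torus al))).
  exact: (measurable_preimage (measurable_flow t)).
have mP := measurable_torus_preimage mB.
rewrite !lebesgue_torusE//.
pose G (y : measurableTypeR R) := lu (ysection (torus_proj al @^-1` B : set mRR) y).
have mG : measurable_fun setT G by exact: measurable_fun_ysection.
have G0 y : (0 <= G y)%E by exact: measure_ge0.
rewrite -[RHS](integral_fpart_shift t mG G0).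
apply: ge0_ae_eq_integral => //.
- exact: (measurable_fun_ysection _ (measurable_torus_preimage mB')).
- exact: measurableT_comp mG (measurable_fpart_shift t).
apply: lebesgue_unit_ae => y /andP[y0 y1] _.
rewrite /G.
pose c := (Num.floor (y + t))%:~R * al.
rewrite -[RHS](@lebesgue_unit_periodic _ _ c).
- have e x : suspension_flow t (torus_proj al (x, y)) =
      torus_proj al (transl c x, fpart_shift t y).
    by rewrite torus_projE -tp_tpi ?flow_tp ?tp_fpart// y0 ltW.
  by congr (lu _); apply/seteqP; split => x;
    rewrite /preimage /mkset /ysection/= !inE /= e.
- exact: measurable_ysection.
- move=> x m; apply/propext; rewrite /ysection /= !inE /= !torus_projE /=.
  by rewrite cpiDint.
Qed.

End torus_measure.

(** * Every invariant measure agrees with area on boxes *)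

Section unique_ergodicity.
Context {R : realType} (al : R).
Local Notation flow := (@suspension_flow R al).
Implicit Types (w : torus al) (B : set (borel (torus al))).

Lemma tcoord_subproof w : exists p : R * R,
  [/\ 0 <= p.1 < 1, 0 <= p.2 < 1 & w = tp al p.1 p.2].
Proof. by have [x [y h]] := tpP w; exists (x, y). Qed.

Definition tcoord w : R * R := projT1 (cid (tcoord_subproof w)).

Lemma tcoordP w : [/\ 0 <= (tcoord w).1 < 1, 0 <= (tcoord w).2 < 1 &
  w = tp al (tcoord w).1 (tcoord w).2].
Proof. exact: projT2 (cid (tcoord_subproof w)). Qed.

Lemma int_small (x : R) : x \is a Num.int -> -1 < x -> x < 1 -> x = 0.
Proof.
move=> /intrP[m ->]; rewrite -[1]/(1%:~R) -mulrNz !ltr_int => h1 h2.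
by have -> : m = 0 by lia.
Qed.

Lemma tcoord_tp_itv x y : 0 <= x < 1 -> 0 <= y < 1 -> tcoord (tp al x y) = (x, y).
Proof.
move=> x01 y01; have := tcoordP (tp al x y).
case: (tcoord _) => a b /= [a01 b01] /tp_eqP[h1 h2].
have e : y - b = 0 by apply: int_small => //; lra.
have {e}e : b = y by lra.
rewrite e; congr pair; rewrite e in h2.
have h3 : x - a \is a Num.int by move: h2; congr (_ \is a Num.int); ring.
by have : x - a = 0 by [apply: int_small => //; lra]; lra.
Qed.

Lemma tcoord_tp x y :
  tcoord (tp al x y) = (fpart (x + (Num.floor y)%:~R * al), fpart y).
Proof.
rewrite -[y in LHS](subrK (Num.floor y)%:~R) tpDy -/(fpart y).
set z := x + _.
rewrite -[z in LHS](subrK (Num.floor z)%:~R) tpDx -/(fpart z).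
by rewrite tcoord_tp_itv ?fpart_itv.
Qed.

Definition box (a b c d : R) : set (borel (torus al)) :=
  [set w | (a <= (tcoord w).1 < b) && (c <= (tcoord w).2 < d)].

Lemma closed_torus_image (A : set (R * R)) : compact A ->
  closed (torus_proj al @` A).
Proof.
move=> cA; apply: compact_closed; first exact: torus_hausdorff.
apply: continuous_compact => //; exact/continuous_subspaceT/torus_proj_continuous.
Qed.

Lemma closed_borel (T : ptopologicalType) (A : set T) : closed A ->
  measurable (A : set (borel T)).
Proof.
move=> cA; rewrite -[A]setCK; apply: measurableC; apply: sub_sigma_algebra.
exact: closed_openC.
Qed.

(** A half-open box is a countable union of images of closed rectangles, which are compact and hence
    closed. *)
Lemma measurable_box a b c d : 0 <= a -> b <= 1 -> 0 <= c -> d <= 1 ->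
  measurable (box a b c d).
Proof.
move=> a0 b1 c0 d1.
have -> : box a b c d = \bigcup_n (torus_proj al @`
    (`[a, b - n.+1%:R^-1]%classic `*` `[c, d - n.+1%:R^-1]%classic)).
  apply/seteqP; split => w.
    move=> /andP[/andP[h1 h2] /andP[h3 h4]]; have [x01 y01 e] := tcoordP w.
    have [n hn] : exists n : nat, n.+1%:R^-1 < Num.min (b - (tcoord w).1) (d - (tcoord w).2).
      have m0 : 0 < Num.min (b - (tcoord w).1) (d - (tcoord w).2).
        by rewrite lt_min !subr_gt0 h2.
      exists (Num.bound (Num.min (b - (tcoord w).1) (d - (tcoord w).2))^-1).
      rewrite invf_plt ?posrE//.
      apply: (@lt_trans _ _ (Num.bound (Num.min (b - (tcoord w).1) (d - (tcoord w).2))^-1)%:R).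
        by apply: archi_boundP; rewrite invr_ge0 ltW.
      by rewrite ltr_nat.
    move: hn; rewrite lt_min => /andP[n1 n2].
    exists n => //; exists (tcoord w).
      by split; rewrite /= in_itv/= ?h1 ?h3/= lerBrDr -lerBrDl ltW.
    rewrite torus_projE -tp_tpi//; case/andP: y01 => -> /ltW -> //.
  move=> [n _ [[x y] [/=]]]; rewrite !in_itv/= => /andP[h1 h2] /andP[h3 h4] <-.
  have n0 : 0 < n.+1%:R^-1 :> R by rewrite invr_gt0.
  move: (n.+1%:R^-1) n0 h2 h4 => e e0 h2 h4.
  rewrite /box /= torus_projE -tp_tpi /=; last by apply/andP; split; lra.
  by rewrite tcoord_tp_itv/= ?h1 ?h3/=; lra.
apply: bigcupT_measurable => n; apply: closed_borel; apply: closed_torus_image.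
by apply: compact_setX; exact: segment_compact.
Qed.

(** Integrate the number of visits to [B] at the times [t i]: by invariance each time contributes
    [nu B], while the integrand is at least [c] everywhere. *)
Lemma invariant_count (nu : probability (borel (torus al)) R) (I : finType)
    (t : I -> R) B (c : R) :
  invariant_probability flow nu -> measurable B ->
  (forall w, c <= #|[set i | `[< B (flow (t i) w) >]]%SET|%:R) ->
  (c%:E <= #|I|%:R%:E * nu B)%E.
Proof.
move=> inv mB h.
have [c0|c0] := leP c 0.
  apply: (@le_trans _ _ 0%E); first by rewrite lee_fin.
  by rewrite mule_ge0// lee_fin.
have mpre i : measurable (flow (t i) @^-1` B : set (borel (torus al))).
  exact: (measurable_preimage (@measurable_flow R al (t i))).
pose f i (w : borel (torus al)) : \bar R := (\1_(flow (t i) @^-1` B) w)%:E.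
have -> : (#|I|%:R%:E * nu B = \int[nu]_w (\sum_(i <- index_enum I) f i w))%E.
  rewrite ge0_integral_sum//; last 2 first.
  - by move=> i; apply/measurable_EFinP; exact: measurable_indic.
  - by move=> i w _; rewrite lee_fin.
  rewrite (eq_bigr (fun=> nu B)) => [|i _]; last first.
    by rewrite /f integral_indic// setIT -(inv (t i)).
  have -> : nu B = (fine (nu B))%:E by rewrite fineK// fin_num_measure.
  by rewrite sumEFin -EFinM mulr_natl -sumr_const; congr (_%:E); apply: eq_bigl.
have <- : (\int[nu]_w (cst c%:E w) = c%:E)%E.
  by rewrite integral_cst// -[X in _ = X]mule1 -(@probability_setT _ _ _ nu).
apply: ge0_le_integral => //.
- by move=> w _; rewrite lee_fin ltW.
- apply: emeasurable_sum => i; apply/measurable_EFinP; exact: measurable_indic.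
move=> w _; rewrite /f sumEFin lee_fin; apply: le_trans (h w) _.
rewrite -sum1_card natr_sum big_mkcond/=.
apply: ler_sum => i _; rewrite inE indicE.
case: asboolP => hi; last exact: ler0n.
by rewrite (@mem_set _ (flow (t i) @^-1` B) w hi).
Qed.

Definition well_approximable := forall N : nat, exists p q : nat,
  [/\ (N < q)%N, coprime p q & `|al - p%:R / q%:R| <= q%:R^-1 ^+ 2].

Hypothesis al_approx : well_approximable.

(** Sample at the times j/m + k. The heights y + j/m form a grid of mesh 1/m modulo 1, and for each
    j the integer times k move the base point along q steps of the rotation, a grid of mesh 1/q. *)
Lemma box_count_orbit w a b c d p q m : (0 < q)%N -> (0 < m)%N -> coprime p q ->
  `|al - p%:R / q%:R| <= q%:R^-1 ^+ 2 ->
  0 <= a -> b <= 1 -> 0 <= c -> d <= 1 ->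
  0 <= q%:R * (b - a) - 4 -> 
  (q%:R * (b - a) - 4) * (m%:R * (d - c) - 4) <=
  #|[set i : 'I_m * 'I_q |
     `[< box a b c d (flow (i.1%:R / m%:R + i.2%:R) w) >]]%SET|%:R :> R.
Proof.
move=> q0 m0 pq alpq a0 b1 c0 d1 k0.
have [x [y [x01 y01 ->]]] := tpP w.
have mR : (m%:R : R) != 0 by rewrite pnatr_eq0 -lt0n.
pose J := [set j : 'I_m | (c <= fpart (y + j%:R * m%:R^-1) < d)%R]%SET.
have hJ : m%:R * (d - c) - 4 <= #|J|%:R :> R.
  apply: grid_count_itv => //; apply: (@rotation_grid _ _ _ 1) => //.
    by rewrite /coprime gcd1n.
  by rewrite div1r subrr normr0 exprn_ge0// invr_ge0.
pose z (j : 'I_m) := x + (Num.floor (y + j%:R * m%:R^-1))%:~R * al.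
pose K j := [set k : 'I_q | (a <= fpart (z j + k%:R * al) < b)%R]%SET.
have hK j : q%:R * (b - a) - 4 <= #|K j|%:R :> R.
  by apply: grid_count_itv => //; exact: rotation_grid pq alpq.
apply: (@le_trans _ _ ((q%:R * (b - a) - 4) * #|J|%:R)).
  by rewrite ler_wpM2l.
apply: (@le_trans _ _ (\sum_(j in J) #|K j|%:R)).
  rewrite [leLHS]mulr_natr -sumr_const; apply: ler_sum => j _; exact: hK.
rewrite -natr_sum ler_nat.
have -> : (\sum_(j in J) #|K j| = #|[set i : 'I_m * 'I_q | (i.1 \in J) && (i.2 \in K i.1)]%SET|)%N.
  rewrite -sum1_card; under [LHS]eq_bigr do rewrite -sum1_card.
  rewrite pair_big_dep /=; apply: eq_bigl => -[j k] /=; by rewrite [RHS]inE.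
apply: subset_leq_card; apply/fintype.subsetP => -[j k]; rewrite !inE /= => /andP[hj hk].
apply/asboolP; rewrite flow_tp /box /= tcoord_tp /=.
have -> : y + (j%:R / m%:R + k%:R) = y + j%:R / m%:R + k%:Z%:~R by rewrite addrA.
rewrite fpartDint hj andbT floorDrz ?intr_int// intrKfloor.
by rewrite intrD mulrDl addrA; apply/asboolP; exact: hk.
Qed.

Lemma box_lower (nu : probability (borel (torus al)) R) a b c d :
  invariant_probability flow nu ->
  0 <= a <= b -> b <= 1 -> 0 <= c <= d -> d <= 1 ->
  (((b - a) * (d - c))%:E <= nu (box a b c d))%E.
Proof.
move=> inv /andP[a0 ab] b1 /andP[c0 cd] d1.
have mB := measurable_box a0 b1 c0 d1.
have rE : nu (box a b c d) = (fine (nu (box a b c d)))%:E.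
  by rewrite fineK// fin_num_measure.
set r := fine _ in rE; have r0 : 0 <= r by rewrite -lee_fin -rE.
rewrite rE lee_fin leNgt; apply/negP => rlt.
set u := b - a in rlt; set v := d - c in rlt.
have u0 : 0 <= u by rewrite /u; lra.
have v0 : 0 <= v by rewrite /v; lra.
have u1 : u <= 1 by rewrite /u; lra.
have v1 : v <= 1 by rewrite /v; lra.
(* Once e q > 4, the q^2 sampled times make more than q^2 (u - e) (v - e) visits, which is at least
   q^2 (u v - 2 e) = q^2 r and contradicts [invariant_count]. *)
pose e := (u * v - r) / 2.
have e0 : 0 < e by rewrite /e; lra.
have [N hN] : exists N : nat, 4 / e < N%:R.
  exists (Num.bound (4 / e)); apply: archi_boundP; rewrite divr_ge0//; lra.
have {}hN : 4 < e * N%:R by rewrite mulrC -ltr_pdivrMr.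
have [p [q [Nq pq alpq]]] := al_approx N.
have q0 : (0 < q)%N by exact: leq_ltn_trans Nq.
have qN : (N%:R : R) < q%:R by rewrite ltr_nat.
have q4 : 4 < e * q%:R by apply: lt_trans hN _; rewrite ltr_pM2l.
have uvu : u * v <= u by rewrite ler_piMr.
have uvv : u * v <= v by rewrite ler_piMl.
have eu : e <= u by rewrite /e; lra.
have ev : e <= v by rewrite /e; lra.
have qR : 0 < (q%:R : R) by rewrite ltr0n.
have qeu : e * q%:R <= u * q%:R by rewrite ler_wpM2r// ltW.
have h0 : 0 <= q%:R * u - 4 by rewrite mulrC; lra.
have := invariant_count inv mB (fun w => box_count_orbit w q0 q0 pq alpq a0 b1 c0 d1 h0).
rewrite card_prod !card_ord rE -EFinM lee_fin natrM -/u -/v.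
suff : q%:R * q%:R * r < (q%:R * u - 4) * (q%:R * v - 4).
  by move=> h1 h2; have := lt_le_trans h1 h2; rewrite ltxx.
have k1 : q%:R * (u - e) < q%:R * u - 4 by rewrite mulrBr [_ * e]mulrC; lra.
have k2 : q%:R * (v - e) < q%:R * v - 4 by rewrite mulrBr [_ * e]mulrC; lra.
have k3 : 0 <= q%:R * (u - e) by apply: mulr_ge0; [exact: ltW|lra].
have k4 : 0 <= q%:R * (v - e) by apply: mulr_ge0; [exact: ltW|lra].
have k5 : (q%:R * (u - e)) * (q%:R * (v - e)) < (q%:R * u - 4) * (q%:R * v - 4).
  by apply: ltr_pM.
apply: le_lt_trans k5; rewrite [leRHS]mulrACA ler_pM2l ?mulr_gt0//.
have -> : r = u * v - 2 * e by rewrite /e; field.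
have : 0 <= e * e by rewrite mulr_ge0// ltW.
have : e * (u + v) <= e * 2 by apply: ler_wpM2l; [exact: ltW|lra].
have -> : (u - e) * (v - e) = u * v - e * (u + v) + e * e by ring.
lra.
Qed.

(** The complement of the box is cut into four boxes. Their lower bounds and that of the box itself
    add up to 1, the total mass, so all of them are equalities. *)
Lemma box_measure (nu : probability (borel (torus al)) R) a b c d :
  invariant_probability flow nu ->
  0 <= a <= b -> b <= 1 -> 0 <= c <= d -> d <= 1 ->
  nu (box a b c d) = ((b - a) * (d - c))%:E.
Proof.
move=> inv ab b1 cd d1; apply/eqP; rewrite eq_le box_lower// andbT.
have /andP[a0 ab'] := ab; have /andP[c0 cd'] := cd.
pose B1 := box 0 a 0 1; pose B2 := box b 1 0 1.
pose B3 := box a b 0 c; pose B4 := box a b d 1.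
have m1 : measurable B1 by apply: measurable_box => //; lra.
have m2 : measurable B2 by apply: measurable_box => //; lra.
have m3 : measurable B3 by apply: measurable_box => //; lra.
have m4 : measurable B4 by apply: measurable_box => //; lra.
have mB : measurable (box a b c d) by apply: measurable_box.
have cover : ~` box a b c d = B1 `|` B2 `|` B3 `|` B4.
  apply/seteqP; split => w; have [/andP[h1 h2] /andP[h3 h4] _] := tcoordP w.
    rewrite /setC /= /B1 /B2 /B3 /B4 /box /= => /negP.
    rewrite !negb_and -!ltNge -!leNgt => /orP[|] /orP[] h.
    + by left; left; left; rewrite h1 h h3 h4.
    + by left; left; right; rewrite h h2 h3 h4.
    + have [h'|h'] := ltP (tcoord w).1 a; first by left; left; left; rewrite h1 h3 h4.
      have [h''|h''] := ltP (tcoord w).1 b; last by left; left; right; rewrite h2 h3 h4.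
      by left; right; rewrite h3 h.
    + have [h'|h'] := ltP (tcoord w).1 a; first by left; left; left; rewrite h1 h3 h4.
      have [h''|h''] := ltP (tcoord w).1 b; last by left; left; right; rewrite h2 h3 h4.
      by right; rewrite h h4.
  rewrite /setC /= /B1 /B2 /B3 /B4 /box /=.
  move=> [[[|]|]|] /andP[/andP[k1 k2] /andP[k3 k4]] /andP[/andP[k5 k6] /andP[k7 k8]]; lra.
have disj (X Y : set (borel (torus al))) : (forall w, X w -> Y w -> False) -> X `&` Y = set0.
  by move=> h; apply/seteqP; split => // w [] /h; apply.
have : nu (~` box a b c d) = (1 - nu (box a b c d))%E by exact: probability_setC.
have disjB (X : set (borel (torus al))) a' b' c' d' :
    (forall w, X w -> [\/ (tcoord w).1 < a', b' <= (tcoord w).1,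
      (tcoord w).2 < c' | d' <= (tcoord w).2]) -> X `&` box a' b' c' d' = set0.
  move=> h; apply: disj => w /h h' /andP[/andP[k1 k2] /andP[k3 k4]].
  by case: h' => h'; lra.
have d12 : B1 `&` B2 = set0.
  by apply: disjB => w /andP[/andP[_ k] _]; apply: Or41; lra.
have d3 : (B1 `|` B2) `&` B3 = set0.
  apply: disjB => w [] /andP[/andP[k1 k2] _]; first exact: Or41.
  exact: Or42.
have d4 : (B1 `|` B2 `|` B3) `&` B4 = set0.
  apply: disjB => w [[]|] /andP[/andP[k1 k2] /andP[_ k3]]; first exact: Or41.
    exact: Or42.
  apply: Or43; lra.
have m12 := measurableU _ _ m1 m2; have m123 := measurableU _ _ m12 m3.
have e4 := measureU nu m123 m4 d4; have e3 := measureU nu m12 m3 d3.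
have e2 := measureU nu m1 m2 d12; rewrite cover e4 e3 e2.
have fE B : measurable B -> nu B = (fine (nu B))%:E.
  by move=> ?; rewrite fineK// fin_num_measure.
have l1 : ((a * 1)%:E <= nu B1)%E.
  by rewrite -[a]subr0 -[1]subr0; apply: box_lower => //; lra.
have l2 : (((1 - b) * 1)%:E <= nu B2)%E.
  by rewrite -[X in _ * X]subr0; apply: box_lower => //; lra.
have l3 : (((b - a) * c)%:E <= nu B3)%E.
  by rewrite -[c in X in (X <= _)%E]subr0; apply: box_lower => //; lra.
have l4 : (((b - a) * (1 - d))%:E <= nu B4)%E.
  by apply: box_lower => //; lra.
move: l1 l2 l3 l4; rewrite (fE _ m1) (fE _ m2) (fE _ m3) (fE _ m4) (fE _ mB).
rewrite !lee_fin => l1 l2 l3 l4 e.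
have {e} [e] : (fine (nu B1) + fine (nu B2) + fine (nu B3) + fine (nu B4))%:E =
    (1 - fine (nu (box a b c d)))%:E :> \bar R.
  by rewrite EFinB !EFinD -(fE _ m1) -(fE _ m2) -(fE _ m3) -(fE _ m4); exact: e.
lra.
Qed.

Definition boxes : set (set (borel (torus al))) :=
  fun X => exists a b c d, [/\ 0 <= a, b <= 1, 0 <= c, d <= 1 & X = box a b c d].

Lemma boxes_measure (nu : probability (borel (torus al)) R) a b c d :
  invariant_probability flow nu -> 0 <= a -> b <= 1 -> 0 <= c -> d <= 1 ->
  nu (box a b c d) = (Num.max 0 (b - a) * Num.max 0 (d - c))%:E.
Proof.
move=> inv a0 b1 c0 d1.
have emp : b < a \/ d < c -> box a b c d = set0.
  by move=> h; apply/seteqP; split => // w /andP[/andP[h1 h2] /andP[h3 h4]];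
    case: h => h; lra.
have [ab|ab] := leP a b; last first.
  by rewrite emp ?measure0; [rewrite max_l ?mul0r//; lra|left].
have [cd|cd] := leP c d; last first.
  by rewrite emp ?measure0; [rewrite [X in _ * X]max_l ?mulr0//; lra|right].
by rewrite !max_r ?subr_ge0//; apply: box_measure; rewrite ?a0 ?c0.
Qed.

Lemma ratr_sandwich (x e : R) : 0 <= x < 1 -> 0 < e -> exists q : rat * rat,
  [/\ 0 <= ratr q.1 :> R, ratr q.2 <= 1 :> R, x - e < ratr q.1 <= x &
   x < ratr q.2 < x + e].
Proof.
move=> /andP[x0 x1] e0.
have ratI (u v : R) : u < v -> exists q, u < ratr q < v.
  by move=> /rat_in_itvoo[q]; rewrite in_itv/=; exists q.
have [b /andP[xb]] : exists q, x < ratr q < Num.min 1 (x + e).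
  by apply: ratI; rewrite lt_min x1/=; lra.
rewrite lt_min => /andP[b1 be].
(* At x = 0 the left end cannot go below x without leaving [0, 1]; the box starts at 0 itself. *)
have [xz|xn0] := eqVneq x 0.
  exists (0, b); rewrite /= rmorph0; split => //; first exact: ltW.
    by rewrite xz; apply/andP; split; lra.
  by rewrite xb be.
have xp : 0 < x by rewrite lt_neqAle eq_sym xn0.
have [a /andP[+ ax]] : exists q, Num.max 0 (x - e) < ratr q < x.
  by apply: ratI; rewrite gt_max xp/=; lra.
rewrite gt_max => /andP[a0 ae].
by exists (a, b); split; rewrite /= ?ae ?xb ?be//; exact: ltW.
Qed.

Lemma measurable_boxes : @measurable _ (borel (torus al)) = <<s boxes >>.
Proof.
apply/seteqP; split.
  apply: smallest_sub; first exact: smallest_sigma_algebra.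
  move=> U oU.
  pose Q := ((rat * rat) * (rat * rat))%type.
  pose bx (q : Q) := box (ratr q.1.1) (ratr q.1.2) (ratr q.2.1) (ratr q.2.2).
  pose ok (q : Q) := [/\ 0 <= ratr q.1.1 :> R, ratr q.1.2 <= 1 :> R,
    0 <= ratr q.2.1 :> R & ratr q.2.2 <= 1 :> R].
  have -> : U = \bigcup_(q in [set q | ok q /\ bx q `<=` U]) bx q.
    apply/seteqP; split => [w Uw|w [q [_ qU]]]; last exact: qU.
    have [x01 y01 we] := tcoordP w.
    set x := (tcoord w).1 in x01 we; set y := (tcoord w).2 in y01 we.
    have clw u v : 0 <= v < 1 -> torus_proj al (u, v) = tp al u v.
      by move=> /andP[v0 v1]; rewrite torus_projE -tp_tpi// v0 ltW.
    have : nbhs (x, y) (torus_proj al @^-1` U).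
      apply: open_nbhs_nbhs; split.
        by have /continuousP := @torus_proj_continuous R al; apply.
      by rewrite /preimage /mkset clw// -we.
    move=> [[/= A B] [/nbhs_ballP[e /= e0 eA] /nbhs_ballP[f /= f0 fB]] ABU].
    have [[a b] [/= a0 b1 /andP[ea ax] /andP[xb be]]] := ratr_sandwich x01 e0.
    have [[c d] [/= c0 d1 /andP[fc cy] /andP[yd df]]] := ratr_sandwich y01 f0.
    exists ((a, b), (c, d)); last by rewrite /bx /box /= -/x -/y ax xb cy yd.
    split => // w' /andP[/= /andP[h1 h2] /andP[h3 h4]].
    have [x01' y01' ->] := tcoordP w'; rewrite -clw//.
    by apply: ABU; split; [apply: eA|apply: fB]; rewrite /ball/= ltr_distlC;
      apply/andP; split; lra.
  rewrite bigcup_mkcond.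
  apply: (@countable_bigcupT_measurable _ (g_sigma_algebraType boxes)).
    exact: countableP.
  move=> q.
  case: ifP => [/set_mem [[a0 b1 c0 d1] _]|_]; last exact: measurable0.
  apply: sub_sigma_algebra; exists (ratr q.1.1), (ratr q.1.2), (ratr q.2.1), (ratr q.2.2).
  by [].
apply: smallest_sub; first exact: sigma_algebra_measurable.
by move=> _ [a [b [c [d [a0 b1 c0 d1 ->]]]]]; exact: measurable_box.
Qed.

Lemma torus_uniquely_ergodic : uniquely_ergodic flow (@lebesgue_torus R al).
Proof.
have inv := @lebesgue_torus_invariant R al.
split => // nu nuinv B mB.
apply: (@measure_unique _ R _ boxes (fun=> box 0 1 0 1)) => //.
- exact: measurable_boxes.
- move=> _ _ [a [b [c [d [a0 b1 c0 d1 ->]]]]] [a' [b' [c' [d' [a0' b1' c0' d1' ->]]]]].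
  exists (Num.max a a'), (Num.min b b'), (Num.max c c'), (Num.min d d').
  split; rewrite ?le_max ?ge_min ?a0 ?b1 ?c0 ?d1//.
  apply/seteqP; split => w; rewrite /box /setI /= !ge_max !lt_min.
    by move=> [/andP[/andP[-> ->] /andP[-> ->]] /andP[/andP[-> ->] /andP[-> ->]]].
  by move=> /andP[/andP[/andP[-> ->] /andP[-> ->]] /andP[/andP[-> ->] /andP[-> ->]]].
- by move=> i; exists 0, 1, 0, 1; split.
- apply/seteqP; split => // w _; exists 0%N => //.
  by rewrite /box /=; have [-> ->] := tcoordP w.
- move=> _ [a [b [c [d [a0 b1 c0 d1 ->]]]]].
  exact: (etrans (boxes_measure nuinv a0 b1 c0 d1) (esym (boxes_measure inv a0 b1 c0 d1))).
- move=> k; apply: (@le_lt_trans _ _ (1 : \bar R)%E); last exact: ltry.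
  by apply: probability_le1; exact: measurable_box.
Qed.

End unique_ergodicity.

Lemma sqrt2_well_approximable (R : realType) : well_approximable (@sqrt2 R).
Proof.
move=> N; exists (pell N).1, (pell N).2.
by rewrite pell_gt pell_coprime; split => //; exact: pell_approx.
Qed.

(** * The canonical extension *)

Section smooth_step.
Context {R : realType}.
Implicit Types (s t : R).

(** A second-order remainder bound treats [pos2] at its junction 0 like everywhere else, without
    one-sided derivatives. *)
Lemma is_derive_quadratic (f : R -> R) s d (K : R) :
  (forall t, `|f (s + t) - f s - d * t| <= K * t ^+ 2) -> is_derive s 1 f d.
Proof.
move=> h.
have c : h^-1 *: (f (h *: 1 + s) - f s) @[h --> 0^'] --> d.
  apply/cvgrPdist_le => /= e e0.
  have K0 : 0 <= K by have := le_trans (normr_ge0 _) (h 1); rewrite expr1n mulr1.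
  near=> t.
  have t0 : t != 0 by near: t; exact: nbhs_dnbhs_neq.
  rewrite -normrN opprB.
  have -> : t^-1 *: (f (t *: 1 + s) - f s) - d = t^-1 * (f (s + t) - f s - d * t).
    by rewrite -[_ *: 1]/(t * 1) mulr1 -[_ *: _]/(_ * _) [t + s]addrC; field.
  rewrite normrM normfV ler_pdivrMl ?normr_gt0//.
  apply: le_trans (h t) _; rewrite -real_normK ?num_real// expr2 mulrCA ler_wpM2l//.
  have : `|t| <= e / (K + 1).
    near: t; apply: dnbhs0_le; rewrite divr_gt0//; lra.
  rewrite ler_pdivlMr; last by lra.
  have := normr_ge0 t; nra.
apply: DeriveDef; first by apply/cvg_ex; exists d.
exact/cvg_lim.
Unshelve. all: by end_near. Qed.

Definition pos2 s := Num.max s 0 ^+ 2.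

Lemma is_derive_pos2 s : is_derive s 1 pos2 (2 * Num.max s 0).
Proof.
apply: (@is_derive_quadratic _ _ _ 1) => t; rewrite /pos2 mul1r ler_norml.
by have [h1|h1] := leP s 0; have [h2|h2] := leP (s + t) 0; apply/andP; split; nra.
Qed.

(** A C^1 quadratic spline: 0 up to 0, then 2 s^2 up to 1/2, then 1 - 2 (1 - s)^2 up to 1, and 1
    afterwards. *)
Definition sgm s : R := 2 * pos2 s - 4 * pos2 (s - 1 / 2) + 2 * pos2 (s - 1).
Definition dsgm s : R :=
  4 * Num.max s 0 - 8 * Num.max (s - 1 / 2) 0 + 4 * Num.max (s - 1) 0.

Lemma is_derive_translate (f : R -> R) s c d : is_derive (s + c) 1 f d ->
  is_derive s 1 (fun t => f (t + c)) d.
Proof.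
move=> h; rewrite -[d]mulr1.
apply: (@is_derive1_comp _ f (fun t => t + c)).
by apply: is_derive_eq; rewrite addr0.
Qed.

Lemma is_derive_sgm s : is_derive s 1 sgm (dsgm s).
Proof.
have h0 := is_derive_pos2 s.
have h1 := is_derive_translate (is_derive_pos2 (s - 1 / 2)).
have h2 := is_derive_translate (is_derive_pos2 (s - 1)).
have h := is_deriveD (is_deriveB (is_deriveZ 2 h0) (is_deriveZ 4 h1)) (is_deriveZ 2 h2).
have -> : dsgm s = 2 * (2 * Num.max s 0) - 4 * (2 * Num.max (s - 1 / 2) 0) +
    2 * (2 * Num.max (s - 1) 0) by rewrite /dsgm; ring.
exact: h.
Qed.

Lemma sgm_le0 s : s <= 0 -> sgm s = 0.
Proof.
move=> h; rewrite /sgm /pos2 !max_r ?expr0n/=; first by ring.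
all: lra.
Qed.

Lemma dsgm_le0 s : s <= 0 -> dsgm s = 0.
Proof. by move=> h; rewrite /dsgm !max_r; [ring|lra|lra|lra]. Qed.

Lemma sgm_ge1 s : 1 <= s -> sgm s = 1.
Proof. by move=> h; rewrite /sgm /pos2 !max_l; [field|lra|lra|lra]. Qed.

Lemma dsgm_ge1 s : 1 <= s -> dsgm s = 0.
Proof. by move=> h; rewrite /dsgm !max_l; [field|lra|lra|lra]. Qed.

Lemma max0_cont : continuous (fun s : R => Num.max s 0).
Proof.
move=> s; apply: (@continuous_max _ _ (fun s : R => s) (cst 0)).
  exact: cvg_id.
exact: cvg_cst.
Qed.

Lemma sgm_cont : continuous sgm.
Proof.
move=> s; apply: differentiable_continuous; apply/derivable1_diffP.
by case: (is_derive_sgm s).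
Qed.

Lemma dsgm_cont : continuous dsgm.
Proof.
have h (k c : R) : continuous (fun s : R => k * Num.max (s - c) 0).
  move=> s; apply: cvgM; first exact: cvg_cst.
  apply: (@comp_cont _ _ _ (fun s : R => s - c) _ _ max0_cont) => t.
  by apply: cvgB; [exact: cvg_id|exact: cvg_cst].
rewrite /dsgm => s; apply: cvgD; [apply: cvgB|].
- by apply: cvgM; [exact: cvg_cst|exact: max0_cont].
- exact: h.
- exact: h.
Qed.

End smooth_step.

(** * Entrywise derivatives and continuity of matrix functions *)

Section mx_calculus.
Context {R : realType}.

Lemma is_derive_mx2 (M : R -> 'M[R]_2) (s : R) (dM : 'M[R]_2) :
  (forall i j, is_derive s 1 (fun t => M t i j) (dM i j)) -> is_derive s 1 M dM.
Proof.
move=> h; have dM' : derivable M s 1.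
  by apply/derivable_mxP => i j; case: (h i j).
apply: DeriveDef => //; rewrite derive_mx//.
by apply/matrixP => i j; rewrite mxE; case: (h i j).
Qed.

Lemma is_derive_mulmx2 (M N : R -> 'M[R]_2) (s : R) (dM dN : 'M[R]_2) :
  (forall i j, is_derive s 1 (fun t => M t i j) (dM i j)) ->
  (forall i j, is_derive s 1 (fun t => N t i j) (dN i j)) ->
  forall i j, is_derive s 1 (fun t => (M t *m N t) i j)
    ((dM *m N s + M s *m dN) i j).
Proof.
move=> hM hN i j.
have e : (fun t => (M t *m N t) i j) =
    (fun t => M t i 0) * (fun t => N t 0 j) + (fun t => M t i 1) * (fun t => N t 1 j).
  by apply/funext => t; rewrite mulmx2.
rewrite e; have h1 := hM i 0; have h2 := hM i 1; have h3 := hN 0 j; have h4 := hN 1 j.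
by apply: is_derive_eq; rewrite /GRing.scale /= mxE !mulmx2; ring.
Qed.

Definition mxcont (T : topologicalType) (M : T -> 'M[R]_2) :=
  forall i j, continuous (fun t => M t i j).

Lemma mxcontP (T : topologicalType) (M : T -> 'M[R]_2) : mxcont M -> continuous M.
Proof.
move=> h t A [P PM PA]; rewrite nbhs_filterE /=.
have [h00 h01 h10 h11] : [/\ \forall u \near t, P 0 0 (M u 0 0),
   \forall u \near t, P 0 1 (M u 0 1), \forall u \near t, P 1 0 (M u 1 0) &
   \forall u \near t, P 1 1 (M u 1 1)].
  by split; apply: h; exact: PM.
near=> u; apply: PA => i j.
by case: (ord2P i) => ->; case: (ord2P j) => ->; near: u.
Unshelve. all: by end_near. Qed.

Lemma mxcontM (T : topologicalType) (M N : T -> 'M[R]_2) :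
  mxcont M -> mxcont N -> mxcont (fun t => M t *m N t).
Proof.
move=> hM hN i j; under eq_fun do rewrite mulmx2.
by move=> t; apply: cvgD; apply: cvgM; (exact: hM || exact: hN).
Qed.

Lemma mxcont_mx2 (T : topologicalType) (a b c d : T -> R) :
  continuous a -> continuous b -> continuous c -> continuous d ->
  mxcont (fun t => mx2 (a t) (b t) (c t) (d t)).
Proof.
move=> ca cb cc cd i j.
by case: (ord2P i) => ->; case: (ord2P j) => ->; under eq_fun do rewrite mx2E.
Qed.

Lemma mxcont_adj2 (T : topologicalType) (M : T -> 'M[R]_2) :
  mxcont M -> mxcont (fun t => adj2 (M t)).
Proof.
move=> h; apply: mxcont_mx2; [exact: h| | |exact: h].
  by move=> t; apply: cvgN; exact: h.
by move=> t; apply: cvgN; exact: h.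
Qed.

Lemma mxcont_frob (T : topologicalType) (M : T -> 'M[R]_2) :
  mxcont M -> continuous (fun t => frob (M t)).
Proof.
move=> h t; rewrite /frob /frob2; apply: continuous_comp; last exact: sqrt_continuous.
by do !apply: cvgD; apply: (@cvgM _ _ _ _ (fun t => M t _ _) (fun t => M t _ _)); exact: h.
Qed.

End mx_calculus.

(** * The cocycle, its interpolation and the generator on the suspension *)

Section schrodinger_cocycle.
Context {R : realType} (al E : R).
Implicit Types (x y s t : R) (m n : int).

Definition gen (th : circle R) : 'M[R]_2 := stp (pot E (repr th)).

Lemma gen_cpi x : gen (cpi x) = stp (pot E x).
Proof.
by rewrite /gen (per1_repr (f := fun x => stp (pot E x)))// => z m; rewrite pot_add1.
Qed.

Lemma pot_circle_cont : continuous (fun th : circle R => pot E (repr th)).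
Proof.
apply: per1_continuous; first by move=> z m; rewrite pot_add1.
move=> x; apply: cvgD; first exact: cvg_cst.
by apply: cvgM; [exact: cvg_cst|exact: cos1_cont].
Qed.

Lemma gen_mxcont : mxcont gen.
Proof.
apply: (@mxcont_mx2 _ _ (fun th : circle R => 1 + pot E (repr th))
  (fun th => pot E (repr th)) (fun=> 1) (fun=> 1));
  [|exact: pot_circle_cont|exact: cst_cont|exact: cst_cont].
exact: (contD (@cst_cont _ _ (1 : R)) pot_circle_cont).
Qed.

Lemma gen_SL2 : SL2_generator gen.
Proof. by split; [exact/mxcontP/gen_mxcont|move=> th; exact: det_stp]. Qed.

Local Notation dc := (discrete_cocycle al gen).

Definition zc n x : 'M[R]_2 := dc n (cpi x).

Lemma det_zc n x : \det (zc n x) = 1.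
Proof.
rewrite /zc; case: n => n.
  by elim: n => [|n IH] /=; rewrite ?det1// det_mul1// det_stp.
rewrite /discrete_cocycle; elim: n.+1 => [|k IH] /=; first by rewrite det1.
by rewrite det_mul1// det_invmx1// det_stp.
Qed.

Lemma zc0 x : zc 0 x = 1%:M. Proof. by []. Qed.

Lemma zcS n x : zc (n + 1) x = stp (pot E (x + n%:~R * al)) *m zc n x.
Proof.
have u y : stp (pot E y) \in unitmx by rewrite det1_unitmx// det_stp.
case: n => [n|[|n]].
- by rewrite /zc -[Posz n + 1]/(Posz (n + 1)%N) addn1 /= rotation_cpi gen_cpi.
- have -> : (Negz 0)%:~R = (- (1%:Z))%:~R :> R by [].
  by rewrite /zc /= rotation_cpi gen_cpi mulmx1 mulmxV.
have -> : Negz n.+1 + 1 = Negz n by lia.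
have -> : (Negz n.+1)%:~R = (- (n.+2%:Z))%:~R :> R by [].
by rewrite /zc [in RHS]/= rotation_cpi gen_cpi [RHS]mulmxA mulmxV// mul1mx.
Qed.

Lemma zc_gmx (n : nat) x : zc n x = gmx al E x n.
Proof.
elim: n => [//|n IH]; have -> : Posz n.+1 = Posz n + 1 by lia.
by rewrite zcS IH.
Qed.

Lemma zcD m n x : zc (m + n) x = zc m (x + n%:~R * al) *m zc n x.
Proof.
have u y : stp (pot E y) \in unitmx by rewrite det1_unitmx// det_stp.
have e (k : int) : x + (k + n)%:~R * al = x + n%:~R * al + k%:~R * al.
  by rewrite intrD mulrDl addrA addrAC.
elim/int_rect: m => [|k IH|k IH].
- by rewrite add0r zc0 mul1mx.
- have -> : Posz k.+1 + n = (Posz k + n) + 1 by lia.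
  have -> : Posz k.+1 = Posz k + 1 by lia.
  by rewrite !zcS IH e mulmxA.
- move: IH; have -> : - Posz k + n = (- Posz k.+1 + n) + 1 by lia.
  have -> : - Posz k = - Posz k.+1 + 1 by lia.
  rewrite !zcS e -mulmxA => /(congr1 (mulmx (invmx (stp (pot E
    (x + n%:~R * al + (- Posz k.+1)%:~R * al)))))).
  by rewrite !mulKmx.
Qed.

Lemma zc_per n : per1 (zc n).
Proof. by move=> x m; rewrite /zc cpiDint. Qed.

Lemma mx2_0 : mx2 0 0 0 0 = 0 :> 'M[R]_2.
Proof. by apply: mx2P; rewrite !mx2E mxE. Qed.

(* The factors of [stp a] are switched on by [sgm], which is constant outside [0, 1]. *)
Definition path_mx a s : 'M[R]_2 :=
  mx2 (1 + a * sgm s ^+ 2) (a * sgm s) (sgm s) 1.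

Definition dpath_mx a s : 'M[R]_2 :=
  mx2 (dsgm s * (2 * a * sgm s)) (dsgm s * a) (dsgm s) 0.

(** The logarithmic derivative [dpath_mx a s *m invmx (path_mx a s)], written out; it is traceless
    because the path stays in SL_2. *)
Definition gpath_mx a s : 'M[R]_2 :=
  mx2 (dsgm s * (a * sgm s)) (dsgm s * (a - a ^+ 2 * sgm s ^+ 2)) (dsgm s)
    (- (dsgm s * (a * sgm s))).

Lemma det_path a s : \det (path_mx a s) = 1.
Proof. by rewrite det2 !mx2E; ring. Qed.

Lemma path_le0 a s : s <= 0 -> path_mx a s = 1%:M.
Proof.
move=> /sgm_le0 h; rewrite /path_mx h; apply: mx2P;
  by rewrite !mx2E id2/= ?mulr1n ?mulr0n; ring.
Qed.

Lemma path_ge1 a s : 1 <= s -> path_mx a s = stp a.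
Proof. by move=> /sgm_ge1 h; rewrite /path_mx h /stp expr1n !mulr1. Qed.

Lemma gpath_path a s : gpath_mx a s *m path_mx a s = dpath_mx a s.
Proof.
by rewrite /gpath_mx /dpath_mx /path_mx; apply: mx2P;
  rewrite !mulmx2 !mx2E; ring.
Qed.

Lemma is_derive_path a s c i j :
  is_derive s 1 (fun t => path_mx a (t + c) i j) (dpath_mx a (s + c) i j).
Proof.
have h := is_derive_translate (is_derive_sgm (s + c)).
have h2 : is_derive s 1 (fun t => a * sgm (t + c)) (a * dsgm (s + c)).
  by have := is_deriveZ a h.
rewrite /path_mx /dpath_mx.
case: (ord2P i) => ->; case: (ord2P j) => ->; rewrite !mx2E;
  under [X in is_derive _ _ X _]funext => t do rewrite mx2E.
- have h3 := is_deriveD (is_derive_cst (1 : R) s 1) (is_deriveM h2 h).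
  under [X in is_derive _ _ X _]funext => t do rewrite expr2 mulrA.
  by apply: is_derive_eq h3 _; rewrite /GRing.scale/=; ring.
- by rewrite mulrC.
- by [].
- exact: is_derive_cst.
Qed.

(** The solution over the point x at height 0: all complete steps up to the floor of s, then the
    current step partly switched on. *)
Definition fsol x s : 'M[R]_2 :=
  path_mx (pot E (x + (Num.floor s)%:~R * al)) (fpart s) *m zc (Num.floor s) x.

Lemma det_fsol x s : \det (fsol x s) = 1.
Proof. by rewrite det_mul1// ?det_path ?det_zc. Qed.

Lemma fsol_per s : per1 (fsol^~ s).
Proof. by move=> x m; rewrite /fsol zc_per addrAC pot_add1. Qed.

Lemma fsol_int x n : fsol x n%:~R = zc n x.
Proof. by rewrite /fsol /fpart intrKfloor subrr path_le0// mul1mx. Qed.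

Lemma fsolD x s n : fsol x (s + n%:~R) = fsol (x + n%:~R * al) s *m zc n x.
Proof.
rewrite /fsol fpartDint floorDrz ?intr_int// intrKfloor zcD mulmxA.
by congr (path_mx (pot E _) _ *m _ *m _); rewrite intrD mulrDl addrA addrAC.
Qed.

(** One formula on both sides of the integer n, since the path of step n is still the identity
    before n and that of step n - 1 is complete after n. It makes [fsol] differentiable at integers
    too. *)
Lemma fsol_local x n s : n%:~R - 1 < s < n%:~R + 1 ->
  fsol x s = path_mx (pot E (x + n%:~R * al)) (s - n%:~R) *m
    (path_mx (pot E (x + (n - 1)%:~R * al)) (s - n%:~R + 1) *m zc (n - 1) x).
Proof.
move=> /andP[h1 h2]; rewrite /fsol /fpart; have [sn|ns] := ltP s n%:~R.
  have -> : Num.floor s = n - 1.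
    by apply: floor_def; rewrite subrK intrB sn andbT ltW.
  rewrite [path_mx _ (s - n%:~R)]path_le0 ?mul1mx; last by lra.
  by rewrite intrB opprB addrA addrAC.
have -> : Num.floor s = n.
  by apply: floor_def; rewrite ns intrD.
rewrite [path_mx _ (_ + 1)]path_ge1; last by lra.
by rewrite -zcS subrK.
Qed.

Lemma is_derive_fsol x s i j : is_derive s 1 (fun t => fsol x t i j)
  ((gpath_mx (pot E (x + (Num.floor s)%:~R * al)) (fpart s) *m fsol x s) i j).
Proof.
set n := Num.floor s.
pose W t := path_mx (pot E (x + n%:~R * al)) (t - n%:~R) *m
    (path_mx (pot E (x + (n - 1)%:~R * al)) (t - n%:~R + 1) *m zc (n - 1) x).
have /andP[f0 f1] := fpart_itv s.
have ns : n%:~R - 1 < s < n%:~R + 1 by move: f0 f1; rewrite /fpart -/n; lra.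
have dW : is_derive s 1 (fun t => W t i j)
    ((gpath_mx (pot E (x + n%:~R * al)) (fpart s) *m fsol x s) i j).
  pose C := fun _ : R => zc (n - 1) x.
  have dC k l : is_derive s 1 (fun t => C t k l) ((0 : 'M[R]_2) k l).
    by rewrite mxE; exact: is_derive_cst.
  have dP2 k l : is_derive s 1
     (fun t => path_mx (pot E (x + (n - 1)%:~R * al)) (t - n%:~R + 1) k l)
     (dpath_mx (pot E (x + (n - 1)%:~R * al)) (s - n%:~R + 1) k l).
    rewrite -addrA.
    by under [X in is_derive _ _ X _]funext => t do rewrite -addrA; exact: is_derive_path.
  have dP1 k l : is_derive s 1
     (fun t => path_mx (pot E (x + n%:~R * al)) (t - n%:~R) k l)
     (dpath_mx (pot E (x + n%:~R * al)) (s - n%:~R) k l).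
    exact: is_derive_path.
  have := is_derive_mulmx2 dP1 (is_derive_mulmx2 dP2 dC) i j.
  (* Step n - 1 is complete at s, where [dsgm] vanishes, so only the current factor is
     differentiated. *)
  have -> : dpath_mx (pot E (x + (n - 1)%:~R * al)) (s - n%:~R + 1) = 0.
    rewrite /dpath_mx dsgm_ge1 ?mul0r ?mx2_0//; move: f0; rewrite /fpart -/n; lra.
  rewrite mul0mx mulmx0 addr0 mulmx0 addr0.
  rewrite /C path_ge1; last by move: f0; rewrite /fpart -/n; lra.
  by rewrite -zcS subrK -gpath_path -mulmxA.
apply: (@near_eq_is_derive _ _ _ (fun t => W t i j)) => //.
near=> t; rewrite /W -fsol_local//.
by apply/andP; split; near: t; [apply: lt_nbhsr|apply: lt_nbhsl]; case/andP: ns.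
Unshelve. all: by end_near. Qed.

Definition flift t x y : 'M[R]_2 := fsol x (y + t) *m invmx (fsol x y).

Lemma flift_per t y : per1 (flift t ^~ y).
Proof. by move=> x m; rewrite /flift !fsol_per. Qed.

Lemma fliftD t x y n : flift t x (y + n%:~R) = flift t (x + n%:~R * al) y.
Proof.
rewrite /flift addrAC !fsolD invmx_mul1 ?det_fsol ?det_zc// !mulmxA.
by rewrite -[_ *m zc n x *m _]mulmxA mulmxV ?mulmx1// det1_unitmx// det_zc.
Qed.

Definition Phi t (w : torus al) : 'M[R]_2 :=
  let: (th, r) := repr w in flift t (repr th) (\val r).

Lemma Phi_tp t x y : Phi t (tp al x y) = flift t x y.
Proof.
have -> : tp al x y = tp al (x + (Num.floor y)%:~R * al) (fpart y).
  by rewrite -tpDy subrK.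
have -> : flift t x y = flift t (x + (Num.floor y)%:~R * al) (fpart y).
  by rewrite -fliftD subrK.
set z := x + _; set r := fpart y.
have r01 : 0 <= r <= 1 by have /andP[-> /ltW ->] := fpart_itv y.
have glue u : flift t u 1 = flift t (u + al) 0.
  by rewrite -[1]add0r -[1]/(1%:~R) fliftD mul1r.
have := @repr_lift _ al _ (flift t) z r (flift_per t) glue r01.
by rewrite /Phi; case: (repr (tp al z r)).
Qed.

(** Since [dsgm] vanishes at 0 and at 1, the generator is 0 on the glued fibre, so it is continuous
    across the gluing. *)
Definition Gen (w : torus al) : 'M[R]_2 :=
  let: (th, r) := repr w in gpath_mx (pot E (repr th)) (\val r).

Lemma gpath_le0 a s : s <= 0 -> gpath_mx a s = 0.
Proof. by move=> /dsgm_le0 h; rewrite /gpath_mx h !mul0r oppr0 mx2_0. Qed.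

Lemma gpath_ge1 a s : 1 <= s -> gpath_mx a s = 0.
Proof. by move=> /dsgm_ge1 h; rewrite /gpath_mx h !mul0r oppr0 mx2_0. Qed.

Lemma Gen_tp01 x y : 0 <= y <= 1 -> Gen (tp al x y) = gpath_mx (pot E x) y.
Proof.
move=> y01.
have per u : per1 (fun z => gpath_mx (pot E z) u) by move=> z m; rewrite pot_add1.
have glue u : gpath_mx (pot E u) 1 = gpath_mx (pot E (u + al)) 0.
  by rewrite gpath_ge1// gpath_le0.
have := @repr_lift _ al _ (fun x y => gpath_mx (pot E x) y) x y per glue y01.
by rewrite /Gen; case: (repr (tp al x y)).
Qed.

Lemma Gen_tp x y :
  Gen (tp al x y) = gpath_mx (pot E (x + (Num.floor y)%:~R * al)) (fpart y).
Proof.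
have -> : tp al x y = tp al (x + (Num.floor y)%:~R * al) (fpart y).
  by rewrite -tpDy subrK.
by rewrite Gen_tp01//; have /andP[-> /ltW ->] := fpart_itv y.
Qed.

Let potv_cont : continuous (fun p : circle R * unit_itv R => pot E (repr p.1)).
Proof. exact: (comp_cont (@fst_cont _ _) pot_circle_cont). Qed.

Let val2_cont : continuous (fun p : circle R * unit_itv R => \val p.2).
Proof. exact: (comp_cont (@snd_cont _ _) (@val_unit_continuous R)). Qed.

Lemma Gen_cont : continuous Gen.
Proof.
apply: torus_continuous.
pose s (p : circle R * unit_itv R) : R := sgm (\val p.2).
pose ds (p : circle R * unit_itv R) : R := dsgm (\val p.2).
pose a (p : circle R * unit_itv R) : R := pot E (repr p.1).
rewrite (_ : (fun _ => _) = fun p => mx2 (ds p * (a p * s p))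
   (ds p * (a p - (a p * a p) * (s p * s p))) (ds p) (- (ds p * (a p * s p)))); last first.
  apply/funext => -[th r] /=; have [x _ ->] := cpiP th.
  have -> : tpi al (cpi x) r = tp al x (\val r) by rewrite tp_tpi ?unit_itvP// val_clamp.
  rewrite Gen_tp01 ?unit_itvP// /a /=.
  rewrite (per1_repr (f := pot E)); last by move=> z m; rewrite pot_add1.
  by rewrite /gpath_mx !expr2.
have cs : continuous s := comp_cont val2_cont (@sgm_cont R).
have cds : continuous ds := comp_cont val2_cont (@dsgm_cont R).
have ca : continuous a := potv_cont.
have cas := contM ca cs.
apply/mxcontP/mxcont_mx2; [exact: contM| |exact: cds|exact: (contN (contM cds cas))].
exact: (contM cds (contD ca (contN (contM (contM ca ca) (contM cs cs))))).
Qed.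

Lemma Phi_continuous_cocycle : continuous_cocycle (@suspension_flow R al) Phi.
Proof.
split.
  move=> t w; have [x [y [_ _ ->]]] := tpP w.
  by rewrite Phi_tp det_mul1 ?det_fsol// det_invmx1// det_fsol.
exists Gen; split; first exact: Gen_cont.
  move=> w; have [x [y [_ _ ->]]] := tpP w; rewrite Gen_tp tr2 /gpath_mx.
  by rewrite !mx2E; ring.
move=> w; have [x [y [_ _ ->]]] := tpP w; split.
  by rewrite Phi_tp /flift addr0 mulmxV// det1_unitmx// det_fsol.
move=> t; apply: is_derive_mx2 => i j.
rewrite (_ : (fun u => _) = (fun u => (fsol x (u + y) *m invmx (fsol x y)) i j)); last first.
  by apply/funext => u; rewrite Phi_tp /flift addrC.
have d1 k l : is_derive t 1 (fun u => fsol x (u + y) k l)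
  ((Gen (suspension_flow t (tp al x y)) *m fsol x (y + t)) k l).
  rewrite flow_tp Gen_tp [y + t]addrC; apply: (@is_derive_translate _ (fun u => fsol x u k l)).
  exact: is_derive_fsol.
have d2 k l : is_derive t 1 (fun u : R => (invmx (fsol x y)) k l) ((0 : 'M[R]_2) k l).
  by rewrite mxE; exact: is_derive_cst.
have := is_derive_mulmx2 d1 d2 i j.
by rewrite mulmx0 addr0 Phi_tp /flift mulmxA.
Qed.

Lemma Phi_canonical : canonical_extension gen Phi.
Proof.
move=> n th; have [x _ ->] := cpiP th.
rewrite -/(tpi al (cpi x) (clamp 0)) -tp_tpi ?lexx ?ler01//.
by rewrite Phi_tp /flift add0r fsol_int -[0]/(0%:~R) fsol_int zc0 invmx1 mulmx1.
Qed.

Lemma zc_mxcont n : mxcont (fun th : circle R => dc n th).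
Proof.
have rc (k : int) : mxcont (fun th => gen (rotation al k th)).
  move=> i j; exact: (@comp_cont _ _ _ (rotation al k) (fun th => gen th i j)
    (@rotate_continuous _ _) (@gen_mxcont i j)).
case: n => n.
  elim: n => [|n IH]; first by move=> i j; exact: cst_cont.
  exact: mxcontM (rc n) IH.
rewrite /discrete_cocycle; elim: n.+1 => [|k IH]; first by move=> i j; exact: cst_cont.
rewrite /=; apply: mxcontM IH.
under [X in mxcont X]eq_fun do rewrite invmx2 ?det_stp//.
exact/mxcont_adj2/rc.
Qed.

(** From height r in [0, 1], n units of time undo the partial step at the start, make n full steps
    and redo the partial step at the end. Integer times are what [torus_growth] samples. *)
Lemma Phi_mxcont n : mxcont (fun w => Phi n%:~R w).
Proof.
have pc (k : int) : mxcont (fun p : circle R * unit_itv R =>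
    path_mx (pot E (repr (rotation al k p.1))) (\val p.2)).
  have ca : continuous (fun p : circle R * unit_itv R => pot E (repr (rotation al k p.1))).
    apply: (@comp_cont _ _ _ fst (fun th => pot E (repr (rotation al k th)))).
      exact: fst_cont.
    exact: (@comp_cont _ _ _ (rotation al k) (fun th => pot E (repr th))
      (@rotate_continuous _ _) pot_circle_cont).
  have cs := comp_cont val2_cont (@sgm_cont R).
  apply: mxcont_mx2; [|exact: contM|exact: cs|exact: cst_cont].
  exact: (contD (@cst_cont _ _ (1 : R)) (contM ca (contM cs cs))).
have fs (x r : R) : 0 <= r <= 1 -> fsol x r = path_mx (pot E x) r.
  move=> /andP[r0 r1]; have [->|rn] := eqVneq r 1.
    rewrite path_ge1// -[1]/(1%:~R) fsol_int -[1]add0r zcS zc0 mulmx1.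
    by rewrite mul0r addr0.
  have fr : Num.floor r = 0 by apply: floor_def; rewrite r0 lt_neqAle rn.
  by rewrite /fsol /fpart fr mul0r addr0 subr0 zc0 mulmx1.
move=> i j; apply: torus_continuous.
rewrite (_ : (fun _ => _) = fun p : circle R * unit_itv R =>
  (path_mx (pot E (repr (rotation al n p.1))) (\val p.2) *m dc n p.1 *m
   adj2 (path_mx (pot E (repr (rotation al 0 p.1))) (\val p.2))) i j); last first.
  apply/funext => -[th r] /=; have [x _ ->] := cpiP th.
  have -> : tpi al (cpi x) r = tp al x (\val r) by rewrite tp_tpi ?unit_itvP// val_clamp.
  have pr := per1_repr (f := pot E) _ (fun z m => pot_add1 E z m).
  rewrite Phi_tp /flift fsolD !fs ?unit_itvP// !rotation_cpi !pr mul0r addr0.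
  by rewrite invmx2 ?det_path.
apply: mxcontM; last exact/mxcont_adj2/pc.
apply: mxcontM; first exact: pc.
by move=> k l; exact: (comp_cont (@fst_cont _ _) (@zc_mxcont n k l)).
Qed.

End schrodinger_cocycle.

(** * The Lyapunov exponent *)

Section growth.
Context {R : realType} (al E : R).
Implicit Types (x : R) (n : nat).

Definition lgr n x : R := ln (frob (gmx al E x n)).

Lemma ln_frobM (M N : 'M[R]_2) : \det M = 1 -> \det N = 1 ->
  ln (frob (M *m N)) <= ln (frob M) + ln (frob N).
Proof.
move=> hM hN; rewrite -lnM ?posrE ?frob_gt0// ler_ln ?posrE ?mulr_gt0 ?frob_gt0//.
  exact: frobM.
exact: det_mul1.
Qed.

Lemma gmxD m n x :
  gmx al E x (m + n) = gmx al E (x + n%:R * al) m *m gmx al E x n.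
Proof. by rewrite -!zc_gmx PoszD zcD. Qed.

Lemma lgrD m n x : lgr (m + n) x <= lgr m (x + n%:R * al) + lgr n x.
Proof. by rewrite /lgr gmxD; apply: ln_frobM; rewrite det_gmx. Qed.

Lemma lgr_per n : per1 (lgr n).
Proof. by move=> x m; rewrite /lgr -!zc_gmx zc_per. Qed.

Lemma frob_entries (M : 'M[R]_2) (B : R) : (forall i j, `|M i j| <= B) ->
  frob M <= 2 * B.
Proof.
move=> h; have B0 : 0 <= B by apply: le_trans (h 0 0).
have sq i j : M i j ^+ 2 <= B ^+ 2.
  by rewrite -(real_normK (num_real (M i j))) ler_sqr ?nnegrE.
rewrite le_frob ?mulr_ge0// /frob2 exprMn.
by have := sq 0 0; have := sq 0 1; have := sq 1 0; have := sq 1 1; lra.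
Qed.

Lemma pot_bound x : `|pot E x| <= `|E| + 4.
Proof.
rewrite /pot (le_trans (ler_normD _ _))// lerD2l normrM ger0_norm//.
rewrite -[leRHS]mulr1 ler_wpM2l// ler_norml cos1_ge cos1_le//.
Qed.

Lemma sgm_bound s : `|sgm s| <= 8 :> R.
Proof.
have [h|h] := leP s 0; first by rewrite sgm_le0// normr0; lra.
have [h1|h1] := leP 1 s; first by rewrite sgm_ge1// normr1; lra.
have b (u : R) : u <= 1 -> 0 <= pos2 u <= 1.
  move=> hu; rewrite /pos2 sqr_ge0/= expr_le1//; last by rewrite le_max lexx orbT.
  by rewrite ge_max hu ler01.
rewrite /sgm; have := b s; have := b (s - 1 / 2); have := b (s - 1).
move=> /(_ _)/andP; rewrite ler_norml.
move: (pos2 s) (pos2 (s - 1 / 2)) (pos2 (s - 1)) => p1 p2 p3.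
have e1 : s - 1 <= 1 by lra.
have e2 : s - 1 / 2 <= 1 by lra.
move=> /(_ e1)[q1 q2] /(_ e2)/andP[q3 q4] /(_ (ltW h1))/andP[q5 q6].
by apply/andP; split; lra.
Qed.

Lemma path_bound : exists2 C : R, 1 <= C &
  forall x s, frob (path_mx (pot E x) s) <= C.
Proof.
pose A := `|E| + 4.
have A0 : 0 <= A by rewrite addr_ge0.
(* With |sgm| at most 8 = 2 + 4 + 2 the entries are bounded by 1 + 64 A, 8 A, 8 and 1; the factor 2
   is that of [frob_entries]. *)
exists (2 * (1 + 64 * A + 8 * A + 8)); first by lra.
move=> x s; apply: frob_entries => i j.
have hp := pot_bound x; have hs := sgm_bound s.
have h1 : `|pot E x * sgm s| <= 8 * A.
  by rewrite normrM mulrC; apply: ler_pM.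
have h2 : `|pot E x * sgm s ^+ 2| <= 64 * A.
  rewrite normrM normrX mulrC; apply: ler_pM => //.
  have -> : (64 : R) = 8 ^+ 2 by rewrite -natrX.
  by rewrite ler_sqr ?nnegrE.
case: (ord2P i) => ->; case: (ord2P j) => ->; rewrite mx2E.
- by apply: le_trans (ler_normD _ _) _; rewrite normr1; lra.
- by lra.
- by lra.
- by rewrite normr1; lra.
Qed.

(** The additive [c] is for n = 0, as the Frobenius norm of the identity is sqrt 2. The bound on the
    path covers both its ends, the identity and a full step. *)
Lemma lgr_bound : exists c : R, [/\ 0 <= c, forall x, lgr 1 x <= c &
  forall n x, lgr n x <= c + n%:R * c].
Proof.
have [C C1 hC] := path_bound.
have C0 : 0 < C by apply: lt_le_trans C1.
have h1 x : lgr 1 x <= ln C.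
  rewrite /lgr /= mulmx1 mul0r addr0.
  rewrite -(@path_ge1 _ _ 1)// ler_ln ?posrE ?frob_gt0 ?det_path//.
exists (ln C); split; [by rewrite ln_ge0|by []|].
elim=> [|n IH] x.
  rewrite mul0r addr0 /lgr /= -(@path_le0 _ (pot E 0) 0)//.
  by rewrite ler_ln ?posrE ?frob_gt0 ?det_path.
rewrite -natr1 mulrDl mul1r -add1n; apply: le_trans (lgrD _ _ _) _.
by rewrite addrC addrA lerD.
Qed.

End growth.

Lemma continuous_ln_frob {R : realType} (T : topologicalType) (M : T -> 'M[R]_2) :
  mxcont M -> (forall t, \det (M t) = 1) -> continuous (fun t => ln (frob (M t))).
Proof.
move=> cM dM t; apply: (@continuous_comp _ _ _ (fun t => frob (M t)) (@ln R)).
  exact: mxcont_frob.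
by apply: continuous_ln; rewrite frob_gt0.
Qed.

(** * The uniform growth rate *)

Section top_growth_rate.
Context {R : realType} (al E : R).
Implicit Types (x r : R) (n : nat).
Local Notation lg := (lgr al E).

Lemma lgr_continuous n : continuous (lg n).
Proof.
rewrite (_ : lg n = (fun th => ln (frob (discrete_cocycle al (gen E) n th))) \o cpi);
  last by apply/funext => x; rewrite /lgr -zc_gmx.
move=> x; apply: continuous_comp; first exact: cpi_continuous.
apply: continuous_ln_frob; first exact: zc_mxcont.
move=> th; have [y _ ->] := cpiP th; exact: (@det_zc R al E n y).
Qed.

(** The growth rates that some iterate respects uniformly in x; their infimum is inf_n sup_x ln
    |A^n_x| / n. *)
Definition rate : set R := [set r | exists2 n, (0 < n)%N & forall x, lg n x <= n%:R * r].

Definition top_rate : R := inf rate.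

Lemma rate_ge r : rate r -> ln 2 <= r.
Proof.
move=> [n n0 hr]; have [x hx] := herman_bound al E n.
rewrite -(@ler_pM2l _ n%:R) ?ltr0n//; apply: le_trans (hr x).
rewrite mulr_natl -lnXn// ler_ln ?posrE ?exprn_gt0// ?frob_gt0 ?det_gmx//.
exact: le_trans hx (entry_le_frob _ _ _).
Qed.

Lemma rate_has_inf : has_inf rate.
Proof.
split; last by exists (ln 2) => r; exact: rate_ge.
by have [c [_ c1 _]] := lgr_bound al E; exists c; exists 1%N => // x; rewrite mul1r.
Qed.

Lemma top_rate_gt0 : 0 < top_rate.
Proof.
apply: (@lt_le_trans _ _ (ln 2)); first by rewrite ln_gt0// ltr1n.
by apply: lb_le_inf; [case: rate_has_inf|move=> r; exact: rate_ge].
Qed.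

Lemma lgr_gt r n : (0 < n)%N -> r < top_rate -> exists x, n%:R * r < lg n x.
Proof.
move=> n0; apply: contraPP => /forallNP h; apply/negP; rewrite -leNgt.
apply: ge_inf; first by case: rate_has_inf.
by exists n => // x; rewrite leNgt; apply/negP/h.
Qed.

Lemma lgr_mul (k n : nat) r : (forall x, lg n x <= r) -> forall s x,
  lg (k * n + s) x <= k%:R * r + lg s x.
Proof.
move=> h; elim: k => [|k IH] s x; first by rewrite mul0r add0r.
rewrite mulSn -addnA; apply: le_trans (lgrD _ _ _ _ _) _.
by rewrite -natr1 mulrDl mul1r addrAC addrC lerD.
Qed.

(** Fekete's argument, uniformly in x: cut m steps into blocks of a length n that realizes a rate r'
    < r; the remainder is shorter than n and costs a constant. *)
Lemma lgr_upper r : top_rate < r ->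
  exists N0, forall n, (N0 <= n)%N -> forall x, lg n x <= n%:R * r.
Proof.
move=> Lr; have [r' [n n0 hr'] r'r] := inf_lt rate_has_inf.1 Lr.
have [c [c0 _ hc]] := lgr_bound al E.
have n0R : 0 < n%:R :> R by rewrite ltr0n.
have r'0 : 0 <= r'.
  have rr : rate r' by exists n.
  by apply: le_trans (rate_ge rr); rewrite ln_ge0// ler1n.
pose K := c + n%:R * c.
exists (Num.truncn (K / (r - r'))).+1 => m hm x.
have hK : K <= m%:R * (r - r').
  rewrite -ler_pdivrMr ?subr_gt0//; apply: (le_trans (ltW (truncnS_gt _))).
  by rewrite ler_nat.
rewrite {1}(divn_eq m n); apply: le_trans (lgr_mul _ hr' _ _) _.
have h1 : lg (m %% n) x <= K.
  apply: le_trans (hc _ _) _; rewrite lerD2l ler_wpM2r// ler_nat.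
  by rewrite ltnW// ltn_mod.
have h2 : (m %/ n)%:R * n%:R <= m%:R :> R by rewrite -natrM ler_nat leq_trunc_div.
have := ler_wpM2r r'0 h2; lra.
Qed.

End top_growth_rate.

(** * Cutting orbits into slowly growing blocks *)

Section stopping.
Context {R : realType} (al E : R).
Implicit Types (x r : R) (n : nat).
Local Notation lg := (lgr al E).

Definition early r N : set R := [set x | exists n, (0 < n <= N)%N /\ lg n x < n%:R * r].

Definition late_visits (V : set R) n x : nat := (\sum_(k < n) ~~ `[< V (x + k%:R * al)%R >])%N.

Lemma late_visitsD V m n x :
  late_visits V (n + m) x = (late_visits V n x + late_visits V m (x + n%:R * al))%N.
Proof.
rewrite /late_visits big_split_ord/=; congr (_ + _)%N.
by apply: eq_bigr => k _; rewrite natrD mulrDl addrA.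
Qed.

(* Cut the orbit greedily: at a point of [early r N] jump over a block that grows
   at a rate below [r], elsewhere advance by one step. *)
Lemma lgr_stopping r N c : 0 <= r -> 0 <= c -> (forall x, lg 1 x <= c) ->
  (forall n x, lg n x <= c + n%:R * c) -> forall K x,
  lg K x <= r * K%:R + c * (late_visits (early r N) K x)%:R + (c + N%:R * c).
Proof.
move=> r0 c0 h1 hc; elim/ltn_ind => K IH x.
have [KN|NK] := leqP K N.
  apply: le_trans (hc _ _) _; rewrite -[leLHS]add0r lerD//.
    by rewrite addr_ge0// mulr_ge0.
  by rewrite lerD2l ler_wpM2r// ler_nat.
have K0 : (0 < K)%N by apply: leq_ltn_trans NK.
(* A first block of length n may exceed the rate r by an amount a that its own late visits pay for;
   induction covers the other K - n steps. *)
have step n a : (0 < n <= K)%N -> lg n x <= r * n%:R + a ->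
    a <= c * (late_visits (early r N) n x)%:R ->
    lg K x <= r * K%:R + c * (late_visits (early r N) K x)%:R + (c + N%:R * c).
  move=> /andP[n0 nK] h1n h2n.
  have lt : (K - n < K)%N by rewrite ltn_subrL n0 K0.
  have := IH _ lt (x + n%:R * al); rewrite -[in K%:R](subnKC nK).
  rewrite -[in late_visits _ K](subnKC nK) late_visitsD.
  have := lgrD al E (K - n) n x; rewrite subnK// !natrD => e1 e2.
  by rewrite !mulrDr; lra.
have [V|nV] := pselect (early r N x).
  have [n [/andP[n0 nN] hn]] := V.
  apply: (step n 0); rewrite ?n0 ?(leq_trans nN (ltnW NK))//.
    by rewrite addr0 mulrC ltW.
  by rewrite mulr_ge0.
apply: (step 1%N c); rewrite ?K0//.
  by apply: le_trans (h1 x) _; rewrite lerDr mulr_ge0.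
by rewrite /late_visits big_ord1 mul0r addr0 asboolF// mulr1.
Qed.

End stopping.

(** * Counting visits of grid-like orbits *)

Section occupation.
Context {R : realType}.
Local Notation lu := (@lebesgue_unit R).
Local Notation leb := (@lebesgue_measure R).

(** The points whose eta-neighbourhood lies in [V]. The set is closed for arbitrary [V], hence
    measurable, and leaves room for the error of a grid. *)
Definition deep (V : set R) (eta : R) : set (measurableTypeR R) :=
  [set x | forall y, `|y - x| < eta -> V y].

Lemma measurable_deep V eta : measurable (deep V eta).
Proof.
rewrite -[deep V eta]setCK; apply: measurableC; apply: open_measurable.
rewrite openE => x nd.
have /existsNP[y /not_implyP[yx nV]] : ~ forall y, `|y - x| < eta -> V y by exact: nd.
rewrite /interior; apply/nbhs_ballP; exists (eta - `|y - x|) => /=; first by rewrite subr_gt0.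
move=> u /=; rewrite /ball /= => xu h; apply: nV; apply: h.
have := ler_normD (y - x) (x - u); rewrite addrA subrK; move: xu.
by move: `|x - u| `|y - x| `|y - u| => a b c; lra.
Qed.

Lemma lebesgue_cover q (B : {set 'I_q}) (J : 'I_q -> set (measurableTypeR R)) (l : R) :
  (forall j, measurable (J j)) -> (forall j, leb (J j) <= l%:E)%E ->
  measurable (\big[setU/set0]_(j in B) J j) /\
  (leb (\big[setU/set0]_(j in B) J j) <= (#|B|%:R * l)%:E)%E.
Proof.
move=> mJ lJ.
have -> : #|B|%:R * l = \sum_(j in B) l by rewrite sumr_const mulr_natl.
apply: (big_ind2 (fun (X : set (measurableTypeR R)) (s : R) =>
    measurable X /\ (leb X <= s%:E)%E)) => //.
  by rewrite measure0.
move=> X s Y t [mX hX] [mY hY]; split; first exact: measurableU.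
by apply: le_trans (measureU2 _ mX mY) _; rewrite EFinD leeD.
Qed.

(** Cut [z, z + 1] into q cells of length 1/q. If a cell meets [deep V eta], the orbit point
    attached to its left end is within 2/q of that deep point modulo 1 and so lies in [V]. The
    additional 1 pays for [0, z]. *)
Lemma grid_occupation q (P : 'I_q -> R) (V : set R) eta : is_grid P ->
  (forall x (m : int), V (x + m%:~R) -> V x) -> 2 / q%:R < eta ->
  (lu (deep V eta) <= ((1 + #|[set k | `[< V (P k) >]]%SET|%:R) / q%:R)%:E)%E.
Proof.
move=> [z [/andP[z0 zq] [tau [ti tP]]]] Vper qeta.
have q0 : 0 < q%:R :> R by rewrite -invr_gt0; apply: le_lt_trans zq.
have q0n : (0 < q)%N by rewrite -(@ltr0n R).
pose J (j : 'I_q) : set (measurableTypeR R) := `[z + j%:R / q%:R, z + j.+1%:R / q%:R]%classic.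
pose B : {set 'I_q} := [set j | `[< exists2 x, deep V eta x & J j x >]]%SET.
have BD k : tau k \in B -> k \in [set k | `[< V (P k) >]]%SET.
  rewrite inE => /asboolP[x dx Jx].
  have /andP[x1 x2] : z + (tau k)%:R / q%:R <= x <= z + (tau k).+1%:R / q%:R.
    by move: Jx; rewrite /J /= in_itv.
  rewrite inE.
  have [m hm] := tP k; apply/asboolP; apply: (Vper _ (- m)).
  suff /dx : `|P k + (- m)%:~R - x| < eta by exact.
  apply: le_lt_trans qeta; move: hm x1 x2; rewrite mulrNz.
  rewrite -(natr1 (tau k)) mulrDl mul1r !ler_norml.
  rewrite (_ : 2 / q%:R = q%:R^-1 + q%:R^-1 :> R); last by rewrite mulrDl mul1r.
  move: (tau k)%:R (q%:R^-1) => a b /andP[h1 h2] h3 h4; apply/andP; split; lra.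
have mJ j : measurable (J j) by exact: measurable_itv.
have litv (a b : R) : a <= b -> (leb `[a, b]%classic <= (b - a)%:E)%E.
  move=> ab; rewrite lebesgue_measure_itv/=; case: ifP => _; first by rewrite EFinB.
  by rewrite lee_fin subr_ge0.
have lJ j : (leb (J j) <= (q%:R^-1)%:E)%E.
  have h : j.+1%:R / q%:R = j%:R / q%:R + q%:R^-1 :> R by rewrite -natr1 mulrDl mul1r.
  rewrite (_ : q%:R^-1 = z + j.+1%:R / q%:R - (z + j%:R / q%:R)); last by rewrite h; ring.
  by apply: litv; rewrite h addrA lerDl invr_ge0 ltW.
have [mU hU] := lebesgue_cover B mJ lJ.
have mI : measurable (`[0, z]%classic : set (measurableTypeR R)) by exact: measurable_itv.
rewrite /lebesgue_unit /mrestr.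
apply: (@le_trans _ _ (leb (`[0, z]%classic `|` \big[setU/set0]_(j in B) J j))).
  apply: le_measure; rewrite ?inE.
  - by apply: measurableI; [exact: measurable_deep|exact: measurable_itv].
  - exact: measurableU.
  move=> x [dx]; rewrite /= in_itv/= => /andP[x0 x1].
  have [xz|zx] := leP x z; [left|right]; first by rewrite /= in_itv/= x0.
  suff [j /andP[j1 j2]] : exists j : 'I_q, z + j%:R / q%:R <= x <= z + j.+1%:R / q%:R.
    rewrite -bigcup_pred; exists j; last by rewrite /J /= in_itv/= j1.
    by rewrite /= inE; apply/asboolP; exists x => //; rewrite /J /= in_itv/= j1.
  pose t := (x - z) * q%:R.
  have t0 : 0 <= t by rewrite mulr_ge0 ?subr_ge0 ?ltW.
  have aux k : (z + k%:R / q%:R <= x) = (k%:R <= t).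
    by rewrite addrC -lerBrDr ler_pdivrMr.
  have aux' k : (x <= z + k%:R / q%:R) = (t <= k%:R).
    by rewrite addrC -lerBlDr ler_pdivlMr.
  have [tq|qt] := ltP t q%:R.
    have /andP[k1 k2] := truncn_itv t0.
    have kq : (Num.truncn t < q)%N by rewrite -(@ltr_nat R); apply: le_lt_trans tq.
    by exists (Ordinal kq); rewrite aux aux' k1 ltW.
  have kq : (q.-1 < q)%N by rewrite prednK.
  exists (Ordinal kq); rewrite aux aux' /= prednK// (le_trans _ qt) ?ler_nat ?leq_pred//=.
  by rewrite /t ler_piMl ?(ltW q0)//; lra.
apply: le_trans (measureU2 _ mI mU) _.
rewrite mulrDl mul1r EFinD leeD//.
  by apply: le_trans (litv _ _ z0) _; rewrite subr0 lee_fin ltW.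
apply: le_trans hU _; rewrite lee_fin ler_pM2r ?invr_gt0// ler_nat.
exact: (grid_count ti BD).
Qed.

End occupation.

(** * Slow growth cannot occur almost everywhere *)

Section early_visits.
Context {R : realType} (al E : R).
Local Notation lu := (@lebesgue_unit R).
Local Notation lg := (lgr al E).
Local Notation L := (top_rate al E).

Lemma late_visits_card (V : set R) q x :
  (late_visits al V q x + #|[set k : 'I_q | `[< V (x + (k : nat)%:R * al)%R >]]%SET| = q)%N.
Proof.
rewrite -sum1_card /late_visits [X in (_ + X)%N]big_mkcond/= -big_split/=.
rewrite -[RHS]card_ord -sum1_card; apply: eq_bigr => k _.
by rewrite inE; case: `[< _ >].
Qed.

Definition early_all r : set (measurableTypeR R) :=
  [set x | exists2 n, (0 < n)%N & lg n x < n%:R * r].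

Let core r N := deep (early al E r N) N.+1%:R^-1.

Lemma early_per r N x (m : int) : early al E r N (x + m%:~R) -> early al E r N x.
Proof. by move=> [n [hn h]]; exists n; split => //; rewrite -(lgr_per al E n x m). Qed.

(** A strict inequality for the continuous function [lgr al E n] persists on a neighbourhood, so
    every early point is deep for N large. *)
Lemma bigcup_core r : \bigcup_N core r N = early_all r.
Proof.
apply/seteqP; split => [x [N _ /(_ x)]|x [n n0 hn]].
  rewrite subrr normr0 invr_gt0 ltr0n => /(_ isT)[n [/andP[n0 _] hn]].
  by exists n.
have : \forall y \near x, lg n y < n%:R * r.
  have cl : lg n @ x --> lg n x by exact: (@lgr_continuous R al E n x).
  exact: (cvgr_lt _ cl).
move=> /nbhs_ballP[e /= e0 he].
pose N := maxn n (Num.truncn e^-1).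
exists N => // y hy; exists n; split; first by rewrite n0 leq_maxl.
apply: he; rewrite /ball/= distrC; apply: lt_trans hy _.
rewrite invf_plt ?posrE ?ltr0n//; apply: lt_le_trans (truncnS_gt _) _.
by rewrite ler_nat ltnS leq_maxr.
Qed.

Lemma nondecreasing_core r : nondecreasing_seq (core r).
Proof.
move=> m n mn; apply/subsetPset => x hx y hy.
have [|k [/andP[k0 km] hk]] := hx y.
  by apply: lt_le_trans hy _; rewrite lef_pV2 ?posrE ?ltr0n// ler_nat.
by exists k; split => //; rewrite k0 (leq_trans km).
Qed.

(** Otherwise some [core r N] has measure above 1 - e, and every orbit segment of suitable length q
    has at most e q + 1 late visits. The stopping estimate then bounds the growth over q steps by q
    (r + 2 d) < q L uniformly in x, against the definition of L. *)
Lemma early_all_neq1 r : well_approximable al -> 0 <= r -> r < L ->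
  lu (early_all r) <> 1%E.
Proof.
move=> wa r0 rL h1.
have [c [c0 c1 hc]] := lgr_bound al E.
pose d := (L - r) / 4; have d0 : 0 < d by rewrite divr_gt0// subr_gt0.
pose e := d / (c + 1).
have c10 : 0 < c + 1 by rewrite ltr_wpDl.
have e0 : 0 < e by rewrite divr_gt0.
have ce : c * e <= d by rewrite /e mulrCA ler_piMr ?(ltW d0)// ler_pdivrMr// mul1r lerDl.
have [N hN] : exists N, ((1 - e)%:E < lu (core r N))%E.
  have cv : lu \o core r @ \oo --> lu (\bigcup_N core r N).
    apply: nondecreasing_cvg_mu; last exact: nondecreasing_core.
      by move=> N; exact: measurable_deep.
    by apply: bigcup_measurable => N _; exact: measurable_deep.
  move: cv; rewrite bigcup_core h1 => cv.
  have lt1 : ((1 - e)%:E < 1%:E :> \bar R)%E by rewrite lte_fin; lra.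
  have [N _ hN] : \forall n \near \oo, ((1 - e)%:E < (lu \o core r) n)%E.
    exact: (cv _ (open_ereal_gt' lt1)).
  by exists N; exact: (hN N (leqnn N)).
(* The first term makes 2/q smaller than the depth 1/(N + 1); the second makes the constant c (2 +
   N) of the stopping estimate at most q d. *)
pose B := 2 * N.+1%:R + c * (2 + N%:R) / d.
have [p [q [qB cpq hpq]]] := wa (Num.truncn B).+1.
have q0n : (0 < q)%N by apply: leq_ltn_trans qB.
have q0 : 0 < q%:R :> R by rewrite ltr0n.
have Bq : B < q%:R.
  by apply: lt_le_trans (truncnS_gt _) _; rewrite ler_nat ltnW.
have t0 : 0 <= c * (2 + N%:R) / d by rewrite divr_ge0 ?(ltW d0)// mulr_ge0// addr_ge0.
have q1 : 2 / q%:R < N.+1%:R^-1 :> R.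
  rewrite ltr_pdivrMr// mulrC ltr_pdivlMr ?ltr0n//.
  by move: Bq t0; rewrite /B; move: (c * _ / d) (N.+1%:R) => u v; lra.
have q2 : c * (2 + N%:R) <= q%:R * d.
  rewrite -ler_pdivrMr//; apply: le_trans (ltW Bq); rewrite /B lerDr.
  by rewrite mulr_ge0.
have rL2 : r + 2 * d < L by rewrite /d; lra.
have [x] := lgr_gt q0n rL2; apply/negP; rewrite -leNgt.
apply: le_trans (lgr_stopping N r0 c0 c1 hc q x) _.
have := late_visits_card (early al E r N) q x.
have := grid_occupation (rotation_grid x q0n cpq hpq) (@early_per r N) q1.
move: (#|_|) (late_visits _ _ _ _) => K l hK lK.
have {hK} : ((1 - e)%:E <= ((1 + K%:R) / q%:R)%:E)%E by apply: ltW; apply: lt_le_trans hN hK.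
rewrite lee_fin ler_pdivlMr// => hK.
have {lK} lK : l%:R + K%:R = q%:R :> R by rewrite -natrD lK.
have hl : l%:R <= e * q%:R + 1 by lra.
have := ler_wpM2l c0 hl; have := ler_wpM2r (ltW q0) ce; lra.
Qed.

End early_visits.

(** * Points of small lower growth rate and the zero-one law *)

Section slow.
Context {R : realType}.

(** This encodes liminf f n w / n < r. The margin 1/(j + 1) lets the condition survive bounded
    changes of [f], and only countable operations occur. *)
Definition slow (T : Type) (f : nat -> T -> R) (r : R) : set T :=
  [set w | exists j : nat, forall N, exists2 n, (N <= n)%N &
    f n w < n%:R * (r - j.+1%:R^-1)].

Lemma slow_borel (T : ptopologicalType) (f : nat -> T -> R) r :
  (forall n, continuous (f n)) -> measurable (slow f r : set (borel T)).
Proof.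
move=> cf.
have -> : slow f r = \bigcup_j \bigcap_N \bigcup_(n in [set n | (N <= n)%N])
    [set w | f n w < n%:R * (r - j.+1%:R^-1)].
  apply/seteqP; split => [w [j h]|w [j _ h]]; exists j => //.
    by move=> N _; have [n Nn hn] := h N; exists n.
  by move=> N; have [n Nn hn] := h N I; exists n.
apply: bigcup_measurable => j _; apply: bigcapT_measurable => N.
apply: bigcup_measurable => n _; apply: sub_sigma_algebra.
exact: (@open_comp _ _ (f n) [set y | y < n%:R * (r - j.+1%:R^-1)] _ (@open_lt _ _)).
Qed.

Lemma slow_near (T U : Type) (f : nat -> T -> R) (g : nat -> U -> R) r w u :
  (exists K, forall n, `|f n w - g n u| <= K) -> slow f r w -> slow g r u.
Proof.
(* The new index halves the margin; the other half absorbs K once n is at least 2 K (j + 1). *)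
move=> [K hK] [j h]; exists (j + j).+1 => N.
have [n] := h (maxn N (Num.truncn (K * (2 * j.+1%:R))).+1).
rewrite geq_max => /andP[Nn Kn] hn; exists n => //.
have j0 : 0 < j.+1%:R :> R by rewrite ltr0n.
have e : (j + j).+2%:R^-1 = j.+1%:R^-1 / 2 :> R.
  by rewrite -invfM -natrM muln2 -addnn addnS addSn.
have {}Kn : K <= n%:R * (j.+1%:R^-1 / 2).
  rewrite -invfM [j.+1%:R * 2]mulrC ler_pdivlMr; last by rewrite mulr_gt0.
  by apply: le_trans (ltW (truncnS_gt _)) _; rewrite ler_nat.
have /ler_normlP[h1 h2] := hK n.
rewrite e; move: (j.+1%:R^-1) Kn hn => a; rewrite !mulrBr; lra.
Qed.

Lemma slow_cvg (T : Type) (f : nat -> T -> R) L w :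
  (forall m : nat, ~ slow f (L - m.+1%:R^-1) w) ->
  (forall r, L < r -> exists N, forall n, (N <= n)%N -> f n w <= n%:R * r) ->
  (fun n => f n w / n%:R) @ \oo --> L.
Proof.
move=> hs hu; apply/cvgrPdist_le => e e0.
have [N hN] := hu (L + e) (ltr_pwDr e0 (lexx L)).
pose m := Num.truncn (2 / e).
have m1 : 2 * m.+1%:R^-1 < e.
  by rewrite -ltr_pdivlMl// mulrC invf_plt ?posrE ?divr_gt0 ?ltr0n// invf_div truncnS_gt.
have /forallNP/(_ m)/existsNP[M hM] := hs m.
near=> n.
have n0 : 0 < n%:R :> R by rewrite ltr0n; near: n; exists 1%N.
have up : f n w <= n%:R * (L + e) by apply: hN; near: n; exists N.
have lo : n%:R * (L - m.+1%:R^-1 - m.+1%:R^-1) <= f n w.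
  rewrite leNgt; apply/negP => h; apply: hM; exists n => //; near: n; by exists M.
have {}lo : n%:R * (L - e) <= f n w.
  by apply: le_trans lo; rewrite ler_pM2l//; move: m1; move: (m.+1%:R^-1) => a; lra.
rewrite ler_distlC; apply/andP; split; first by rewrite ler_pdivlMr// mulrC.
by rewrite ler_pdivrMr// mulrC.
Unshelve. all: by end_near.
Qed.

(** If [mu B] is not 0, the normalized restriction of [mu] to [B] is again invariant; by uniqueness
    it is [mu], and it gives [B] mass 1. *)
Lemma invariant_set_0_1 (T : Type) (Omega : ptopologicalType) (phi : T -> Omega -> Omega)
    (mu : probability (borel Omega) R) (B : set (borel Omega)) :
  uniquely_ergodic phi mu -> measurable B -> (forall t, phi t @^-1` B = B) ->
  mu B = 0%E \/ mu B = 1%E.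
Proof.
move=> [inv uni] mB phiB.
have [->|B0] := eqVneq (mu B) 0%E; [by left|right].
pose nu : probability (borel Omega) R := mnormalize (mrestr mu mB) mu.
have fB : mu B \is a fin_num by exact: fin_num_measure.
have nuE A : nu A = (mu (A `&` B) * (fine (mu B))^-1%:E)%E.
  rewrite /nu /= /mnormalize /= /mrestr setTI ifF//.
  by apply/negbTE; rewrite negb_or B0 -ltey ltey_eq fB.
have inv_nu : invariant_probability phi nu.
  move=> t A mA; rewrite !nuE; congr (_ * _)%E.
  by rewrite -[in LHS](phiB t) -preimage_setI inv//; exact: measurableI.
rewrite -(uni nu inv_nu B mB) nuE setIid -[X in (X * _)%E]fineK// -EFinM divff//.
by rewrite fine_eq0.
Qed.

End slow.

(** * Bounded perturbations of growth rates *)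

Section growth_transfer.
Context {R : realType}.

Lemma bounded_over_cvg0 (T : Type) (F : set_system T) {FF : Filter F}
    (k : T -> nat) (h : T -> R) (K : R) : k @ F --> \oo ->
  (\forall t \near F, `|h t| <= K) -> (fun t => h t / (k t)%:R) @ F --> 0.
Proof.
move=> kF hK; apply/cvgr0Pnorm_le => e e0; near=> t.
have kt : ((Num.truncn (K / e)).+1 <= k t)%N.
  near: t; apply: (kF [set n | ((Num.truncn (K / e)).+1 <= n)%N]).
  by exists (Num.truncn (K / e)).+1.
have k0 : 0 < (k t)%:R :> R by rewrite ltr0n; apply: leq_trans kt.
rewrite normrM normfV [`|_%:R|]ger0_norm// ler_pdivrMr//.
have hk : `|h t| <= K by near: t.
apply: (le_trans hk); rewrite mulrC -ler_pdivrMr//.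
by apply: le_trans (ltW (truncnS_gt _)) _; rewrite ler_nat.
Unshelve. all: by end_near. Qed.

(** Numerator and denominator are divided by [k t], after which their bounded errors vanish in the
    limit. This passes from natural times to both time sets, and from [frob] to [opnorm]. *)
Lemma growth_transfer (T : Type) (F : set_system T) {FF : Filter F} (c g : T -> R)
    (k : T -> nat) (u : nat -> R) (K L : R) :
  (fun n => u n / n%:R) @ \oo --> L -> k @ F --> \oo ->
  (\forall t \near F, `|c t - (k t)%:R| <= K) ->
  (\forall t \near F, `|g t - u (k t)| <= K) ->
  (fun t => g t / c t) @ F --> L.
Proof.
move=> uL kF ck gu.
have k0 : \forall t \near F, (k t)%:R != 0 :> R.
  by apply: (kF [set n | n%:R != 0 :> R]); exists 1%N => // n /= n0; rewrite pnatr_eq0 -lt0n.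
have h1 : (fun t => u (k t) / (k t)%:R + (g t - u (k t)) / (k t)%:R) @ F --> L + 0.
  apply: cvgD; last exact: bounded_over_cvg0 kF gu.
  exact: (@cvg_comp _ _ _ k (fun n => u n / n%:R) F \oo (nbhs L)).
have h2 : (fun t => 1 + (c t - (k t)%:R) / (k t)%:R) @ F --> (1 + 0 : R).
  by apply: cvgD; [exact: cvg_cst|exact: bounded_over_cvg0 kF ck].
rewrite (_ : L = (L + 0) / (1 + 0)); last by rewrite !addr0 divr1.
have : (fun t => (u (k t) / (k t)%:R + (g t - u (k t)) / (k t)%:R) /
    (1 + (c t - (k t)%:R) / (k t)%:R)) @ F --> (L + 0) / (1 + 0).
  by apply: cvgM h1 _; apply: cvgV => //; rewrite addr0 oner_neq0.
apply: cvg_trans; apply: near_eq_cvg; near=> t.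
have kt : (k t)%:R != 0 :> R by near: t.
rewrite /= -mulrDl addrCA subrr addr0 mulrBl divff// addrCA subrr addr0.
by rewrite invf_div mulrA divfK.
Unshelve. all: by end_near. Qed.

(** The lower bound multiplies back by the inverse of [N], which has the same Frobenius norm. *)
Lemma ln_frob_mulr (M N : 'M[R]_2) : \det M = 1 -> \det N = 1 ->
  `|ln (frob (M *m N)) - ln (frob M)| <= ln (frob N).
Proof.
move=> hM hN; rewrite ler_distl; apply/andP; split; last first.
  exact: ln_frobM.
have := @ln_frobM R (M *m N) (invmx N) (det_mul1 hM hN) (det_invmx1 hN).
by rewrite -mulmxA mulmxV ?det1_unitmx// mulmx1 frob_invmx// => h; lra.
Qed.

Lemma ln_frob_mull (M N : 'M[R]_2) : \det M = 1 -> \det N = 1 ->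
  `|ln (frob (M *m N)) - ln (frob N)| <= ln (frob M).
Proof.
move=> hM hN; rewrite ler_distl; apply/andP; split; last first.
  by rewrite addrC; exact: ln_frobM.
have := @ln_frobM R (invmx M) (M *m N) (det_invmx1 hM) (det_mul1 hM hN).
by rewrite mulmxA mulVmx ?det1_unitmx// mul1mx frob_invmx// => h; lra.
Qed.

Lemma ln_opnorm_frob (M : 'M[R]_2) : \det M = 1 ->
  `|ln (opnorm M) - ln (frob M)| <= ln 2.
Proof.
move=> hM; have f0 := frob_gt0 hM.
have o0 : 0 < opnorm M by have := frob_le_opnorm M; lra.
have h1 : ln (opnorm M) <= ln (frob M) by rewrite ler_ln ?posrE// opnorm_le_frob.
have h2 : ln (frob M) <= ln 2 + ln (opnorm M).
  by rewrite -lnM ?posrE// ler_ln ?posrE ?mulr_gt0// frob_le_opnorm.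
have l2 : 0 <= ln 2 :> R by rewrite ln_ge0// ler1n.
by rewrite ler_distl; apply/andP; split; lra.
Qed.

End growth_transfer.

(** * The almost everywhere growth rate on the circle and on the suspension *)

Section lyapunov.
Context {R : realType} (al E : R).
Local Notation lg := (lgr al E).
Local Notation L := (top_rate al E).
Local Notation lu := (@lebesgue_unit R).
Local Notation dc := (discrete_cocycle al (gen E)).
Local Notation zc := (zc al E).
Local Notation fsol := (fsol al E).

Definition circle_growth (n : nat) (th : circle R) : R := ln (frob (dc n th)).

Definition torus_growth (n : nat) (w : torus al) : R := ln (frob (Phi E n%:~R w)).

Lemma circle_growth_cpi n x : circle_growth n (cpi x) = lg n x.
Proof. by rewrite /circle_growth -/(zc n x) zc_gmx. Qed.

Lemma ln_frob_zc n : exists K, forall x, ln (frob (zc n x)) <= K.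
Proof.
have [c [_ _ hc]] := lgr_bound al E.
have pos (k : nat) x : ln (frob (zc k x)) <= c + k%:R * c by rewrite zc_gmx; exact: hc.
case: n => [k|k]; first by exists (c + k%:R * c).
exists (c + k.+1%:R * c) => x.
have := @zcD R al E k.+1 (- k.+1%:Z) x; rewrite subrr zc0 => e.
rewrite -[zc _ x](mulKmx (det1_unitmx (@det_zc R al E k.+1 (x + (- k.+1%:Z)%:~R * al)))).
by rewrite -e mulmx1 frob_invmx ?det_zc.
Qed.

Lemma ln_frob_fsol y : exists K, forall x, ln (frob (fsol x y)) <= K.
Proof.
have [C C1 hC] := path_bound E; have [K hK] := ln_frob_zc (Num.floor y).
exists (ln C + K) => x; apply: le_trans (ln_frobM (det_path _ _) (det_zc _ _ _ _)) _.
apply: lerD => //; rewrite ler_ln ?posrE ?frob_gt0 ?det_path//.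
by apply: lt_le_trans C1.
Qed.

(** Starting at height y conjugates the n-step map by [fsol] at height y, whose norm is bounded
    uniformly over the base. Hence slowness at [tp al x y] depends on x alone. *)
Lemma torus_growth_tp x y : exists K, forall n, `|torus_growth n (tp al x y) - lg n x| <= K.
Proof.
have [K hK] := ln_frob_fsol y; exists (K + K) => n.
rewrite /torus_growth Phi_tp /flift fsolD -/(zc _ _).
have d1 := @det_fsol R al E (x + n%:~R * al) y.
have d2 := @det_zc R al E n x.
have d3 := det_invmx1 (@det_fsol R al E x y).
have h1 := ln_frob_mulr (det_mul1 d1 d2) d3.
have h2 := ln_frob_mull d1 d2.
rewrite frob_invmx ?det_fsol// in h1.
rewrite /lgr -zc_gmx.
move: h1 h2 (hK x) (hK (x + n%:~R * al)); move: (ln _) (ln _) (ln (frob (fsol x y))) => a b u.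
move: (ln (frob (zc n x))) => v; rewrite !ler_distl.
by move=> /andP[? ?] /andP[? ?] ? ?; apply/andP; split; lra.
Qed.

Lemma slow_tp r x y : slow torus_growth r (tp al x y) <-> slow lg r x.
Proof.
have [K hK] := torus_growth_tp x y.
split; apply: (@slow_near R); exists K => n; first exact: hK.
by rewrite distrC; exact: hK.
Qed.

Lemma slow_circle r x : slow circle_growth r (cpi x) <-> slow lg r x.
Proof.
by split; apply: slow_near; exists 0 => n; rewrite circle_growth_cpi subrr normr0.
Qed.

Lemma measurable_slow_circle r : measurable (slow circle_growth r : set (borel (circle R))).
Proof.
apply: slow_borel => n; apply: continuous_ln_frob; first exact: zc_mxcont.
by move=> th; have [x _ ->] := cpiP th; exact: (@det_zc R al E n x).
Qed.

Lemma measurable_slow_torus r : measurable (slow torus_growth r : set (borel (torus al))).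
Proof.
apply: slow_borel => n; apply: continuous_ln_frob; first exact: Phi_mxcont.
move=> w; exact: (Phi_continuous_cocycle al E).1.
Qed.

Lemma slow_circle_proj r : circle_proj @^-1` slow circle_growth r = slow lg r.
Proof. by apply/funext => x; apply/propext; exact: slow_circle. Qed.

Lemma measurable_slow r : measurable (slow lg r : set (measurableTypeR R)).
Proof.
rewrite -slow_circle_proj.
exact: (measurable_preimage (@measurable_circle_proj R) (measurable_slow_circle r)).
Qed.

Lemma lebesgue_circle_slow r : lebesgue_circle (slow circle_growth r) = lu (slow lg r).
Proof. by rewrite -slow_circle_proj. Qed.

Lemma lebesgue_torus_slow r :
  lebesgue_torus al (slow torus_growth r : set (borel (torus al))) = lu (slow lg r).
Proof.
have mB := measurable_slow_torus r.
rewrite lebesgue_torusE//.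
transitivity (\int[lu]_y (cst (lu (slow lg r)) y))%E; last first.
  by rewrite integral_cst//= lebesgue_unit_setT mule1.
apply: ge0_ae_eq_integral => //.
  exact: (measurable_fun_ysection _ (measurable_torus_preimage mB)).
apply: lebesgue_unit_ae => y /andP[y0 y1] _ /=.
congr (lu _); apply/seteqP; split => x; rewrite /ysection /= inE /= torus_projE -tp_tpi ?y0 ?ltW//.
  by move/slow_tp.
by move=> h; apply/slow_tp.
Qed.

(** The slow set of the suspension is flow-invariant and each of its slices is the slow set of the
    base, so the zero-one law for the flow descends to the base; measure 1 is excluded by
    [early_all_neq1]. *)
Lemma lebesgue_slow r : well_approximable al -> r < L -> lu (slow lg r) = 0%E.
Proof.
move=> wa rL.
have uni := torus_uniquely_ergodic wa.
have inv t : @suspension_flow R al t @^-1` slow torus_growth r = slow torus_growth r.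
  apply/funext => w; apply/propext; have [x [y [_ _ ->]]] := tpP w.
  by rewrite /preimage /mkset flow_tp; split => /slow_tp h; apply/slow_tp.
have := invariant_set_0_1 uni (measurable_slow_torus r) inv.
rewrite lebesgue_torus_slow => -[//|h1].
(* The stopping estimate needs a nonnegative rate; raising r to 0 keeps it below L, which is
   positive. *)
have m0 : 0 <= Num.max r 0 by rewrite le_max lexx orbT.
have mL : Num.max r 0 < L by rewrite gt_max rL top_rate_gt0.
have mE : measurable (early_all al E (Num.max r 0)).
  by rewrite -bigcup_core; apply: bigcup_measurable => N _; exact: measurable_deep.
case: (early_all_neq1 wa m0 mL).
apply/eqP; rewrite eq_le probability_le1//= -h1.
apply: le_measure; rewrite ?inE//; first exact: measurable_slow.
move=> x [j /(_ 1%N)[n n0 hn]]; exists n => //; apply: lt_le_trans hn _.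
rewrite ler_wpM2l// le_max; apply/orP; left.
by rewrite lerBlDr lerDl invr_ge0.
Qed.

Lemma lgr_cvg x : (forall m : nat, ~ slow lg (L - m.+1%:R^-1) x) ->
  (fun n => lg n x / n%:R) @ \oo --> L.
Proof.
move=> hs; apply: (@slow_cvg R R lg L x hs) => r Lr.
by have [N hN] := lgr_upper Lr; exists N => n /hN.
Qed.

Lemma ae_not_slow d (T : measurableType d) (mu : {measure set T -> \bar R})
    (f : nat -> T -> R) (P : T -> Prop) :
  (forall r, measurable (slow f r)) -> (forall r, r < L -> mu (slow f r) = 0%E) ->
  (forall w, (forall m : nat, ~ slow f (L - m.+1%:R^-1) w) -> P w) -> {ae mu, forall w, P w}.
Proof.
move=> mS S0 h; apply: (@negligibleS _ _ _ _ (\bigcup_m slow f (L - m.+1%:R^-1))).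
  move=> w /= nP; apply: contrapT => nS; apply: nP; apply: h => m hm.
  by apply: nS; exists m.
apply: negligible_bigcup => m; apply/negligibleP; first exact: mS.
by apply: S0; rewrite ltrBlDr ltrDl invr_gt0 ltr0n.
Qed.

Lemma circle_lyapunov : well_approximable al ->
  lyapunov_exponent (fun n : int => n%:~R) (Posz @ \oo) lebesgue_circle dc L.
Proof.
move=> wa; apply: (ae_not_slow measurable_slow_circle).
  move=> r rL; exact: (etrans (lebesgue_circle_slow r) (lebesgue_slow wa rL)).
move=> w; have [x _ ->] := cpiP w => hs.
have lx : (fun n => lg n x / n%:R) @ \oo --> L.
  by apply: lgr_cvg => m hm; apply: (hs m); apply/slow_circle.
apply: (@growth_transfer R _ _ _ _ _ absz _ (ln 2) _ lx).
- by move=> A; exact.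
- by exists 0%N => // n _ /=; rewrite subrr normr0 ln_ge0// ler1n.
- exists 0%N => // n _ /=; rewrite -circle_growth_cpi; apply: ln_opnorm_frob.
  exact: (@det_zc R al E n x).
Qed.

Lemma torus_lyapunov : well_approximable al ->
  lyapunov_exponent (fun t : R => t) (+oo : set_system R) (lebesgue_torus al) (@Phi R al E) L.
Proof.
move=> wa; apply: (ae_not_slow measurable_slow_torus).
  move=> r rL; exact: (etrans (lebesgue_torus_slow r) (lebesgue_slow wa rL)).
move=> w; have [x [y [_ y01 ->]]] := tpP w => hs.
have lx : (fun n => lg n x / n%:R) @ \oo --> L.
  by apply: lgr_cvg => m hm; apply: (hs m); apply/slow_tp.
have [C C1 hC] := path_bound E; have [K hK] := ln_frob_fsol y.
have K0 : 0 <= K by apply: le_trans (hK x); rewrite ln_ge0// frob_ge1// det_fsol.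
have l2 : 0 <= ln 2 :> R by rewrite ln_ge0// ler1n.
have lC : 0 <= ln C by rewrite ln_ge0.
have /andP[y0 y1] := y01.
have fl t : 0 <= t -> Num.floor (y + t) = `|Num.floor (y + t)|%N /\
    `|Num.floor (y + t)|%N%:R <= y + t < `|Num.floor (y + t)|%N.+1%:R.
  move=> t0; have s0 : 0 <= y + t by rewrite addr_ge0.
  have e : Num.floor (y + t) = `|Num.floor (y + t)|%N by rewrite gez0_abs// floor_ge0.
  split=> //; have := floor_itv (y + t); rewrite {1 2}e.
  by rewrite -pmulrn intrD -pmulrn natr1.
(* The error terms: ln 2 for the change of norm, ln C for the unfinished last step, K for the
   initial height, and 1 for replacing t by the floor of y + t. *)
apply: (@growth_transfer R _ _ _ _ _ (fun t => `|Num.floor (y + t)|%N) _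
  (ln 2 + ln C + K + 1) _ lx).
- move=> A [N _ NA]; exists N%:R; split; first exact: num_real.
  move=> t Nt; apply: NA => /=.
  have t0 : 0 <= t by apply: le_trans (ltW Nt).
  have [_ /andP[_ h]] := fl t t0.
  by rewrite -ltnS -(@ltr_nat R); apply: le_lt_trans h; rewrite (le_trans (ltW Nt))// lerDr.
- exists 0; split => // t /ltW t0; have [_] := fl t t0.
  rewrite -natr1 ler_distl; move: (`|_|%N%:R) => a /andP[h1 h2].
  by apply/andP; split; lra.
- exists 0; split => // t /ltW t0; have [e _] := fl t t0.
  rewrite Phi_tp /flift.
  have dM : \det (fsol x (y + t) *m invmx (fsol x y)) = 1.
    by rewrite det_mul1 ?det_invmx1 ?det_fsol.
  have h1 := ln_opnorm_frob dM.
  have h2 := ln_frob_mulr (@det_fsol R al E x (y + t)) (det_invmx1 (@det_fsol R al E x y)).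
  rewrite frob_invmx ?det_fsol// in h2.
  have h3 := hK x.
  set P := path_mx (pot E (x + (Num.floor (y + t))%:~R * al)) (fpart (y + t)).
  have h4 : `|ln (frob (fsol x (y + t))) - lg `|Num.floor (y + t)|%N x| <= ln (frob P).
    rewrite /lgr -zc_gmx -e; apply: ln_frob_mull; [exact: det_path|exact: det_zc].
  have h5 : ln (frob P) <= ln C.
    by rewrite ler_ln ?posrE ?frob_gt0 ?det_path ?hC// (lt_le_trans _ C1).
  move: h1 h2 h3 h4 h5; move: (ln (opnorm _)) (ln (frob (fsol x y))) => a b.
  move: (ln (frob (_ *m _))) (ln (frob (fsol _ (y + t)))) (lg _ x) (ln (frob P)) => c d g h.
  rewrite !ler_distl => /andP[? ?] /andP[? ?] ? /andP[? ?] ?.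
  by apply/andP; split; lra.
Qed.

End lyapunov.

(** * The bounded orbit in both cocycles *)

Section not_uniformly_hyperbolic.
Context {R : realType} (al E x : R) (p : R * R).
Hypotheses (p1 : nrm2 p = 1) (bo : bounded_orbit al E x p).

Lemma forb_borb y n (q : R * R) : forb al E (y - n%:R * al) n (borb al E y n q) = q.
Proof.
elim: n => [//|n IH]; rewrite -{2}add1n forbD /=.
rewrite mul0r addr0 bstepK mul1r.
by rewrite (_ : y - n.+1%:R * al + al = y - n%:R * al) ?IH// -natr1; ring.
Qed.

Lemma col2_neq0 : col2 p != 0.
Proof.
apply/eqP => h; have := enorm_col2 p; rewrite h p1 enorm2 !mxE expr0n /= addr0.
by move/eqP; rewrite eq_sym oner_eq0.
Qed.

Lemma enorm_le1 (q : R * R) : nrm2 q <= 1 -> enorm (col2 q) <= 1.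
Proof. by move=> h; rewrite le_enorm// expr1n -enorm2 enorm_col2. Qed.

Lemma zc_unit n (y : R) : zc al E n y \in unitmx. Proof. by rewrite det1_unitmx// det_zc. Qed.

Lemma zc_col2 n : enorm (zc al E (Posz n) x *m col2 p) <= 1.
Proof. by rewrite zc_gmx gmx_forb enorm_le1//; case: (bo n). Qed.

Lemma zc_borb n : zc al E (Posz n) (x - n%:R * al) *m col2 (borb al E x n p) = col2 p.
Proof. by rewrite zc_gmx gmx_forb forb_borb. Qed.

Lemma circle_not_uniformly_hyperbolic :
  ~ uniformly_hyperbolic (fun n : int => n%:~R : R) (rotation al)
      (discrete_cocycle al (gen E)).
Proof.
apply: (@bounded_orbit_not_uniformly_hyperbolic _ _ _ _ _ _ (cpi x) (col2 p) 1
  Posz (fun n => cpi (x - n%:R * al)) (fun n => col2 (borb al E x n p))).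
- exact: col2_neq0.
- by move=> n; exact: (zc_unit (Posz n) (x - n%:R * al)).
- by [].
- exact: zc_col2.
- by move=> n; rewrite rotation_cpi subrK.
- exact: zc_borb.
- by move=> n; rewrite enorm_le1//; case: (bo n).
Qed.

Lemma Phi_int n y : Phi E n%:R (tp al y 0) = zc al E (Posz n) y.
Proof.
rewrite Phi_tp /flift add0r -[n%:R]/(n%:~R) fsol_int -[0]/(0%:~R) fsol_int.
by rewrite zc0 invmx1 mulmx1.
Qed.

Lemma torus_not_uniformly_hyperbolic :
  ~ uniformly_hyperbolic (fun t : R => t) (@suspension_flow R al) (@Phi R al E).
Proof.
apply: (@bounded_orbit_not_uniformly_hyperbolic _ _ _ _ _ _ (tp al x 0) (col2 p) 1
  (fun n => n%:R) (fun n => tp al (x - n%:R * al) 0) (fun n => col2 (borb al E x n p))).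
- exact: col2_neq0.
- by move=> n; rewrite Phi_int zc_unit.
- by [].
- by move=> n; rewrite Phi_int zc_col2.
- move=> n; rewrite flow_tp (tpDy al (x - n%:R * al) 0 n).
  by rewrite -pmulrn subrK.
- by move=> n; rewrite Phi_int zc_borb.
- by move=> n; rewrite enorm_le1//; case: (bo n).
Qed.

End not_uniformly_hyperbolic.

Theorem mainTheorem4 (R : realType) :
  (exists (alpha : R) (A : circle R -> 'M[R]_2),
    [/\ irrational alpha, SL2_generator A,
        discrete_nonuniformly_hyperbolic alpha A,
        uniquely_ergodic (@suspension_flow R alpha) (lebesgue_torus alpha) &
        exists Phi : R -> torus alpha -> 'M[R]_2,
          [/\ continuous_cocycle (@suspension_flow R alpha) Phi,
              canonical_extension A Phi &
              flow_nonuniformly_hyperbolic (@suspension_flow R alpha)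
                (lebesgue_torus alpha) Phi]]) /\
  (exists (Omega : ptopologicalType) (phi : R -> Omega -> Omega)
      (mu : probability (borel Omega) R) (Phi : R -> Omega -> 'M[R]_2),
    [/\ compact [set: Omega] /\ hausdorff_space Omega, continuous_flow phi,
        uniquely_ergodic phi mu, continuous_cocycle phi Phi &
        flow_nonuniformly_hyperbolic phi mu Phi]).
Proof.
have wa := sqrt2_well_approximable R.
have s02 : 0 <= @sqrt2 R <= 2 by rewrite sqrt2_le2 (le_trans ler01)// sqrt2_ge1.
have [E [x [v [_ v1 bo]]]] := exists_bounded_orbit s02.
have uni := torus_uniquely_ergodic wa.
have cc := Phi_continuous_cocycle (@sqrt2 R) E.
have nu : flow_nonuniformly_hyperbolic (@suspension_flow R sqrt2)
    (lebesgue_torus sqrt2) (@Phi R sqrt2 E).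
  split; last exact: (@torus_not_uniformly_hyperbolic R _ _ x v).
  by exists (top_rate sqrt2 E); split; [exact: torus_lyapunov|exact: top_rate_gt0].
split.
  exists sqrt2, (gen E); split => //.
  - exact: sqrt2_irrational.
  - exact: gen_SL2.
  - split; last exact: (@circle_not_uniformly_hyperbolic R _ _ x v).
    by exists (top_rate sqrt2 E); split; [exact: circle_lyapunov|exact: top_rate_gt0].
  - by exists (@Phi R sqrt2 E); split => //; exact: Phi_canonical.
exists (torus (@sqrt2 R)), (@suspension_flow R sqrt2), (lebesgue_torus sqrt2), (@Phi R sqrt2 E).
split => //; [split; [exact: torus_compact|exact: torus_hausdorff]|].
exact: suspension_continuous_flow.
Qed.
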